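(* Let $T=1$ and let $u$ be the mild solution of $\partial_tu=\Delta u+f(u)+\xi$ on $[0,1]\times\mathbb{T}$ with $u_0=0$ and $f(u)=u$. For $M\in\mathbb{N}$ and $I\subset\mathbb{R}$ let $$\mathcal{G}_{M,I}=\sigma\big(\hat O_{t_k}(n):\ k=0,\dots,M,\ n\in I\cap\mathbb{Z}\big),\qquad t_k=k/M,$$ where $\hat O_t$ is the Fourier transform of the stochastic convolution $O_t$. Then for all sufficiently large $M,N$ one has $$\inf_{Z}\Big\|\|u_1-Z\|_{L^2(\mathbb{T})}\Big\|_{L^2(\Omega)}=\Big\|\big\|u_1-\mathbb{E}(u_1\,|\,\mathcal{G}_{M,[-N,N]})\big\|_{L^2(\mathbb{T})}\Big\|_{L^2(\Omega)}\ \ge\ \frac{M^{-1}+N^{-1/2}}{30},$$ where the infimum runs over all $\mathcal{G}_{M,[-N,N]}$-measurable $L^2(\mathbb{T})$-valued random variables $Z$.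
   Context: $\mathbb{T}=\mathbb{R}/\mathbb{Z}$. Space-time white noise $\xi$ on a probability space $(\Omega,\mathcal{F},\mathbb{P})$ is a map from the Borel sets of $[0,1]\times\mathbb{T}$ to $L^2(\Omega)$ such that for Borel sets $A_1,\dots,A_k$ the vector $(\xi(A_1),\dots,\xi(A_k))$ is centred Gaussian with $\mathbb{E}[\xi(A_i)\xi(A_j)]=\lambda(A_i\cap A_j)$, $\lambda$ the Lebesgue measure; stochastic integrals of deterministic integrands are given by the linear isometric extension of $\mathbf{1}_A\mapsto\xi(A)$ to $L^2([0,1]\times\mathbb{T})$. The Fourier transform is $\hat g(n)=\int_{\mathbb{T}}e^{-2\pi inx}g(x)dx$, $n\in\mathbb{Z}$. $P_t$ is the heat semigroup, $\widehat{P_tg}(k)=e^{-4\pi^2k^2t}\hat g(k)$, with kernel $p_t(x)=\sum_{k\in\mathbb{Z}}e^{-4\pi^2k^2t}e^{2\pi ikx}$. The stochastic convolution is $O_t(x)=\int_0^t\int_{\mathbb{T}}p_{t-s}(x-y)\,\xi(ds,dy)$ (continuous version). The mild solution is the adapted process with paths in $C([0,1];C(\mathbb{T}))$ satisfying $u_t=P_tu_0+\int_0^tP_{t-s}f(u_s)ds+O_t$ for all $t\in[0,1]$. *)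

(* Defs.v *)
From HB Require Import structures.
From mathcomp Require Import all_boot all_order all_algebra.
From mathcomp Require Import complex.
From mathcomp Require Import all_classical all_reals all_analysis.

Set Implicit Arguments.
Unset Strict Implicit.
Unset Printing Implicit Defensive.

Import Order.TTheory GRing.Theory Num.Theory.
Import numFieldNormedType.Exports.

Local Open Scope classical_set_scope.
Local Open Scope ring_scope.
Local Open Scope complex_scope.

(* The torus R/Z is represented by its fundamental domain [0, 1[: a measure on
   the torus is a measure on R restricted to [0, 1[, and a function that is
   evaluated pointwise on the torus is a 1-periodic function on R. *)
Section Spaces.
Context {R : realType}.

Definition torus_dom : set R := `[0, 1[%classic.

Lemma measurable_torus_dom : measurable torus_dom.
Proof. exact: measurable_itv. Qed.

Definition torus_mu := mrestr lebesgue_measure measurable_torus_dom.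

HB.instance Definition _ := Measure.on torus_mu.

Definition spacetime_dom : set (R * R) := `[0, 1]%classic `*` torus_dom.

Lemma measurable_spacetime_dom : measurable spacetime_dom.
Proof. by apply: measurableX; exact: measurable_itv. Qed.

Definition spacetime_mu :=
  mrestr (lebesgue_measure \x lebesgue_measure)%E measurable_spacetime_dom.

HB.instance Definition _ := Measure.on spacetime_mu.

(* Paths in C([0,1]; C(T)), with the supremum norm on C(T). *)
Definition path_CT (v : R -> R -> R) : Prop :=
  [/\ forall t, t \in `[0, 1] -> continuous (v t),
      forall t x, t \in `[0, 1] -> v t (x + 1) = v t x
    & {within `[0, 1], continuous (v : R -> {uniform R -> R})}].

End Spaces.

Section Fourier.
Context {R : realType}.

(* e^{2 pi i n x} *)
Definition expi (n : int) (x : R) : R[i] :=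
  cos (2 * pi * n%:~R * x) +i* sin (2 * pi * n%:~R * x).

Definition cintegral (h : R -> R[i]) : R[i] :=
  (\int[torus_mu]_x complex.Re (h x)) +i* (\int[torus_mu]_x complex.Im (h x)).

Definition fourier (g : R -> R) (n : int) : R[i] :=
  cintegral (fun x => expi (- n) x * (g x)%:C).

(* The symmetric partial sums over |k| <= K are real, because the terms k and
   -k are conjugate; meaningful for t > 0. *)
Definition heat_kernel (t x : R) : R :=
  limn (fun K : nat => complex.Re (\sum_(0 <= j < (2 * K).+1)
    let k : int := j%:Z - K%:Z in
    (expR (- (4 * pi ^+ 2 * k%:~R ^+ 2 * t)))%:C * expi k x)).

Definition heat_semigroup (t : R) (g : R -> R) (x : R) : R :=
  if 0 < t then \int[torus_mu]_y (heat_kernel t (x - y) * g y) else g x.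

End Fourier.

Section Noise.
Context {R : realType} {d : measure_display} {Omega : measurableType d}.
Variable P : probability Omega R.

(* normal_prob 0 0 is not the Dirac mass at 0 in the library, hence the case
   distinction: degenerate Gaussians are allowed. *)
Definition centred_gaussian (X : Omega -> R) : Prop :=
  measurable_fun setT X /\
  exists2 s : R, 0 <= s & forall B : set R, measurable B ->
    P (X @^-1` B) = if s == 0 then dirac (0 : R) B else normal_prob 0 s B.

Definition centred_gaussian_vector (k : nat) (X : 'I_k -> Omega -> R) : Prop :=
  forall a : 'I_k -> R, centred_gaussian (fun w => \sum_(i < k) a i * X i w).

Definition borel_spacetime (A : set (R * R)) : Prop :=
  measurable A /\ A `<=` spacetime_dom.

Definition white_noise (xi : set (R * R) -> Omega -> R) : Prop :=
  (forall A, borel_spacetime A -> xi A \in Lfun P 2%:E) /\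
  forall (k : nat) (A : 'I_k -> set (R * R)),
    (forall i, borel_spacetime (A i)) ->
    centred_gaussian_vector (fun i => xi (A i)) /\
    forall i j, ('E_P[xi (A i) \* xi (A j)] = spacetime_mu (A i `&` A j))%E.

(* The integral of phi is I phi; it is determined up to a null set by the
   conditions, since simple functions are dense in L^2([0,1] x T). *)
Definition stochastic_integral (xi : set (R * R) -> Omega -> R)
    (I : (R * R -> R) -> Omega -> R) : Prop :=
  [/\ forall phi, phi \in Lfun spacetime_mu 2%:E ->
        I phi \in Lfun P 2%:E /\
        ('N[P]_2%:E[EFin \o I phi] = 'N[spacetime_mu]_2%:E[EFin \o phi])%E,
      forall (a b : R) phi psi, phi \in Lfun spacetime_mu 2%:E ->
        psi \in Lfun spacetime_mu 2%:E ->
        {ae P, forall w,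
          I (fun z => a * phi z + b * psi z) w = a * I phi w + b * I psi w}
    & forall A, borel_spacetime A -> {ae P, forall w, I \1_A w = xi A w}].

Definition convolution_kernel (t x : R) (z : R * R) : R :=
  if z.1 < t then heat_kernel (t - z.1) (x - z.2) else 0.

(* Processes indexed by t take values in functions of x: O t w x. *)
Definition stochastic_convolution (I : (R * R -> R) -> Omega -> R)
    (O : R -> Omega -> R -> R) : Prop :=
  [/\ forall t x, t \in `[0, 1] -> measurable_fun setT (fun w => O t w x),
      forall t x, t \in `[0, 1] ->
        {ae P, forall w, O t w x = I (convolution_kernel t x) w}
    & forall w, path_CT (fun t => O t w)].

(* The natural filtration of the noise, completed by the null sets of P. *)
Definition noise_filtration (xi : set (R * R) -> Omega -> R) (t : R) :
    set (set Omega) :=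
  <<s [set E | (exists A B, [/\ borel_spacetime A,
                  A `<=` `[0, t]%classic `*` torus_dom, measurable B
                  & E = xi A @^-1` B])
               \/ (measurable E /\ P E = 0%E)] >>.

Definition mild_solution (xi : set (R * R) -> Omega -> R)
    (O : R -> Omega -> R -> R) (f : R -> R) (u0 : R -> R)
    (u : R -> Omega -> R -> R) : Prop :=
  [/\ forall t x (B : set R), t \in `[0, 1] -> measurable B ->
        noise_filtration xi t [set w | B (u t w x)],
      forall w, path_CT (fun t => u t w)
    & {ae P, forall w, forall t x, t \in `[0, 1] ->
        u t w x = heat_semigroup t u0 x
          + \int[lebesgue_measure]_(s in `[0, t])
              heat_semigroup (t - s) (fun y => f (u s w y)) x
          + O t w x}].

(* The sigma-algebra generated by the complex random variables
   \hat O_{k/M}(n), k = 0, ..., M, n in I. *)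
Definition sigma_fourier (O : R -> Omega -> R -> R) (M : nat) (I : set R) :
    set (set Omega) :=
  <<s [set E | exists (k : nat) (n : int) (B1 B2 : set R),
       [/\ (k <= M)%N, I n%:~R, measurable B1, measurable B2
         & E = [set w | let z := fourier (O (k%:R / M%:R) w) n in
                        B1 (complex.Re z) /\ B2 (complex.Im z)]]] >>.

End Noise.

Section L2valued.
Context {R : realType} {d : measure_display} {Omega : measurableType d}.
Variable P : probability Omega R.

Definition L2T : set (R -> R) := [set g | g \in Lfun (torus_mu (R := R)) 2%:E].

Definition L2T_norm (g : R -> R) : \bar R := 'N[torus_mu]_2%:E[EFin \o g]%E.

Definition L2T_inner (g h : R -> R) : R := \int[torus_mu]_x (g x * h x).

(* Elements of L^2(T) are given by representatives; open sets are those of the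
   seminorm, hence stable under almost everywhere equality. *)
Definition L2T_open (U : set (R -> R)) : Prop :=
  U `<=` L2T /\ forall g, U g -> exists2 e : R, 0 < e &
    forall h, L2T h -> (L2T_norm (g \- h)%R < e%:E)%E -> U h.

Definition L2T_borel : set (set (R -> R)) := <<s L2T, L2T_open >>.

Definition L2T_random_variable (G : set (set Omega)) (Z : Omega -> R -> R) :
    Prop :=
  (forall w, L2T (Z w)) /\ forall B, L2T_borel B -> G (Z @^-1` B).

(* V is a version of E(X | G); the equality of the L^2(T)-valued integrals of V
   and X over A is tested against all h in L^2(T). *)
Definition cond_expectation (G : set (set Omega)) (X V : Omega -> R -> R) :
    Prop :=
  [/\ L2T_random_variable G V,
      (\int[P]_w L2T_norm (V w) < +oo)%E
    & forall A h, G A -> L2T h ->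
        \int[P]_(w in A) L2T_inner (V w) h =
        \int[P]_(w in A) L2T_inner (X w) h].

Definition L2_distance (X Z : Omega -> R -> R) : \bar R :=
  'N[P]_2%:E[(fun w => L2T_norm (X w \- Z w)%R)]%E.

End L2valued.

(* Main.v *)
From HB Require Import structures.
Require Import Defs.
From mathcomp Require Import all_boot all_order all_algebra.
From mathcomp Require Import complex.
From mathcomp Require Import all_classical all_reals all_analysis.
From mathcomp Require Import measurable_realfun.
From mathcomp Require Import ring lra zify.
Set Implicit Arguments.
Unset Strict Implicit.
Unset Printing Implicit Defensive.
Import Order.TTheory GRing.Theory Num.Theory.
Import numFieldNormedType.Exports.
Local Open Scope classical_set_scope.
Local Open Scope ring_scope.

(* Duhamel's formula turns the linear drift into the deterministic integrand
   Phi_x(s, y) = e^{1-s} p_{1-s}(x - y): almost surely u_1(x) is the Wiener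
   integral of Phi_x.  The real and imaginary parts of the observed modes are
   Wiener integrals of finitely many kernels psi_j, and uncorrelated Wiener
   integrals are independent, so E(u_1(x) | G) is obtained by projecting Phi_x
   onto the span of the psi_j.

   By Bessel's inequality the squared distance is at least the sum of the
   normalised errors of <u_1, cos(2 pi l x)> for l = 0 and N < l <= 2N, and each
   error is bounded below by the squared correlation with a Wiener integral of
   some chi(s) cos(2 pi l y) orthogonal to all psi_j.  For l = 0, the function
   chi(s) = sin(2 pi M s) has integral 0 over every [0, k/M] and gives an error
   of order M^-2.  For l > N every chi is allowed, and
   chi(s) = e^{-(4 pi^2 l^2 - 1)(1 - s)} gives an error of order l^-2; these sum
   up to order N^-1. *)

(** Independence is reached without joint laws: the law of a Wiener integral depends only on the
    norm of its integrand, so for orthogonal [phi] and [psi] the integrals of t phi + psi and t phi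
    - psi have the same law, and product-to-sum formulas do the rest.

    The norm of u_1 - Z is never shown to be measurable in w. Competitors are therefore compared
    through inner products with fixed functions, and averages over the cells of a grid recover the
    norm in the limit.

    In the mode l = 0, which the heat flow does not damp, sin(2 pi M s) is invisible to every
    observation; but u_1 weights the noise by e^{1-s}, which is not constant, and this detects it.
    For l > N, [chi] is the time factor of Phi itself, so the bound is the whole variance of that
    mode.

    With a = M^-1 and b = N^{-1/2} the squared distance is at least a^2/256 + b^2/384, whereas (a +
    b)^2/900 is at most (a^2 + b^2)/450. *)

(** * Integrals of real-valued functions *)

Section RealIntegrable.
Context d (T : measurableType d) (R : realType).
Variable mu : {measure set T -> \bar R}.
Implicit Types f g : T -> R.

Lemma rint_measurable f : mu.-integrable setT (EFin \o f) -> measurable_fun setT f.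
Proof. by move=> /measurable_int/measurable_EFinP. Qed.

Lemma rintD f g : mu.-integrable setT (EFin \o f) -> mu.-integrable setT (EFin \o g) ->
  mu.-integrable setT (EFin \o (fun x => f x + g x)).
Proof. by move=> intf intg; apply: (@integrableD _ _ _ mu _ measurableT _ _ intf intg). Qed.

Lemma rintZ a f : mu.-integrable setT (EFin \o f) ->
  mu.-integrable setT (EFin \o (fun x => a * f x)).
Proof. by move=> intf; apply: (@integrableZl _ _ _ mu _ measurableT a _ intf). Qed.

Lemma rintB f g : mu.-integrable setT (EFin \o f) -> mu.-integrable setT (EFin \o g) ->
  mu.-integrable setT (EFin \o (fun x => f x - g x)).
Proof. by move=> intf intg; apply: (@integrableB _ _ _ mu _ measurableT _ _ intf intg). Qed.

Lemma rint_le f g : measurable_fun setT f -> mu.-integrable setT (EFin \o g) ->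
  (forall x, `|f x| <= g x) -> mu.-integrable setT (EFin \o f).
Proof.
move=> mf ig fg; apply: le_integrable ig => //=; first exact/measurable_EFinP.
by move=> x _; rewrite lee_fin (le_trans (fg x))// ler_norm.
Qed.

Lemma rintM_bounded c f g : measurable_fun setT f -> (forall x, `|f x| <= c) ->
  mu.-integrable setT (EFin \o g) -> mu.-integrable setT (EFin \o (fun x => f x * g x)).
Proof.
move=> mf fc ig; apply: (@rint_le _ (fun x => c * `|g x|)).
- by apply: measurable_funM => //; exact: rint_measurable.
- by apply: rintZ; exact: integrable_norm.
- by move=> x; rewrite normrM ler_wpM2r.
Qed.

Lemma rint_sum (I : Type) (r : seq I) (P : pred I) (F : I -> T -> R) :
  (forall i, P i -> mu.-integrable setT (EFin \o F i)) ->
  mu.-integrable setT (EFin \o (fun x => \sum_(i <- r | P i) F i x)).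
Proof.
move=> iF; elim: r => [|i r IH].
  by under eq_fun do rewrite big_nil; exact: integrable0.
under eq_fun do rewrite big_cons.
case Pi : (P i) => //.
by apply: rintD => //; exact: iF.
Qed.

Lemma Rintegral_sum (I : Type) (r : seq I) (P : pred I) (F : I -> T -> R) :
  (forall i, P i -> mu.-integrable setT (EFin \o F i)) ->
  \int[mu]_x (\sum_(i <- r | P i) F i x) = \sum_(i <- r | P i) \int[mu]_x F i x.
Proof.
move=> iF; elim: r => [|i r IH].
  under eq_Rintegral do rewrite big_nil.
  by rewrite big_nil /Rintegral integral0.
rewrite big_cons.
under eq_Rintegral do rewrite big_cons.
case Pi : (P i) => //.
by rewrite RintegralD ?IH//; [exact: iF|exact: rint_sum].
Qed.

Lemma ae_eq_Rintegral f g : measurable_fun setT f -> measurable_fun setT g ->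
  ae_eq mu setT f g -> \int[mu]_x f x = \int[mu]_x g x.
Proof.
move=> mf mg fg; congr fine; apply: ae_eq_integral => //; try exact/measurable_EFinP.
by apply: filterS fg => x /(_ I) /= ->.
Qed.

Lemma rint_ae f g : measurable_fun setT g ->
  ae_eq mu setT f g -> mu.-integrable setT (EFin \o f) -> mu.-integrable setT (EFin \o g).
Proof.
move=> mg fg intf; have mf := rint_measurable intf.
move/integrableP : intf => [_ intf]; apply/integrableP; split; first exact/measurable_EFinP.
apply: le_lt_trans intf.
rewrite (@ge0_ae_eq_integral _ _ _ _ _ (abse \o (EFin \o g)) (abse \o (EFin \o f)))//.
- by apply: measurableT_comp => //; exact/measurable_EFinP.
- by apply: measurableT_comp => //; exact/measurable_EFinP.
- by move=> x _ /=.
- by move=> x _ /=.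
- by apply: filterS fg => x /= /(_ I) <-.
Qed.

Lemma dominated_Rintegral (F : nat -> T -> R) f g :
  (forall n, measurable_fun setT (F n)) -> measurable_fun setT f ->
  (forall x, F n x @[n --> \oo] --> f x) ->
  mu.-integrable setT (EFin \o g) -> (forall n x, `|F n x| <= g x) ->
  \int[mu]_x F n x @[n --> \oo] --> \int[mu]_x f x.
Proof.
move=> mF mf Ff ig Fg.
have [intf _ H] := @dominated_convergence _ _ _ mu setT measurableT
  (fun n => EFin \o F n) (EFin \o f) (EFin \o g)
  (fun n => (measurable_EFinP _ _).2 (mF n)) ((measurable_EFinP _ _).2 mf)
  ltac:(apply: nearW => x _; apply: cvg_EFin; [exact: nearW|exact: Ff]) ig
  ltac:(apply: nearW => x n _; rewrite lee_fin; exact: Fg).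
have fin : (\int[mu]_x (EFin \o f) x)%E \is a fin_num by exact: integrable_fin_num.
apply: fine_cvg; rewrite fineK//; exact: H.
Qed.

End RealIntegrable.

(** * Inner products of square-integrable functions *)

Section SquareIntegrable.
Context d (T : measurableType d) (R : realType).
Variable mu : {measure set T -> \bar R}.
Implicit Types f g h : T -> R.

Local Notation L2 f := (f \in Lfun mu 2%:E).

Lemma Lfun2P f : L2 f <->
  measurable_fun setT f /\ mu.-integrable setT (EFin \o (fun x => f x ^+ 2)).
Proof.
split=> [Lf|[mf /integrableP[mf2 intf]]].
  split; last exact: Lfun2_integrable_sqr.
  by move: Lf; rewrite inE => /andP[]; rewrite inE.
rewrite inE; apply/andP; split; rewrite inE//=.
rewrite /finite_norm unlock /Lnorm poweR_lty//.
apply: le_lt_trans intf; apply: ge0_le_integral => //=.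
- apply/measurable_EFinP; apply: (measurableT_comp (measurable_powR _)) => //.
  exact: measurableT_comp.
- by apply/measurable_EFinP; apply: measurableT_comp => //; apply/measurable_EFinP.
- by move=> x _; rewrite lee_fin powR_mulrn// normrX.
Qed.

Lemma Lfun2_measurable f : L2 f -> measurable_fun setT f.
Proof. by move=> /Lfun2P[]. Qed.

Lemma Lfun2_dominated f g : measurable_fun setT f ->
  mu.-integrable setT (EFin \o g) -> (forall x, f x ^+ 2 <= g x) -> L2 f.
Proof.
move=> mf ig fg; apply/Lfun2P; split => //.
apply: le_integrable ig => //=.
  by apply/measurable_EFinP; exact: measurable_funX.
by move=> x _; rewrite lee_fin ger0_norm ?sqr_ge0// (le_trans (fg x))// ler_norm.
Qed.

Lemma Lfun2_integrableM f g : L2 f -> L2 g ->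
  mu.-integrable setT (EFin \o (fun x => f x * g x)).
Proof. by move=> Lf Lg; apply/Lfun1_integrable; exact: Lfun2_mul_Lfun1. Qed.

Lemma Lfun2_comb a b f g : L2 f -> L2 g -> L2 (fun x => a * f x + b * g x).
Proof.
move=> /Lfun2P[mf intf] /Lfun2P[mg intg].
apply: (@Lfun2_dominated _ (fun x => 2 * a ^+ 2 * f x ^+ 2 + 2 * b ^+ 2 * g x ^+ 2)).
- by apply: measurable_funD; apply: measurable_funM.
- by apply: rintD; apply: rintZ.
- by move=> x; rewrite -subr_ge0 (_ : _ - _ = (a * f x - b * g x) ^+ 2) ?sqr_ge0//; ring.
Qed.

Lemma Lfun2D f g : L2 f -> L2 g -> L2 (fun x => f x + g x).
Proof.
move=> Lf Lg; rewrite (_ : (fun _ => _) = (fun x => 1 * f x + 1 * g x)).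
  exact: Lfun2_comb.
by apply/funext => x; rewrite !mul1r.
Qed.

Lemma Lfun2B f g : L2 f -> L2 g -> L2 (fun x => f x - g x).
Proof.
move=> Lf Lg; rewrite (_ : (fun _ => _) = (fun x => 1 * f x + (-1) * g x)).
  exact: Lfun2_comb.
by apply/funext => x; rewrite mul1r mulN1r.
Qed.

Lemma Lfun2Z a f : L2 f -> L2 (fun x => a * f x).
Proof.
move=> Lf; rewrite (_ : (fun _ => _) = (fun x => a * f x + 0 * f x)).
  exact: Lfun2_comb.
by apply/funext => x; rewrite mul0r addr0.
Qed.

Lemma Lfun2_0 : L2 (fun=> 0).
Proof.
apply/Lfun2P; split => //.
by rewrite (_ : _ \o _ = cst 0%E); [exact: integrable0|apply/funext=> x/=; rewrite expr0n].
Qed.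

Lemma Lfun2_sum (I : Type) (r : seq I) (P : pred I) (F : I -> T -> R) :
  (forall i, P i -> L2 (F i)) -> L2 (fun x => \sum_(i <- r | P i) F i x).
Proof.
move=> LF; elim: r => [|i r IH].
  by under eq_fun do rewrite big_nil; exact: Lfun2_0.
under eq_fun do rewrite big_cons.
case Pi : (P i) => //.
by apply: Lfun2D => //; exact: LF.
Qed.

Lemma Lfun2_ae f g : measurable_fun setT g -> ae_eq mu setT f g -> L2 f -> L2 g.
Proof.
move=> mg fg /Lfun2P[mf intf]; apply/Lfun2P; split => //.
apply: rint_ae intf; first exact: measurable_funX.
by apply: filterS fg => x /= /(_ I) <-.
Qed.

Definition ip f g := \int[mu]_x (f x * g x).

Lemma ipC f g : ip f g = ip g f.
Proof. by apply: eq_Rintegral => x _; rewrite mulrC. Qed.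

Lemma ip_combl a b f g h : L2 f -> L2 g -> L2 h ->
  ip (fun x => a * f x + b * g x) h = a * ip f h + b * ip g h.
Proof.
move=> Lf Lg Lh; rewrite /ip.
under eq_Rintegral do rewrite mulrDl -!mulrA.
by rewrite RintegralD//= ?RintegralZl//; try apply: rintZ; exact: Lfun2_integrableM.
Qed.

Lemma ip_combr a b f g h : L2 f -> L2 g -> L2 h ->
  ip h (fun x => a * f x + b * g x) = a * ip h f + b * ip h g.
Proof. by move=> Lf Lg Lh; rewrite ipC ip_combl// !(ipC h). Qed.

Lemma ipDl f g h : L2 f -> L2 g -> L2 h ->
  ip (fun x => f x + g x) h = ip f h + ip g h.
Proof.
move=> Lf Lg Lh; rewrite -[ip f h]mul1r -[ip g h]mul1r -ip_combl//.
by congr ip; apply/funext => x; rewrite !mul1r.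
Qed.

Lemma ipDr f g h : L2 f -> L2 g -> L2 h ->
  ip h (fun x => f x + g x) = ip h f + ip h g.
Proof. by move=> Lf Lg Lh; rewrite ipC ipDl// !(ipC h). Qed.

Lemma ipBl f g h : L2 f -> L2 g -> L2 h ->
  ip (fun x => f x - g x) h = ip f h - ip g h.
Proof.
move=> Lf Lg Lh; rewrite -[ip f h]mul1r -mulN1r -ip_combl//.
by congr ip; apply/funext => x; rewrite mul1r mulN1r.
Qed.

Lemma ipZl a f h : L2 f -> L2 h -> ip (fun x => a * f x) h = a * ip f h.
Proof.
move=> Lf Lh; rewrite -[RHS]addr0 -[X in _ + X](mul0r (ip f h)) -ip_combl//.
by congr ip; apply/funext => x; rewrite mul0r addr0.
Qed.

Lemma ipBr f g h : L2 f -> L2 g -> L2 h ->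
  ip h (fun x => f x - g x) = ip h f - ip h g.
Proof. by move=> Lf Lg Lh; rewrite ipC ipBl// !(ipC h). Qed.

Lemma ipZr a f h : L2 f -> L2 h -> ip h (fun x => a * f x) = a * ip h f.
Proof. by move=> Lf Lh; rewrite ipC ipZl// (ipC h). Qed.

Lemma ip0l h : ip (fun=> 0) h = 0.
Proof. by rewrite /ip; under eq_Rintegral do rewrite mul0r; rewrite /Rintegral integral0. Qed.

Lemma ip_suml (I : Type) (r : seq I) (P : pred I) (F : I -> T -> R) h :
  (forall i, P i -> L2 (F i)) -> L2 h ->
  ip (fun x => \sum_(i <- r | P i) F i x) h = \sum_(i <- r | P i) ip (F i) h.
Proof.
move=> LF Lh; elim: r => [|i r IH].
  by under eq_fun do rewrite big_nil; rewrite big_nil ip0l.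
rewrite big_cons.
under eq_fun do rewrite big_cons.
case Pi : (P i) => //.
by rewrite ipDl ?IH//; [exact: LF|exact: Lfun2_sum].
Qed.

Lemma ip_ge0 f : 0 <= ip f f.
Proof. by apply: Rintegral_ge0 => x _; rewrite -expr2 sqr_ge0. Qed.

Lemma ipE f : ip f f = \int[mu]_x (f x ^+ 2).
Proof. by apply: eq_Rintegral => x _; rewrite expr2. Qed.

Lemma ip_integral f : L2 f -> (\int[mu]_x (f x ^+ 2)%:E = (ip f f)%:E)%E.
Proof.
move=> /Lfun2P[mf intf]; rewrite ipE fineK//.
exact: integrable_fin_num.
Qed.

Lemma ip_sqrD f g : L2 f -> L2 g ->
  ip (fun x => f x + g x) (fun x => f x + g x) = ip f f + 2 * ip f g + ip g g.
Proof.
move=> Lf Lg; have LD := Lfun2D Lf Lg.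
by rewrite ipDl// !ipDr// (ipC g f); ring.
Qed.

Lemma ip_CS f g : L2 f -> L2 g -> ip f g ^+ 2 <= ip f f * ip g g.
Proof.
move=> Lf Lg.
have H a b : 0 <= a ^+ 2 * ip f f + 2 * (a * b) * ip f g + b ^+ 2 * ip g g.
  have := ip_ge0 (fun x => a * f x + b * g x).
  have LL := Lfun2_comb a b Lf Lg.
  rewrite ip_combl// !ip_combr// (ipC g f) => /le_trans; apply.
  by rewrite le_eqVlt; apply/orP; left; apply/eqP; ring.
have [g0|g0] := eqVneq (ip g g) 0.
  have := H 1 (- (1 + ip f f) * ip f g / 2).
  rewrite g0 !mulr0 => H1.
  suff /eqP : ip f g ^+ 2 = 0 by rewrite sqrf_eq0 => /eqP ->; rewrite expr0n.
  have f0 := ip_ge0 f.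
  apply/eqP; rewrite eq_le sqr_ge0 andbT.
  (* With b = -(1 + ip f f) / ip f g and ip g g = 0 the quadratic form takes the value -2 - ip f f,
     which is negative. *)
  have [//|] := leP (ip f g ^+ 2) 0; have := H 1 (- (1 + ip f f) / ip f g).
  rewrite g0 => H2 h; exfalso.
  have fg0 : ip f g != 0 by apply: contraTneq h => ->; rewrite expr0n ltxx.
  move: H2; rewrite mul1r expr1n mul1r mulr0 addr0 -!mulrA mulVf// mulr1; lra.
have := H (ip g g) (- ip f g); have gg := ip_ge0 g.
have gg0 : 0 < ip g g by rewrite lt_neqAle eq_sym g0.
move=> H1; rewrite -subr_ge0 -(pmulr_rge0 _ gg0); apply: (le_trans H1).
by rewrite le_eqVlt; apply/orP; left; apply/eqP; ring.
Qed.

Lemma ip_ae f f' g : measurable_fun setT f -> measurable_fun setT f' ->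
  measurable_fun setT g -> ae_eq mu setT f f' -> ip f g = ip f' g.
Proof.
move=> mf mf' mg ff'; congr fine; apply: ae_eq_integral => //.
- by apply/measurable_EFinP; exact: measurable_funM.
- by apply/measurable_EFinP; exact: measurable_funM.
- by apply: filterS ff' => x /(_ I) /= ->.
Qed.

Lemma ip_eq0 f : L2 f -> ip f f = 0 -> ae_eq mu setT f (cst 0).
Proof.
move=> Lf f0; have := ip_integral Lf; rewrite f0 => i0.
have : ae_eq mu setT (EFin \o (fun x => f x ^+ 2)) (cst 0%E).
  apply/ae_eq_integral_abs => //.
    by apply/measurable_EFinP; apply: measurable_funX; case/Lfun2P : Lf.
  by rewrite -[RHS]i0; apply: eq_integral => x _ /=; rewrite ger0_norm ?sqr_ge0.
apply: filterS => x /(_ I) /= [] /eqP; rewrite sqrf_eq0 => /eqP ->//.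
Qed.

Lemma Lnorm2E f : L2 f -> 'N[mu]_2%:E[EFin \o f]%E = (Num.sqrt (ip f f))%:E.
Proof.
move=> Lf; rewrite unlock /Lnorm.
rewrite (_ : (\int[mu]_x _)%E = (ip f f)%:E).
  by rewrite poweR_EFin powR12_sqrt// ip_ge0.
rewrite -ip_integral//; apply: eq_integral => x _ /=.
by rewrite powR_mulrn// real_normK ?num_real.
Qed.

End SquareIntegrable.

(** * Orthogonality to a generated sigma-algebra *)

Section StepPolynomial.
Variable R : realType.
Implicit Types s x : R.

Lemma bernoulli_ge x n : 0 <= x -> 1 + x *+ n <= (1 + x) ^+ n.
Proof.
move=> x0; elim: n => [|n IH]; first by rewrite mulr0n addr0 expr0.
rewrite exprS; apply: (@le_trans _ _ ((1 + x) * (1 + x *+ n))).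
  by rewrite mulrS -mulr_natr; have := ler0n R n; nra.
by rewrite ler_wpM2l// addr_ge0.
Qed.

Lemma bernoulli_le1 x n : 0 <= x <= 1 -> 1 - x *+ n <= (1 - x) ^+ n.
Proof.
move=> /andP[x0 x1]; elim: n => [|n IH]; first by rewrite mulr0n subr0 expr0.
rewrite exprS; apply: (@le_trans _ _ ((1 - x) * (1 - x *+ n))).
  by rewrite mulrS -mulr_natr; have := ler0n R n; nra.
by rewrite ler_wpM2l// subr_ge0.
Qed.

(** With r the square root of s, Bernoulli's inequality for 1/r bounds n r^n, which leaves the
    factor r^n to tend to 0. *)
Lemma cvg_natM_expr s : 0 <= s < 1 -> (s ^+ n *+ n) @[n --> \oo] --> (0 : R).
Proof.
move=> /andP[s0 s1].
have [->|s_neq0] := eqVneq s 0.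
  apply: cvg_near_cst; near=> n.
  rewrite expr0n gtn_eqF ?mul0rn//; by near: n; exists 1%N.
have sp : 0 < s by rewrite lt_neqAle eq_sym s_neq0.
pose r := Num.sqrt s.
have r0 : 0 < r by rewrite sqrtr_gt0.
have r1 : r < 1 by rewrite -sqrtr1 ltr_sqrt.
have rr : s = r * r by rewrite -expr2 sqr_sqrtr// ltW.
pose x := r^-1 - 1.
have x0 : 0 < x by rewrite subr_gt0 invf_gt1.
have H n : r ^+ n *+ n <= x^-1.
  have rn0 : 0 < r ^+ n by rewrite exprn_gt0.
  have := bernoulli_ge n (ltW x0); rewrite [X in X ^+ n](_ : _ = r^-1); last by rewrite /x; ring.
  rewrite exprVn -(ler_pM2r rn0) mulVf ?gt_eqF// => h.
  rewrite -(ler_pM2l x0) divff ?gt_eqF//; apply: le_trans h.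
  by rewrite -mulr_natr -[in leRHS]mulr_natr; nra.
apply: (@squeeze_cvgr _ _ _ _ (fun=> 0) (fun n => x^-1 * r ^+ n)).
- apply: nearW => n; apply/andP; split; first by rewrite mulrn_wge0// exprn_ge0.
  by rewrite rr exprMn -mulrnAl ler_wpM2r ?exprn_ge0 ?(ltW r0)// H.
- exact: cvg_cst.
- rewrite -[X in _ --> X](mulr0 x^-1); apply: cvgMr.
  by apply: cvg_expr; rewrite gtr0_norm.
Unshelve. all: by end_near. Qed.

(** A variant of the polynomials (1 - s^m)^(2^m) known from elementary proofs of the
    Stone-Weierstrass theorem. The additional factor m in the exponent makes the values at s = 1/2
    tend to 0 instead of 1/e. *)
Definition step_poly (m : nat) s := (1 - s ^+ m) ^+ (m * 2 ^ m).

Lemma step_poly_bound m s : 0 <= s <= 1 -> 0 <= step_poly m s <= 1.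
Proof.
move=> /andP[s0 s1]; rewrite /step_poly.
have h : 0 <= s ^+ m <= 1 by rewrite exprn_ge0 ?exprn_ile1.
by rewrite exprn_ge0 ?exprn_ile1//; lra.
Qed.

(** Write k = m 2^m, so that k s^m = m (2s)^m. Below 1/2 this tends to 0 and (1 - s^m)^k >= 1 - k
    s^m. From 1/2 on it is at least m, and (1 - s^m)^k (1 + s^m)^k <= 1 gives (1 - s^m)^k <= 1/(1 +
    m). *)
Lemma cvg_step_poly s : 0 <= s <= 1 ->
  step_poly m s @[m --> \oo] --> ((s < 2^-1)%R%:R : R).
Proof.
move=> s01; have /andP[s0 s1] := s01.
have Hn n : s ^+ n *+ (n * 2 ^ n) = (2 * s) ^+ n *+ n.
  by rewrite mulnC mulrnA exprMn -natrX mulr_natl.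
have [sl|sg] := ltP s 2^-1.
  apply: (@squeeze_cvgr _ _ _ _ (fun n => 1 - (2 * s) ^+ n *+ n) (fun=> 1)).
  - apply: nearW => n; apply/andP; split; last by have /andP[] := step_poly_bound n s01.
    apply: le_trans (bernoulli_le1 (n * 2 ^ n) _); last by rewrite exprn_ge0 ?exprn_ile1.
    by rewrite Hn.
  - rewrite -[X in _ --> X]subr0; apply: cvgB; first exact: cvg_cst.
    by apply: cvg_natM_expr; apply/andP; split; lra.
  - exact: cvg_cst.
apply: (@squeeze_cvgr _ _ _ _ (fun=> 0) (fun n => n.+1%:R^-1)).
- apply: nearW => n; have /andP[q0 _] := step_poly_bound n s01; rewrite q0 /=.
  rewrite -[leRHS]mul1r ler_pdivlMr ?ltr0n//.
  have sn : 0 <= s ^+ n <= 1 by rewrite exprn_ge0 ?exprn_ile1.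
  apply: (@le_trans _ _ (step_poly n s * (1 + s ^+ n) ^+ (n * 2 ^ n))).
    rewrite ler_wpM2l//; apply: le_trans (bernoulli_ge _ _); last by case/andP: sn.
    by rewrite -natr1 addrC lerD2l Hn -[leRHS]mulr_natr ler_peMl// exprn_ege1//; lra.
  rewrite /step_poly -exprMn exprn_ile1//; nra.
- exact: cvg_cst.
- by under eq_fun do rewrite -[_^-1]/(harmonic _); exact: cvg_harmonic.
Qed.

End StepPolynomial.

Lemma measurable_cos (R : realType) : measurable_fun [set: R] (@cos R).
Proof. by apply: continuous_measurable_fun; exact: continuous_cos. Qed.

Lemma measurable_sin (R : realType) : measurable_fun [set: R] (@sin R).
Proof. by apply: continuous_measurable_fun; exact: continuous_sin. Qed.

Section Uncorrelated.
Context d (T : measurableType d) (R : realType).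
Variable mu : {finite_measure set T -> \bar R}.
Variables (J : finType) (Y : J -> T -> R) (X : T -> R).
Hypothesis mY : forall i, measurable_fun setT (Y i).
Hypothesis iX : mu.-integrable setT (EFin \o X).

(** The phase [e] covers the sines as well, so that products of waves are linear combinations of
    waves and no complex exponentials are needed. *)
Definition wave (a : J -> R) (e : R) (w : T) := cos (\sum_i a i * Y i w + e).

Lemma measurable_wave a e : measurable_fun setT (wave a e).
Proof.
apply: (@measurableT_comp _ _ _ _ _ _ (@cos R)); first exact: measurable_cos.
apply: measurable_funD => //; apply: measurable_sum => i.
exact: measurable_funM.
Qed.

Lemma wave_bound a e w : `|wave a e w| <= 1.
Proof. by rewrite ler_norml cos_geN1 cos_le1. Qed.

(* This class is stable under multiplication by waves and under bounded
   pointwise limits, hence under multiplication by the indicator of any event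
   generated by the [Y i]. *)
Definition annihilated (g : T -> R) := [/\ measurable_fun setT g,
  exists c : R, forall w, `|g w| <= c &
  forall a e, \int[mu]_w (g w * wave a e w * X w) = 0].

Let integrable_gX (g : T -> R) : measurable_fun setT g -> (exists c : R, forall w, `|g w| <= c) ->
  forall a e, mu.-integrable setT (EFin \o (fun w => g w * wave a e w * X w)).
Proof.
move=> mg [c gc] a e; apply: (@rintM_bounded _ _ _ _ c) => //.
  by apply: measurable_funM => //; exact: measurable_wave.
move=> w; rewrite normrM -[leRHS]mulr1 ler_pM//; first exact: wave_bound.
Qed.

Lemma annihilated_comb r1 r2 g1 g2 : annihilated g1 -> annihilated g2 ->
  annihilated (fun w => r1 * g1 w + r2 * g2 w).
Proof.
move=> [m1 [c1 b1] h1] [m2 [c2 b2] h2]; split.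
- by apply: measurable_funD; apply: measurable_funM.
- exists (`|r1| * c1 + `|r2| * c2) => w.
  by rewrite (le_trans (ler_normD _ _))// !normrM lerD// ler_wpM2l.
- move=> a e; under eq_Rintegral do rewrite !mulrDl -!mulrA.
  have i1 := integrable_gX m1 (ex_intro _ c1 b1) a e.
  have i2 := integrable_gX m2 (ex_intro _ c2 b2) a e.
  under eq_Rintegral do rewrite (mulrA (g1 _)) (mulrA (g2 _)).
  by rewrite RintegralD//= ?RintegralZl// ?h1 ?h2 ?mulr0 ?addr0//; exact: rintZ.
Qed.

(** The product-to-sum formula turns a product of two waves into the half-sum of the waves with
    added and subtracted frequencies and phases. *)
Lemma annihilatedM_wave b e' g : annihilated g ->
  annihilated (fun w => g w * wave b e' w).
Proof.
move=> [mg [c bg] hg]; split.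
- by apply: measurable_funM => //; exact: measurable_wave.
- by exists c => w; rewrite normrM -[leRHS]mulr1 ler_pM//; exact: wave_bound.
- move=> a e.
  have E w : g w * wave b e' w * wave a e w * X w =
      2^-1 * (g w * wave (fun i => a i + b i) (e + e') w * X w) +
      2^-1 * (g w * wave (fun i => a i - b i) (e - e') w * X w).
    have -> : wave (fun i => a i + b i) (e + e') w =
        cos (\sum_i a i * Y i w + e + (\sum_i b i * Y i w + e')).
      congr cos; under eq_bigr do rewrite mulrDl.
      by rewrite big_split/=; ring.
    have -> : wave (fun i => a i - b i) (e - e') w =
        cos (\sum_i a i * Y i w + e - (\sum_i b i * Y i w + e')).
      congr cos; under eq_bigr do rewrite mulrBl.
      by rewrite sumrB/=; ring.
    by rewrite cosD cosB /wave; field.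
  under eq_Rintegral do rewrite E.
  rewrite RintegralD//= ?RintegralZl// ?hg ?mulr0 ?addr0//; try apply: rintZ;
    by apply: integrable_gX => //; exists c.
Qed.

Lemma annihilated_cvg (c : R) (g_ : nat -> T -> R) (g : T -> R) :
  (forall n, annihilated (g_ n)) -> (forall n w, `|g_ n w| <= c) ->
  (forall w, g_ n w @[n --> \oo] --> g w) -> annihilated g.
Proof.
move=> hg bg cg.
have mg : measurable_fun setT g.
  by apply: (@measurable_fun_cvg _ _ _ _ g_) => // n; case: (hg n).
have gc w : `|g w| <= c.
  rewrite ler_norml; apply/andP; split.
    by apply: (cvgr_to_ge (cg w)); apply: nearW => n; have := bg n w; rewrite ler_norml => /andP[].
  by apply: (cvgr_to_le (cg w)); apply: nearW => n; have := bg n w; rewrite ler_norml => /andP[].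
split=> //; first by exists c.
move=> a e.
have : \int[mu]_w (g_ n w * wave a e w * X w) @[n --> \oo] -->
    \int[mu]_w (g w * wave a e w * X w).
  apply: (@dominated_Rintegral _ _ _ _ _ _ (fun w => c * `|X w|)).
  - move=> n; have [mgn _ _] := hg n.
    apply: measurable_funM; last exact: (rint_measurable iX).
    by apply: measurable_funM => //; exact: measurable_wave.
  - apply: measurable_funM; last exact: (rint_measurable iX).
    by apply: measurable_funM => //; exact: measurable_wave.
  - by move=> w; do 2 (apply: cvgMr_tmp); exact: cg.
  - by apply: rintZ; exact: integrable_norm.
  - move=> n w; rewrite normrM ler_wpM2r// normrM -[leRHS]mulr1 ler_pM//.
    exact: wave_bound.
under eq_fun do rewrite (let: And3 _ _ h := hg _ in h a e).
move=> /(cvg_lim (@Rhausdorff R)) <-.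
by apply: (cvg_lim (@Rhausdorff R)); exact: cvg_cst.
Qed.

(** s_n = (1 + sin((Y_i - c)/(n+1)))/2 is affine in a wave and lies in [0, 1], so polynomials in s_n
    preserve the class. The step polynomials yield the indicator of s_n < 1/2, that is of a negative
    sine. Once n + 1 > |Y_i - c|, the argument lies in ]-1, 1[ and the sine has the sign of Y_i -
    c. *)
Lemma ltr_indic_annihilated i c g : annihilated g ->
  annihilated (fun w => g w * \1_[set w | Y i w < c] w).
Proof.
move=> hg; have [mg [b bg] _] := hg.
pose s n w := (1 + sin ((Y i w - c) / n.+1%:R)) / 2.
have sE n w : s n w = 2^-1 + 2^-1 *
    wave (fun j => (j == i)%:R / n.+1%:R) (- (c / n.+1%:R) - pi / 2) w.
  rewrite /wave addrA cosBpihalf (bigD1 i)//= eqxx big1 ?addr0.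
    rewrite /s mulrDl mul1r [X in _ + X]mulrC; congr (_ + _ * sin _).
    by rewrite mulrBl (_ : true%:R = 1 :> R)// mul1r [X in X - _]mulrC.
  by move=> j /negbTE ->; rewrite !mul0r.
have s01 n w : 0 <= s n w <= 1.
  by have := sin_geN1 ((Y i w - c) / n.+1%:R); have := sin_le1 ((Y i w - c) / n.+1%:R);
    rewrite /s; lra.
have Ms n h : annihilated h -> annihilated (fun w => h w * s n w).
  move=> ah; under eq_fun do rewrite sE mulrDr (mulrCA (h _)) (mulrC _ 2^-1).
  by apply: annihilated_comb => //; exact: annihilatedM_wave.
have Msm n m h : annihilated h -> annihilated (fun w => h w * s n w ^+ m).
  elim: m h => [|m IH] h ah; first by under eq_fun do rewrite expr0 mulr1.
  by under eq_fun do rewrite exprS mulrA; apply: IH; exact: Ms.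
have Mq n m k h : annihilated h -> annihilated (fun w => h w * (1 - s n w ^+ m) ^+ k).
  elim: k h => [|k IH] h ah; first by under eq_fun do rewrite expr0 mulr1.
  under eq_fun do rewrite exprS mulrA; apply: IH.
  rewrite (_ : (fun _ => _) = (fun w => 1 * h w + (-1) * (h w * s n w ^+ m))).
    by apply: annihilated_comb => //; exact: Msm.
  by apply/funext => w; ring.
have step n : annihilated (fun w => g w * (s n w < 2^-1)%R%:R).
  apply: (@annihilated_cvg b (fun m w => g w * step_poly m (s n w))).
  - by move=> m; exact: Mq.
  - move=> m w; have /andP[q0 q1] := step_poly_bound m (s01 n w).
    by rewrite normrM (ger0_norm q0) -[leRHS]mulr1 ler_pM.
  - by move=> w; apply: cvgMl_tmp; exact: cvg_step_poly.
apply: (@annihilated_cvg b (fun n w => g w * (s n w < 2^-1)%R%:R)) => //.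
- move=> n w; rewrite normrM -[leRHS]mulr1 ler_pM//.
  by case: (_ < _); rewrite ?normr1 ?normr0.
- move=> w; apply: cvgMl_tmp; rewrite indicE; apply: cvg_near_cst.
  near=> n; congr (_ %:R); congr nat_of_bool.
  have n0 : 0 < n.+1%:R :> R by rewrite ltr0n.
  have xn : `|Y i w - c| < n.+1%:R.
    by rewrite -natr1 (@lt_trans _ _ n%:R) ?ltrDl//; near: n; exact: nbhs_infty_gtr.
  rewrite /s; apply/idP/idP.
    move=> sl; rewrite inE/=; have [//|ge] := ltP (Y i w) c.
    have : 0 <= sin ((Y i w - c) / n.+1%:R); last by move: sl; lra.
    have [->|ne] := eqVneq (Y i w) c; first by rewrite subrr mul0r sin0.
    have gt : 0 < Y i w - c by rewrite subr_gt0 lt_neqAle eq_sym ne.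
    apply/ltW/sin2_gt0/andP; split; first by rewrite divr_gt0.
    by rewrite ltr_pdivrMr//; rewrite gtr0_norm// in xn; lra.
  rewrite inE/= => lt.
  have : 0 < sin (- ((Y i w - c) / n.+1%:R)); last by rewrite sinN; lra.
  rewrite -mulNr opprB; apply/sin2_gt0/andP; split; first by rewrite divr_gt0// subr_gt0.
  by rewrite ltr_pdivrMr//; rewrite ltr0_norm ?subr_lt0// in xn; lra.
Unshelve. all: by end_near. Qed.

Definition annihilating (A : set T) := measurable A /\
  forall g, annihilated g -> annihilated (fun w => g w * \1_A w).

(** Since [annihilating] quantifies over all annihilated [g], finite products of indicators come for
    free; countable intersections are their pointwise limits, and unions follow by complement. No
    pi-system argument is required. *)
Lemma annihilating_sigma_algebra : sigma_algebra setT annihilating.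
Proof.
have C A : annihilating A -> annihilating (~` A).
  move=> [mA hA]; split; first exact: measurableC.
  move=> g ag; rewrite (_ : (fun _ => _) = (fun w => 1 * g w + (-1) * (g w * \1_A w))).
    by apply: annihilated_comb => //; exact: hA.
  by apply/funext => w; rewrite !indicE in_setC; case: (_ \in _) => /=; ring.
split.
- split => // g ag; rewrite (_ : (fun _ => _) = (fun w => 0 * g w + 0 * g w)).
    exact: annihilated_comb.
  by apply/funext => w; rewrite indic0 /= !mul0r mulr0 addr0.
- by move=> A hA; rewrite setTD; exact: (C).
- move=> A hA.
  suff cap (B : (set T)^nat) : (forall n, annihilating (B n)) -> annihilating (\bigcap_n B n).
    by rewrite -[X in annihilating X]setCK setC_bigcup; apply: (C); apply: cap => n; exact: (C).
  move=> hB; split; first by apply: bigcapT_measurable => n; case: (hB n).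
  move=> g ag; have [mg [b bg] _] := ag.
  pose F n w := g w * \prod_(k < n) \1_(B k) w.
  have aF n : annihilated (F n).
    elim: n => [|n IH]; rewrite /F; first by under eq_fun do rewrite big_ord0 mulr1.
    by under eq_fun do rewrite big_ord_recr/= mulrA; case: (hB n) => _; exact.
  apply: (@annihilated_cvg b F) => //.
    move=> n w; rewrite normrM -[leRHS]mulr1 ler_pM// normr_prod.
    by apply: prodr_ile1 => k; rewrite normr_ge0/= indicE; case: (_ \in _); rewrite ?normr1 ?normr0.
  move=> w; apply: cvgMl_tmp; apply: cvg_near_cst.
  have [Bw|] := pselect ((\bigcap_n B n) w).
    apply: nearW => n; rewrite indicE mem_set//.
    by rewrite big1// => k _; rewrite indicE mem_set//; exact: Bw.
  move=> nBw; have : exists k, ~ B k w by apply/existsNP => h; apply: nBw => k _; exact: h.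
  move=> [k Bk]; near=> n; rewrite [RHS]indicE memNset//.
  have kn : (k < n)%N by near: n; exact: nbhs_infty_gt.
  by rewrite (bigD1 (Ordinal kn))//= indicE memNset// mul0r.
Unshelve. all: by end_near. Qed.

Lemma annihilating_preimage i B : measurable B -> annihilating (Y i @^-1` B).
Proof.
move=> mB.
have : <<s [set A : set R | exists x, A = `]-oo, x[%classic] >> B.
  by move: mB; rewrite /= [X in X B](RGenInftyO.measurableE R).
suff sub : <<s [set A : set R | exists x, A = `]-oo, x[%classic] >> `<=`
    [set B | annihilating (Y i @^-1` B)] by exact: sub.
apply: smallest_sub.
  have [s0 sC sU] := annihilating_sigma_algebra; split.
  - by rewrite /= preimage_set0.
  - by move=> A /= hA; rewrite setTD preimage_setC -setTD; exact: sC.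
  - by move=> A /= hA; rewrite preimage_bigcup; exact: sU.
move=> _ [c ->]/=; split.
  by rewrite -[X in measurable X]setTI; exact: mY.
move=> g ag; have := ltr_indic_annihilated i c ag.
by rewrite (_ : [set w | Y i w < c] = Y i @^-1` `]-oo, c[).
Qed.

(** The hypothesis says that the constant 1 is annihilated. Hence so is the indicator of [A], which
    is then tested against the wave with zero frequency and phase, the constant 1. *)
Lemma annihilated_integral_eq0 A :
  (forall a e, \int[mu]_w (wave a e w * X w) = 0) ->
  <<s [set E | exists i B, measurable B /\ E = Y i @^-1` B] >> A ->
  \int[mu]_(w in A) X w = 0.
Proof.
move=> X0 sA.
have [mA hA] : annihilating A.
  suff sub : <<s [set E | exists i B, measurable B /\ E = Y i @^-1` B] >> `<=` annihilating.
    exact: sub.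
  apply: smallest_sub; first exact: annihilating_sigma_algebra.
  by move=> _ [i [B [mB ->]]]; exact: annihilating_preimage.
have a1 : annihilated (cst 1).
  split => //; first by exists 1 => w; rewrite normr1.
  by move=> a e; under eq_Rintegral do rewrite mul1r.
have [_ _ /(_ (fun=> 0) 0)] := hA _ a1.
have W w : wave (fun=> 0) 0 w = 1.
  by rewrite /wave big1 ?addr0 ?cos0// => *; rewrite mul0r.
under eq_Rintegral do rewrite /cst mul1r W mulr1.
move=> h; rewrite Rintegral_mkcond -[RHS]h; apply: eq_Rintegral => w _.
by rewrite patchE indicE; case: ifPn => _; rewrite ?mul1r ?mul0r.
Qed.

End Uncorrelated.

(** * Gaussian laws *)

Section IntegralLaw.
Context d (T : measurableType d) (R : realType) (P : probability T R).

Lemma ge0_integral_law (Z : T -> R) (nu : {measure set (measurableTypeR R) -> \bar R})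
    (f : R -> \bar R) :
  measurable_fun setT Z -> (forall B : set R, measurable B -> P (Z @^-1` B) = nu B) ->
  measurable_fun setT f -> (forall x, 0 <= f x)%E ->
  (\int[P]_w f (Z w) = \int[nu]_x f x)%E.
Proof.
move=> mZ lawZ mf f0.
pose Z' : {mfun T >-> measurableTypeR R} :=
  HB.pack Z (isMeasurableFun.Build _ _ T (measurableTypeR R) Z mZ).
rewrite (@eq_measure_integral _ _ _ _ (distribution P Z')).
  by rewrite ge0_integral_distribution.
by move=> A mA _; rewrite /= -lawZ.
Qed.

Lemma Rintegral_law_eq (X Y : T -> R) (f : R -> R) :
  measurable_fun setT X -> measurable_fun setT Y ->
  (forall B : set R, measurable B -> P (X @^-1` B) = P (Y @^-1` B)) ->
  measurable_fun setT f -> (forall x, `|f x| <= 1) ->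
  \int[P]_w f (X w) = \int[P]_w f (Y w).
Proof.
move=> mX mY law mf f1.
pose X' : {mfun T >-> R} := HB.pack X (isMeasurableFun.Build _ _ _ _ X mX).
pose Y' : {mfun T >-> R} := HB.pack Y (isMeasurableFun.Build _ _ _ _ Y mY).
have bint (Z : {mfun T >-> R}) : P.-integrable setT ((EFin \o f) \o Z).
  apply: measurable_bounded_integrable => //.
  - by rewrite (le_lt_trans (probability_le1 _ _))// ltry.
  - exact: measurableT_comp.
  - by exists 1; split => // M M1 w _ /=; rewrite (le_trans (f1 _))// ltW.
have mef : measurable_fun setT (EFin \o f) by exact/measurable_EFinP.
have := @integral_distribution _ _ _ _ _ P X' _ mef (bint X').
have := @integral_distribution _ _ _ _ _ P Y' _ mef (bint Y').
rewrite /Rintegral /= => <- <-; congr fine.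
by apply: eq_measure_integral => A mA _; rewrite /= /distribution /pushforward law.
Qed.

End IntegralLaw.

Section GaussianLaw.
Variable R : realType.
Local Notation leb := (@lebesgue_measure R).
Implicit Types s : R.

Lemma integral_normal_prob s (f : R -> \bar R) :
  (normal_prob 0 s).-integrable setT f ->
  (\int[normal_prob 0 s]_x f x = \int[leb]_x (f x * (normal_pdf 0 s x)%:E))%E.
Proof.
move=> intf; have mf := measurable_int _ intf.
rewrite -(Radon_Nikodym_change_of_variables (normal_prob_dominates 0 s))//=.
have npm : measurable_fun setT (fun x => (normal_pdf 0 s x)%:E).
  by apply/measurable_EFinP; exact: measurable_normal_pdf.
apply: ae_eq_integral => //.
- apply: emeasurable_funM => //; apply: (measurable_int leb).
  by apply: Radon_Nikodym_integrable; exact: normal_prob_dominates.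
- exact: emeasurable_funM.
- apply: ae_eqe_mul2l => /=.
  rewrite Radon_NikodymE//=; first exact: normal_prob_dominates.
  move=> abmu; case: cid => /= h [h1 h2 h3].
  apply: integral_ae_eq => //=.
  by move=> E _ mE; rewrite -h3.
Qed.

(** Substitution of s x for x. The second moment of the standard normal law stays an unknown
    constant: to compare two centred Gaussians, the scaling in s suffices. *)
Lemma normal_moment2_scale s : 0 < s ->
  (\int[leb]_x (x ^+ 2 * normal_pdf 0 s x)%:E =
   (s ^+ 2)%:E * \int[leb]_x (x ^+ 2 * normal_pdf 0 1 x)%:E)%E.
Proof.
move=> s0; have sn0 : s != 0 by rewrite gt_eqF.
pose F (x : R) : R := s * x.
have dF x : derivable (F : R^o -> R^o) x 1 by apply: derivableM.
have F'E : F^`()%classic = cst s.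
  apply/funext => x; rewrite /F derive1E deriveM// derive_cst derive_id.
  by rewrite scaler0 addr0 scaler1.
have pdf_scale x : normal_pdf 0 s (s * x) * s = normal_pdf 0 1 x.
  rewrite !normal_pdfE// ?oner_eq0// /normal_peak /normal_fun !subr0.
  rewrite expr1n mul1r -mulrnAr sqrtrM ?sqr_ge0// sqrtr_sqr gtr0_norm//.
  have -> : - (s * x) ^+ 2 / (s ^+ 2 *+ 2) = - x ^+ 2 / 2 by field.
  have : Num.sqrt (pi *+ 2) != 0 :> R by rewrite gt_eqF// sqrtr_gt0 pmulrn_lgt0// pi_gt0.
  by move: (Num.sqrt _) => r r0; field; rewrite sn0 r0.
rewrite (@increasing_ge0_integration_by_substitutionT _ F (fun x => x ^+ 2 * normal_pdf 0 s x)).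
- rewrite F'E -ge0_integralZl//.
  + apply: eq_integral => x _ /=; rewrite !fctE/= /F -EFinM; congr EFin.
    by rewrite exprMn -pdf_scale; ring.
  + apply/measurable_EFinP; apply: measurable_funM => //.
    exact: measurable_normal_pdf.
  + by move=> x _; rewrite lee_fin mulr_ge0 ?sqr_ge0 ?normal_pdf_ge0.
  + by rewrite lee_fin sqr_ge0.
- by move=> x y xy; rewrite /F ltr_pM2l.
- by rewrite F'E => x; exact: cvg_cst.
- by rewrite F'E; exact: is_cvg_cst.
- by rewrite F'E; exact: is_cvg_cst.
- by [].
- by apply: gt0_cvgMrNy => //; exact: cvg_id.
- by apply: gt0_cvgMry => //; exact: cvg_id.
- move=> x; apply: cvgM; first exact: exprn_continuous.
  exact: continuous_normal_pdf.
- by move=> x; rewrite mulr_ge0 ?sqr_ge0 ?normal_pdf_ge0.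
Qed.

Context d (T : measurableType d) (P : probability T R).

(** A nondegenerate law with parameter s has variance s^2 c, with c the same for all s; equal
    nonzero variances thus force equal parameters. Zero variance gives the Dirac mass, and s = 0 is
    possible only then. *)
Lemma centred_gaussian_law_eq (X Y : T -> R) : centred_gaussian P X -> centred_gaussian P Y ->
  X \in Lfun P 2%:E -> Y \in Lfun P 2%:E -> ip P X X = ip P Y Y ->
  forall B : set R, measurable B -> P (X @^-1` B) = P (Y @^-1` B).
Proof.
have dirac0 (Z : T -> R) : measurable_fun setT Z -> ae_eq P setT Z (cst 0) ->
    forall B : set R, measurable B -> P (Z @^-1` B) = dirac (0 : R) B.
  move=> mZ Z0 B mB; rewrite diracE.
  have mZB : measurable (Z @^-1` B) by rewrite -[X in measurable X]setTI; exact: mZ.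
  have -> : P (Z @^-1` B) = (\int[P]_w (\1_(Z @^-1` B) w)%:E)%E by rewrite integral_indic// setIT.
  rewrite (ae_eq_integral (cst (0 \in B)%:R%:E))//.
  - by rewrite integral_cst// [X in (_ * X)%E]probability_setT mule1.
  - by apply/measurable_EFinP.
  - by apply: filterS Z0 => w /= /(_ I) Zw _; rewrite indicE; congr (_ %:R%:E); congr nat_of_bool;
      apply/idP/idP; rewrite !inE/= Zw.
have gauss0 (Z : T -> R) s : Z \in Lfun P 2%:E -> 0 < s ->
    (forall B, measurable B -> P (Z @^-1` B) = normal_prob 0 s B) ->
    ((ip P Z Z)%:E = (s ^+ 2)%:E * \int[leb]_x (x ^+ 2 * normal_pdf 0 1 x)%:E)%E.
  move=> LZ s0 lawZ; have mZ := Lfun2_measurable LZ.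
  have [_ intZ] := (Lfun2P _ _).1 LZ.
  have mx2 : measurable_fun setT (EFin \o (fun x : R => x ^+ 2)).
    by apply/measurable_EFinP; exact: measurable_funX.
  have lawE : ((ip P Z Z)%:E = \int[normal_prob 0 s]_x (x ^+ 2)%:E)%E.
    rewrite -ip_integral// (@ge0_integral_law _ _ _ _ _ (normal_prob 0 s) (fun x => (x ^+ 2)%:E))//.
    by move=> x; rewrite lee_fin sqr_ge0.
  have intn : (normal_prob 0 s).-integrable setT (EFin \o (fun x : R => x ^+ 2)).
    apply/integrableP; split => //.
    under eq_integral do rewrite /= ger0_norm ?sqr_ge0//.
    by rewrite -lawE ltry.
  rewrite -normal_moment2_scale//.
  under eq_integral do rewrite EFinM.
  by rewrite -integral_normal_prob// -lawE.
have gauss_eq0 (Z : T -> R) : measurable_fun setT Z -> Z \in Lfun P 2%:E -> ip P Z Z = 0 ->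
    forall B : set R, measurable B -> P (Z @^-1` B) = dirac (0 : R) B.
  by move=> mZ LZ Z0; apply: dirac0 => //; exact: ip_eq0.
move=> [mX [s s0 lawX]] [mY [t t0 lawY]] LX LY XY B mB.
have [v0|v0] := eqVneq (ip P X X) 0.
  by rewrite (gauss_eq0 X)// (gauss_eq0 Y)// -XY.
have sp : 0 < s.
  rewrite lt_neqAle s0 andbT eq_sym; apply: contra_neq v0 => s00.
  have X0 : ae_eq P setT X (cst 0).
    exists (X @^-1` (~` [set 0])); split.
    - by rewrite -[X in measurable X]setTI; apply: mX => //; exact: measurableC.
    - have := lawX (~` [set 0]) (measurableC (measurable_set1 0)).
      by rewrite s00 eqxx diracE memNset => [//|h]; exact: h.
    - by move=> w /= h Xw; apply: h => _.
  by rewrite (ip_ae _ _ _ X0) ?ip0l.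
have tp : 0 < t.
  rewrite lt_neqAle t0 andbT eq_sym; apply: contra_neq v0 => s00.
  have X0 : ae_eq P setT Y (cst 0).
    exists (Y @^-1` (~` [set 0])); split.
    - by rewrite -[X in measurable X]setTI; apply: mY => //; exact: measurableC.
    - have := lawY (~` [set 0]) (measurableC (measurable_set1 0)).
      by rewrite s00 eqxx diracE memNset => [//|h]; exact: h.
    - by move=> w /= h Xw; apply: h => _.
  by rewrite XY (ip_ae _ _ _ X0) ?ip0l.
have lX A : measurable A -> P (X @^-1` A) = normal_prob 0 s A.
  by move=> mA; rewrite lawX// gt_eqF.
have lY A : measurable A -> P (Y @^-1` A) = normal_prob 0 t A.
  by move=> mA; rewrite lawY// gt_eqF.
suff st : s = t by rewrite (lX B mB) (lY B mB) st.
have := gauss0 _ _ LX sp lX; have := gauss0 _ _ LY tp lY; rewrite -XY.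
set c := integral _ _ _ => hY hX.
have c0 : (0 <= c)%E.
  by apply: integral_ge0 => x _; rewrite lee_fin mulr_ge0 ?sqr_ge0 ?normal_pdf_ge0.
(* The constant is finite, because an infinite one would give a square-integrable variable an
   infinite variance. *)
case: c c0 hX hY => [c| |//] c0; last first.
  by move=> h; move: h; rewrite gt0_muley// lte_fin exprn_gt0.
move=> [hX] [hY].
have c_neq0 : c != 0 by apply: contra_neq v0 => c00; rewrite hX c00 mulr0.
have : s ^+ 2 = t ^+ 2 by apply: (mulIf c_neq0); rewrite -hX.
by move=> /eqP; rewrite eqrXn2// => /eqP.
Qed.

End GaussianLaw.

(** * Density of step functions *)

Section StepDense.
Context d (T : measurableType d) (R : realType).
Variable mu : {measure set T -> \bar R}.
Local Notation L2 f := (f \in Lfun mu 2%:E).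

(** A list of weighted sets, not necessarily disjoint: sums are concatenations, and the
    representation matches the linear combinations of noise values in the definition of a Gaussian
    vector. *)
Definition step_fun (s : seq (R * set T)) (x : T) : R := \sum_(p <- s) p.1 * \1_(p.2) x.

Lemma step_fun_cat s1 s2 x : step_fun (s1 ++ s2) x = step_fun s1 x + step_fun s2 x.
Proof. by rewrite /step_fun big_cat. Qed.

Lemma step_fun_scale a s x :
  step_fun [seq (a * p.1, p.2) | p <- s] x = a * step_fun s x.
Proof.
by rewrite /step_fun big_map mulr_sumr; apply: eq_bigr => p _; rewrite mulrA.
Qed.

Lemma measurable_step_fun s : (forall p, p \in s -> measurable p.2) ->
  measurable_fun setT (step_fun s).
Proof.
elim: s => [|p s IH] ms.
  by rewrite (_ : step_fun _ = cst 0)//; apply/funext => x; rewrite /step_fun big_nil.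
rewrite (_ : step_fun _ = (fun x => p.1 * \1_(p.2) x + step_fun s x)).
  apply: measurable_funD; last by apply: IH => q qs; apply: ms; rewrite inE qs orbT.
  by apply: measurable_funM => //; apply: measurable_indic; apply: ms; rewrite inE eqxx.
by apply/funext => x; rewrite /step_fun big_cons.
Qed.

Import HBNNSimple.

Lemma nnsfun_step (f : {nnsfun T >-> R}) :
  exists2 s : seq (R * set T), (forall p, p \in s -> measurable p.2) & step_fun s = f.
Proof.
exists [seq (y, f @^-1` [set y]) | y <- finmap.enum_fset (fset_set (range f))].
  have mf : measurable_fun setT f by [].
  by move=> p /mapP[y _ ->] /=; rewrite -[X in measurable X]setTI; exact: mf.
by apply/funext => x; rewrite fimfunE fsbig_finite// /step_fun big_map.
Qed.

(** The positive and the negative part are approximated from below, so the difference of the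
    approximants never exceeds |f|, and 4 f^2 dominates the squared error. *)
Lemma step_dense (f : T -> R) (e : R) : L2 f -> 0 < e -> exists s : seq (R * set T),
  [/\ forall p, p \in s -> measurable p.2, L2 (step_fun s) &
      ip mu (fun x => step_fun s x - f x) (fun x => step_fun s x - f x) <= e].
Proof.
move=> Lf e0; have [mf intf] := (Lfun2P _ _).1 Lf.
have mfp : measurable_fun setT (EFin \o f^\+) by apply/measurable_EFinP/measurable_funrpos.
have mfn : measurable_fun setT (EFin \o f^\-) by apply/measurable_EFinP/measurable_funrneg.
pose p := nnsfun_approx measurableT mfp; pose q := nnsfun_approx measurableT mfn.
have p0 n x : 0 <= p n x <= f^\+ x.
  apply/andP; split; first exact: fun_ge0.
  rewrite /p nnsfun_approxE -lee_fin; apply: le_approx => // y _.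
  by rewrite lee_fin funrpos_ge0.
have q0 n x : 0 <= q n x <= f^\- x.
  apply/andP; split; first exact: fun_ge0.
  rewrite /q nnsfun_approxE -lee_fin; apply: le_approx => // y _.
  by rewrite lee_fin funrneg_ge0.
have pf x : p n x @[n --> \oo] --> f^\+ x.
  have := @cvg_nnsfun_approx _ _ _ _ measurableT _ mfp (fun y _ => ltac:(by rewrite lee_fin funrpos_ge0)) x I.
  by move=> /fine_cvg.
have qf x : q n x @[n --> \oo] --> f^\- x.
  have := @cvg_nnsfun_approx _ _ _ _ measurableT _ mfn (fun y _ => ltac:(by rewrite lee_fin funrneg_ge0)) x I.
  by move=> /fine_cvg.
have fE x : f x = f^\+ x - f^\- x by rewrite -[in LHS](funrposBneg f).
have bnd n x : (p n x - q n x) ^+ 2 <= f x ^+ 2.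
  have /andP[p1 p2] := p0 n x; have /andP[q1 q2] := q0 n x.
  rewrite -[leRHS]real_normK ?num_real// (_ : `|f x| = f^\+ x + f^\- x).
    by rewrite -[leLHS]real_normK ?num_real// lerXn2r ?nnegrE ?addr_ge0//; rewrite ler_norml; apply/andP; split; lra.
  by rewrite -[LHS]/((Num.norm \o f) x) -funrposDneg.
have Lpq n : L2 (fun x => p n x - q n x).
  by apply: (Lfun2_dominated _ intf) => //; apply: measurable_funB.
have cv : ip mu (fun x => p n x - q n x - f x) (fun x => p n x - q n x - f x) @[n --> \oo] --> (0 : R).
  have := @dominated_Rintegral _ _ _ mu (fun n x => (p n x - q n x - f x) * (p n x - q n x - f x))
    (fun=> 0) (fun x => 4 * f x ^+ 2).
  rewrite (_ : \int[mu]_x 0 = 0); last by rewrite /Rintegral integral0.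
  apply.
  - by move=> n; apply: measurable_funM; apply: measurable_funB => //; apply: measurable_funB.
  - by [].
  - move=> x; rewrite -[X in _ --> X](mulr0 0).
    have h : p n x - q n x - f x @[n --> \oo] --> (0 : R).
      rewrite -[X in _ --> X](subrr (f x)); apply: cvgB; last exact: cvg_cst.
      by rewrite fE; apply: cvgB.
    by apply: cvgM.
  - exact: rintZ.
  - move=> n x; rewrite ger0_norm -?expr2 ?sqr_ge0//.
    have := bnd n x; have := sqr_ge0 (p n x - q n x + f x).
    by rewrite !expr2; nra.
move/cvgrPdist_le : cv => /(_ e e0)[n _ /(_ n (leqnn _))] /=.
rewrite sub0r normrN ger0_norm ?ip_ge0// => ne.
have [sp msp spE] := nnsfun_step (p n); have [sq msq sqE] := nnsfun_step (q n).
exists (sp ++ [seq (-1 * r.1, r.2) | r <- sq]).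
have E : step_fun (sp ++ [seq (-1 * r.1, r.2) | r <- sq]) = (fun x => p n x - q n x).
  by apply/funext => x; rewrite step_fun_cat step_fun_scale spE sqE mulN1r.
split; rewrite ?E// => r; rewrite mem_cat => /orP[/msp//|/mapP[r' /msq mr' ->//]].
Qed.

End StepDense.

(** * The measures on the torus and on space-time *)

Section Restriction.
Context d (T : measurableType d) (R : realType) (mu : {measure set T -> \bar R}).
Context (D : set T) (mD : measurable D).
Let nu := mrestr mu mD.
HB.instance Definition _ := Measure.on nu.

Lemma ge0_integral_mrestr (f : T -> \bar R) : measurable_fun setT f ->
  (forall x, 0 <= f x)%E -> (\int[mrestr mu mD]_x f x = \int[mu]_(x in D) f x)%E.
Proof.
move=> mf f0; transitivity (\int[nu]_(x in D) f x)%E.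
  rewrite -/nu (@ge0_negligible_integral _ _ _ nu setT (~` D))//.
  - by rewrite setTD setCK.
  - exact: measurableC.
  - by rewrite -[LHS]/(mu (~` D `&` D)) setICl measure0.
by apply: eq_measure_integral => A mA AD; rewrite -[LHS]/(mu (A `&` D)) setIidl.
Qed.

Lemma integral_mrestr (f : T -> \bar R) : measurable_fun setT f ->
  (\int[mrestr mu mD]_x f x = \int[mu]_(x in D) f x)%E.
Proof.
move=> mf; rewrite [LHS]integralE [RHS]integralE !ge0_integral_mrestr//.
- exact: measurable_funeneg.
- exact: measurable_funepos.
Qed.

Lemma Rintegral_mrestr (f : T -> R) : measurable_fun setT f ->
  \int[mrestr mu mD]_x f x = \int[mu]_(x in D) f x.
Proof. by move=> mf; rewrite /Rintegral integral_mrestr//; exact/measurable_EFinP. Qed.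

Lemma ae_eq_mrestr (U : Type) (f g : T -> U) : (forall x, D x -> f x = g x) ->
  ae_eq (mrestr mu mD : {measure set T -> \bar R}) setT f g.
Proof.
move=> fg; exists (~` D); split.
- exact: measurableC.
- by rewrite -[LHS]/(mu (~` D `&` D)) setICl measure0.
- by move=> x /= h Dx; apply: h => _; exact: fg.
Qed.

End Restriction.

Section EqMeasure.
Context d (T : measurableType d) (R : realType) (m1 m2 : {measure set T -> \bar R}).
Hypothesis m12 : forall A, measurable A -> m1 A = m2 A.

Lemma eq_measure_integrable (f : T -> \bar R) :
  m1.-integrable setT f -> m2.-integrable setT f.
Proof.
move=> /integrableP[mf intf]; apply/integrableP; split => //.
by rewrite (@eq_measure_integral _ _ _ _ m1)// => A mA _; rewrite m12.
Qed.

Lemma eq_measure_Rintegral (f : T -> R) : \int[m1]_x f x = \int[m2]_x f x.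
Proof. by congr fine; apply: eq_measure_integral => A mA _; exact: m12. Qed.

End EqMeasure.

Section TorusMeasure.
Context {R : realType}.
Local Notation leb := (@lebesgue_measure R).

Lemma torus_mu_setT : torus_mu [set: R] = 1%E.
Proof. by rewrite /torus_mu /mrestr setTI /torus_dom lebesgue_measure_itv/= lte_fin ltr01 oppr0 adde0. Qed.

HB.instance Definition _ := @Measure_isProbability.Build _ _ R (@torus_mu R) torus_mu_setT.

Definition unit_mu := mrestr leb (measurable_itv `[0 : R, 1]).

HB.instance Definition _ := Measure.on unit_mu.

Lemma unit_mu_setT : unit_mu [set: R] = 1%E.
Proof. by rewrite /unit_mu /mrestr setTI lebesgue_measure_itv/= lte_fin ltr01 oppr0 adde0. Qed.

HB.instance Definition _ := @Measure_isProbability.Build _ _ R unit_mu unit_mu_setT.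

(** [spacetime_mu] is a restriction of a product measure; to apply Fubini's theorem it has to be
    seen as a product of restrictions. The two agree on rectangles. *)
Lemma spacetime_muE (A : set (measurableTypeR R * measurableTypeR R)) : measurable A ->
  (unit_mu \x torus_mu)%E A = spacetime_mu A.
Proof.
apply: (@product_measure_unique _ _ _ _ _ unit_mu (@torus_mu R) (@spacetime_mu R)) => B C mB mC.
rewrite /= /spacetime_mu /mrestr /spacetime_dom -setXI.
by rewrite product_measure1E//; apply: measurableI => //; exact: measurable_torus_dom.
Qed.

Lemma spacetime_mu_setT : spacetime_mu [set: R * R] = 1%E.
Proof.
rewrite -spacetime_muE// -setXTT product_measure1E//.
transitivity (1 * 1 : \bar R)%E; last by rewrite mul1e.
by congr (_ * _)%E; [exact: unit_mu_setT|exact: torus_mu_setT].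
Qed.

HB.instance Definition _ :=
  @Measure_isProbability.Build _ _ R (@spacetime_mu R) spacetime_mu_setT.

Lemma spacetime_ae (U : Type) (f g : R * R -> U) :
  (forall z, spacetime_dom z -> f z = g z) -> ae_eq spacetime_mu setT f g.
Proof.
move=> fg; exists (~` spacetime_dom); split.
- by apply: measurableC; exact: measurable_spacetime_dom.
- by rewrite /= /spacetime_mu /mrestr setICl measure0.
- by move=> x /= h Dx; apply: h => _; exact: fg.
Qed.

End TorusMeasure.

(* The casts select the measurable structure carried by [lebesgue_measure],
   which is not the canonical one of [R]. *)
Local Notation L2_torus R g :=
  ((g : measurableTypeR R -> R) \in Lfun (@torus_mu R) 2%:E).
Local Notation L2_spacetime R phi :=
  ((phi : measurableTypeR R * measurableTypeR R -> R) \in Lfun (@spacetime_mu R) 2%:E).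

Section RealFubini.
Context d1 d2 (T1 : measurableType d1) (T2 : measurableType d2) (R : realType).
Variables (m1 : {sigma_finite_measure set T1 -> \bar R})
  (m2 : {sigma_finite_measure set T2 -> \bar R}) (f : T1 * T2 -> R).
Hypothesis intf : (m1 \x m2)%E.-integrable setT (EFin \o f).

Lemma rint_fubini1 : m1.-integrable setT (EFin \o (fun x => \int[m2]_y f (x, y))).
Proof.
have iF := integrable_fubini_F intf.
apply: (@le_integrable _ _ _ m1 setT measurableT _ _ _ _ iF) => [|x _ /=].
  apply/measurable_EFinP; apply: (measurableT_comp (@fine_measurable _ _ measurableT)).
  exact: measurable_fubini_F intf.
by rewrite /Rintegral -[integral _ _ _]/(fubini_F m2 (EFin \o f) x);
  case: (fubini_F _ _ _) => [r| |] //=; rewrite leey.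
Qed.

(** On a null set the section may fail to be integrable, and there [fine] may replace an infinite
    inner integral by 0; hence the passage through almost everywhere equality. *)
Lemma Rintegral_fubini1 :
  \int[m1]_x \int[m2]_y f (x, y) = fine (\int[m1 \x m2]_z (f z)%:E).
Proof.
have iF := integrable_fubini_F intf.
rewrite /Rintegral -(integral12_prod_meas1 intf); congr fine.
apply: ae_eq_integral => //.
- exact: (measurable_int _ rint_fubini1).
- exact: (measurable_int _ iF).
- by apply: filterS (integrable_ae measurableT iF) => x /(_ I) fin _; rewrite fineK.
Qed.

End RealFubini.

Section RealFubini2.
Context d1 d2 (T1 : measurableType d1) (T2 : measurableType d2) (R : realType).
Variables (m1 : {sigma_finite_measure set T1 -> \bar R})
  (m2 : {sigma_finite_measure set T2 -> \bar R}) (f : T1 * T2 -> R).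
Hypothesis intf : (m1 \x m2)%E.-integrable setT (EFin \o f).

Let integrable_fubini_G : m2.-integrable setT (fubini_G m1 (EFin \o f)).
Proof.
have mf := measurable_int _ intf.
apply/integrableP; split; first exact: measurable_fubini_G intf.
apply: le_lt_trans ((integrable21ltyP m1 m2 mf).1 intf).
apply: ge0_le_integral => //=.
- by apply: measurableT_comp => //; exact: measurable_fubini_G intf.
- apply: (@measurable_fun_fubini_tonelli_G _ _ _ _ _ m1 (abse \o (EFin \o f))) => //=.
  exact: measurableT_comp.
- move=> y _; apply: le_abse_integral => //.
  by apply/measurable_EFinP; apply: (measurableT_comp ((measurable_EFinP _ _).1 mf)).
Qed.

Lemma rint_fubini2 : m2.-integrable setT (EFin \o (fun y => \int[m1]_x f (x, y))).
Proof.
have iF := integrable_fubini_G.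
apply: (@le_integrable _ _ _ m2 setT measurableT _ _ _ _ iF) => [|x _ /=].
  apply/measurable_EFinP; apply: (measurableT_comp (@fine_measurable _ _ measurableT)).
  exact: measurable_fubini_G intf.
by rewrite /Rintegral -[integral _ _ _]/(fubini_G m1 (EFin \o f) x);
  case: (fubini_G _ _ _) => [r| |] //=; rewrite leey.
Qed.

Lemma Rintegral_fubini2 :
  \int[m2]_y \int[m1]_x f (x, y) = fine (\int[m1 \x m2]_z (f z)%:E).
Proof.
have iF := integrable_fubini_G.
rewrite /Rintegral -(integral21_prod_meas1 intf); congr fine.
apply: ae_eq_integral => //.
- exact: (measurable_int _ rint_fubini2).
- exact: (measurable_int _ iF).
- by apply: filterS (integrable_ae measurableT iF) => x /(_ I) fin _; rewrite fineK.
Qed.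

Lemma Rintegral_fubini :
  \int[m1]_x \int[m2]_y f (x, y) = \int[m2]_y \int[m1]_x f (x, y).
Proof. by rewrite Rintegral_fubini1// Rintegral_fubini2. Qed.

End RealFubini2.

Section SpacetimeFubini.
Context {R : realType}.

Lemma spacetime_integrable (f : R * R -> R) :
  spacetime_mu.-integrable setT (EFin \o f) <->
  (unit_mu \x torus_mu)%E.-integrable setT (EFin \o f).
Proof.
split; apply: eq_measure_integrable => A mA; [exact/esym/spacetime_muE|exact: spacetime_muE].
Qed.

Lemma spacetime_fubini (f : R * R -> R) : spacetime_mu.-integrable setT (EFin \o f) ->
  \int[spacetime_mu]_z f z = \int[unit_mu]_s \int[torus_mu]_y f (s, y).
Proof.
move=> /spacetime_integrable intf.
rewrite (Rintegral_fubini1 intf); apply: esym.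
by apply: eq_measure_Rintegral => A mA; exact: spacetime_muE.
Qed.

End SpacetimeFubini.

(** * The L^2 norm *)

Section L2norm.
Context d (T : measurableType d) (R : realType) (mu : {measure set T -> \bar R}).
Local Notation L2 f := (f \in Lfun mu 2%:E).

Definition nrm (f : T -> R) : R := Num.sqrt (ip mu f f).

Lemma nrm_ge0 f : 0 <= nrm f. Proof. exact: sqrtr_ge0. Qed.

Lemma nrm_sqr f : nrm f ^+ 2 = ip mu f f.
Proof. by rewrite sqr_sqrtr// ip_ge0. Qed.

Lemma nrmZ a f : L2 f -> nrm (fun x => a * f x) = `|a| * nrm f.
Proof.
move=> Lf; rewrite /nrm ipZl ?ipZr//; last exact: Lfun2Z.
by rewrite mulrA -expr2 sqrtrM ?sqr_ge0// sqrtr_sqr.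
Qed.

Lemma ip_le_nrm f g : L2 f -> L2 g -> ip mu f g <= nrm f * nrm g.
Proof.
move=> Lf Lg; rewrite (le_trans (ler_norm _))// -(@ler_pXn2r _ 2)// ?nnegrE ?mulr_ge0 ?nrm_ge0//.
by rewrite real_normK ?num_real// exprMn !nrm_sqr ip_CS.
Qed.

Lemma nrmD f g : L2 f -> L2 g -> nrm (fun x => f x + g x) <= nrm f + nrm g.
Proof.
move=> Lf Lg; rewrite -(@ler_pXn2r _ 2)// ?nnegrE ?addr_ge0 ?nrm_ge0//.
have := ip_le_nrm Lf Lg; rewrite nrm_sqr ip_sqrD// sqrrD !nrm_sqr -[_ *+ 2]mulr_natl; lra.
Qed.

Lemma nrmB f g : L2 f -> L2 g -> nrm (fun x => f x - g x) = nrm (fun x => g x - f x).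
Proof.
move=> Lf Lg; rewrite -[RHS]mul1r -(normr1 R) -[1 in RHS]opprK normrN -nrmZ; last exact: Lfun2B.
by congr nrm; apply/funext => x; ring.
Qed.

End L2norm.

Lemma ip1_le_nrm d (T : measurableType d) (R : realType) (P : probability T R) (f : T -> R) :
  f \in Lfun P 2%:E -> \int[P]_x `|f x| <= nrm P f.
Proof.
move=> Lf.
have L1 : (fun=> 1 : R) \in Lfun P 2%:E.
  apply/Lfun2P; split => //; rewrite (_ : _ \o _ = EFin \o cst (1 ^+ 2))//.
  exact: finite_measure_integrable_cst.
have Lnf : (fun x => `|f x|) \in Lfun P 2%:E.
  have [mf intf] := (Lfun2P _ _).1 Lf.
  apply: (Lfun2_dominated _ intf); first exact: measurableT_comp.
  by move=> x; rewrite real_normK ?num_real.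
have := ip_CS Lnf L1.
rewrite [ip _ (fun=> 1) _](_ : _ = 1); last first.
  rewrite /ip; under eq_Rintegral do rewrite mulr1.
  by rewrite Rintegral_cst// [X in fine X]probability_setT mul1r.
rewrite mulr1 [X in X ^+ 2](_ : _ = \int[P]_x `|f x|); last first.
  by rewrite /ip; under eq_Rintegral do rewrite mulr1.
rewrite (_ : ip P _ _ = ip P f f) -?nrm_sqr; last first.
  by rewrite ?nrm_sqr !ipE; apply: eq_Rintegral => x _; rewrite real_normK ?num_real.
by rewrite ler_pXn2r// ?nnegrE ?nrm_ge0// Rintegral_ge0.
Qed.

(** * Trigonometric estimates, integration on the torus and the cosine modes *)

Section SinCos.
Variable R : realType.
Implicit Types x y : R.

Lemma lipschitz_MVT (f df : R -> R) : (forall x, is_derive x 1 f (df x)) ->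
  (forall x, `|df x| <= 1) -> forall x y, `|f x - f y| <= `|x - y|.
Proof.
move=> fdf df1.
have cf : continuous f.
  by move=> x; apply: differentiable_continuous; apply/derivable1_diffP; exact: ex_derive.
have H x y : x < y -> `|f y - f x| <= `|y - x|.
  move=> xy; have [c _ ->] := MVT xy (fun z _ => fdf z) (continuous_subspaceT cf).
  by rewrite normrM ler_piMl.
move=> x y; have [xy|yx|->] := ltgtP x y.
- by rewrite distrC (distrC x); exact: H.
- exact: H.
- by rewrite !subrr normr0.
Qed.

Lemma sin_lipschitz x y : `|sin x - sin y| <= `|x - y|.
Proof. by apply: (lipschitz_MVT (@is_derive_sin R)) => z; rewrite ler_norml cos_geN1 cos_le1. Qed.

Lemma cos_lipschitz x y : `|cos x - cos y| <= `|x - y|.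
Proof.
apply: (lipschitz_MVT (@is_derive_cos R)) => z; rewrite normrN; exact: sin_max.
Qed.

(** By the mean value theorem a - sin a = a (1 - cos c) with |c| <= |a|, hence |a - sin a| <= a^2.
    This is how an unbounded Gaussian variable is recovered from bounded functions of it. *)
Lemma cvg_sin_scale x : n.+1%:R * sin (x / n.+1%:R) @[n --> \oo] --> x.
Proof.
have H n : `|x - n.+1%:R * sin (x / n.+1%:R)| <= `|x| ^+ 2 * n.+1%:R^-1.
  pose a := x / n.+1%:R.
  have n0 : 0 < n.+1%:R :> R by rewrite ltr0n.
  have -> : x = n.+1%:R * a by rewrite /a mulrCA mulfV ?mulr1// gt_eqF.
  rewrite [n.+1%:R * a / _](_ : _ = a); last by rewrite mulrAC mulfV ?mul1r// gt_eqF.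
  clearbody a; suff : `|a - sin a| <= `|a| * `|a|.
    move=> h.
    rewrite -mulrBr !normrM (gtr0_norm n0) (_ : _ ^+ 2 / _ = n.+1%:R * (`|a| * `|a|)).
      by rewrite ler_pM2l.
    by move: n0; move: n.+1%:R => N n0; field; rewrite gt_eqF.
  have [a0|a0|->] := ltgtP a 0; last by rewrite sin0 subrr !normr0 mul0r.
  - have [c /itvP ca] := MVT a0 (fun z _ => is_derive_sin z)
      (continuous_subspaceT (@continuous_sin R)).
    rewrite sin0 !sub0r mulrN => /oppr_inj ->.
    rewrite -[X in `|X - _|]mul1r -mulrBl normrM ler_wpM2r// -cos0.
    by rewrite (le_trans (cos_lipschitz _ _))// sub0r normrN !ler0_norm ?lerN2 ?ca// ltW.
  - have [c /itvP ca] := MVT a0 (fun z _ => is_derive_sin z)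
      (continuous_subspaceT (@continuous_sin R)).
    rewrite sin0 !subr0 => ->.
    rewrite -[X in `|X - _|]mul1r -mulrBl normrM ler_wpM2r// -cos0.
    by rewrite (le_trans (cos_lipschitz _ _))// sub0r normrN !ger0_norm ?ca// ltW.
have : `|x| ^+ 2 * n.+1%:R^-1 @[n --> \oo] --> `|x| ^+ 2 * 0.
  by apply: cvgMl_tmp; exact: (@cvg_harmonic R).
rewrite mulr0 => /cvgrPdist_le h.
apply/cvgrPdist_le => e /h; apply: filterS => n.
rewrite sub0r normrN => /(le_trans (ler_norm _)); exact: le_trans.
Qed.

End SinCos.

Section Calculus.
Variable R : realType.
Local Notation leb := (@lebesgue_measure R).
Implicit Types (F f : R -> R) (a b c t : R).

Lemma RFTC F f a b : a <= b -> (forall x : R, is_derive x 1 F (f x)) -> continuous f ->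
  \int[leb]_(x in `[a, b]) f x = F b - F a.
Proof.
rewrite le_eqVlt => /predU1P[->|ab] dF cf.
  by rewrite set_itv1 Rintegral_set1 subrr.
have cF : continuous F.
  by move=> x; apply: differentiable_continuous; apply/derivable1_diffP; exact: ex_derive.
rewrite /Rintegral (@continuous_FTC2 _ f F a b ab)//.
- exact: continuous_subspaceT.
- split.
  + by move=> x _; exact: ex_derive.
  + exact/cvg_at_right_filter/cF.
  + exact/cvg_at_left_filter/cF.
- by move=> x _; rewrite derive1E derive_val.
Qed.

Lemma continuous_itv_integrable f a b : continuous f -> leb.-integrable `[a, b] (EFin \o f).
Proof.
move=> cf; apply: continuous_compact_integrable; first exact: segment_compact.
exact: continuous_subspaceT.
Qed.

Lemma torus_FTC F f : (forall x : R, is_derive x 1 F (f x)) -> continuous f ->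
  \int[torus_mu]_x f x = F 1 - F 0.
Proof.
move=> dF cf; rewrite -(RFTC ler01 dF cf) Rintegral_mrestr; last exact: continuous_measurable_fun.
apply: Rintegral_itv_bndo_bndc.
apply: integrableS (continuous_itv_integrable 0 1 cf) => //.
by apply: subset_itvl; rewrite bnd_simp.
Qed.

Lemma unit_FTC F f t : (forall x : R, is_derive x 1 F (f x)) -> continuous f -> 0 <= t <= 1 ->
  \int[unit_mu]_x (if x < t then f x else 0) = F t - F 0.
Proof.
move=> dF cf /andP[t0 t1]; rewrite -(RFTC t0 dF cf) Rintegral_mrestr; last first.
  apply: measurable_fun_ifT => //; first exact: measurable_fun_ltr.
  exact: continuous_measurable_fun.
rewrite -Rintegral_itv_bndo_bndc; last first.
  apply: integrableS (continuous_itv_integrable 0 t cf) => //.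
  by apply: subset_itvl; rewrite bnd_simp.
rewrite Rintegral_mkcond [RHS]Rintegral_mkcond; apply: eq_Rintegral => x _.
rewrite !patchE !mem_setE !in_itv/=; case: (ltP x t) => xt; rewrite ?andbT ?andbF.
  by rewrite (le_trans (ltW xt) t1) andbT.
by case: ifP.
Qed.

Lemma cosDn2pi (n : nat) x : cos (x + 2 * pi * n%:R) = cos x :> R.
Proof.
elim: n => [|n IH]; first by rewrite mulr0 addr0.
rewrite -[n.+1%:R]natr1 mulrDr mulr1 addrA cosD (mulr_natl pi 2) cos2pi sin2pi -(mulr_natl pi 2) IH; lra.
Qed.

Lemma sinDn2pi (n : nat) x : sin (x + 2 * pi * n%:R) = sin x :> R.
Proof.
elim: n => [|n IH]; first by rewrite mulr0 addr0.
rewrite -[n.+1%:R]natr1 mulrDr mulr1 addrA sinD (mulr_natl pi 2) cos2pi sin2pi -(mulr_natl pi 2) IH; lra.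
Qed.

Lemma sinDz2pi (m : int) x : sin (x + 2 * pi * m%:~R) = sin x :> R.
Proof.
case: m => n; first exact: sinDn2pi.
by rewrite NegzE mulrNz -pmulrn -(sinDn2pi n.+1); congr sin; ring.
Qed.

Lemma is_derive_affine a c (x : R) : is_derive x 1 (fun y : R => a * y + c) a.
Proof. by apply: is_derive_eq; rewrite !(scaler0, mulr0, addr0, add0r, scaler1, mulr1). Qed.

Lemma is_derive_comp_affine k a c (G g : R -> R) (x : R) :
  (forall y : R, is_derive y 1 G (g y)) ->
  is_derive x 1 (fun y => k * G (a * y + c)) (k * (g (a * x + c) * a)).
Proof.
move=> dG; apply: (@is_deriveZ R R R (fun y => G (a * y + c)) k).
exact: (is_derive1_comp (dG _) (is_derive_affine a c x)).
Qed.

Lemma continuous_affine a c : continuous (fun y : R => a * y + c).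
Proof. by move=> y; apply: cvgD; [apply: cvgM; [exact: cvg_cst|exact: cvg_id]|exact: cvg_cst]. Qed.

Lemma torus_cos_int (m : int) c : m != 0 ->
  \int[torus_mu]_y cos (2 * pi * m%:~R * y + c) = 0.
Proof.
move=> m0; pose a : R := 2 * pi * m%:~R.
have a0 : a != 0 by rewrite !mulf_neq0 ?intr_eq0// gt_eqF// pi_gt0.
have dF (x : R) : is_derive x 1 (fun y => a^-1 * sin (a * y + c)) (cos (a * x + c)).
  have -> : cos (a * x + c) = a^-1 * (cos (a * x + c) * a) by rewrite mulrCA mulVf ?mulr1.
  exact: (@is_derive_comp_affine a^-1 a c sin cos x (fun y => is_derive_sin y)).
have cf : continuous (fun y => cos (a * y + c)).
  by move=> x; apply: continuous_comp; [exact: continuous_affine|exact: continuous_cos].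
by rewrite (torus_FTC dF cf) mulr1 mulr0 add0r /a (addrC _ c) sinDz2pi subrr.
Qed.

Lemma torus_cos_intE (m : int) c :
  \int[torus_mu]_y cos (2 * pi * m%:~R * y + c) = if m == 0 then cos c else 0.
Proof.
case: eqP => [->|/eqP]; last exact: torus_cos_int.
under eq_Rintegral do rewrite mulr0 mul0r add0r.
by rewrite Rintegral_cst// [X in fine X]torus_mu_setT mulr1.
Qed.

(** The eigenvalue of the negative Laplacian on the torus at the frequencies k and -k. *)
Definition lam (k : nat) : R := 4 * pi ^+ 2 * k%:R ^+ 2.

Definition cosn (k : nat) (x : R) : R := cos (2 * pi * k%:R * x).

(* The number of modes [n] in Z with [|n| = k]. *)
Definition mult (k : nat) : R := if k == 0%N then 1 else 2.

(** The conjugate terms k and -k of the heat kernel, merged into one real term; [kernel_sum K]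
    collects the frequencies strictly below K. *)
Definition kernel_mode (t x : R) (k : nat) : R :=
  mult k * (expR (- (lam k * t)) * cosn k x).

Definition kernel_sum (K : nat) (t x : R) : R := series (kernel_mode t x) K.

Lemma cosnN k x : cosn k (- x) = cosn k x.
Proof. by rewrite /cosn mulrN cosN. Qed.

Lemma cosn0 x : cosn 0 x = 1.
Proof. by rewrite /cosn mulr0 mul0r cos0. Qed.

Lemma cosn_norm k x : `|cosn k x| <= 1.
Proof. by rewrite ler_norml cos_geN1 cos_le1. Qed.

Lemma continuous_cosn k : continuous (cosn k).
Proof. by move=> x; apply: continuous_comp; [exact: mulrl_continuous|exact: continuous_cos]. Qed.

Lemma measurable_cosn k : measurable_fun setT (cosn k).
Proof. by apply: continuous_measurable_fun; exact: continuous_cosn. Qed.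

Lemma mult_gt0 k : 0 < mult k.
Proof. by rewrite /mult; case: ifP. Qed.

Lemma mult_le2 k : mult k <= 2.
Proof. by rewrite /mult; case: ifP => _; lra. Qed.

Lemma lam_ge0 k : 0 <= lam k.
Proof. by rewrite /lam -mulrA mulr_ge0// mulr_ge0 ?sqr_ge0. Qed.

Lemma torus_bounded_integrable c f : measurable_fun setT f -> (forall x, `|f x| <= c) ->
  (@torus_mu R).-integrable setT (EFin \o f).
Proof.
move=> mf fc; apply: (@rint_le _ _ _ _ _ (fun=> c)) => //.
exact: finite_measure_integrable_cst.
Qed.

(** The product-to-sum formula leaves the frequencies n - j and n + j. The second vanishes only for
    n = j = 0, which explains why the constant mode has weight 1 and the others 1/2. *)
Lemma torus_cosn_convolution j n x z :
  \int[torus_mu]_y (cosn j (x - y) * cosn n (y - z)) =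
  if j == n then (mult n)^-1 * cosn n (x - z) else 0.
Proof.
have E y : cosn j (x - y) * cosn n (y - z) =
    2^-1 * cos (2 * pi * (n%:Z - j%:Z)%:~R * y + 2 * pi * (j%:R * x - n%:R * z)) +
    2^-1 * cos (2 * pi * (n%:Z + j%:Z)%:~R * y + (- (2 * pi * (j%:R * x + n%:R * z)))).
  rewrite intrB intrD -!pmulrn /cosn.
  set u := 2 * pi * j%:R * (x - y); set v := 2 * pi * n%:R * (y - z).
  rewrite [X in _ * cos X + _](_ : _ = u + v); last by rewrite /u /v; ring.
  rewrite [X in _ + _ * cos X](_ : _ = v - u); last by rewrite /u /v; ring.
  by rewrite cosD cosB; field.
have I (a c : R) : (@torus_mu R).-integrable setT (EFin \o (fun y => cos (a * y + c))).
  apply: (@torus_bounded_integrable 1) => [|y]; last by rewrite ler_norml cos_geN1 cos_le1.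
  apply: continuous_measurable_fun => y.
  by apply: continuous_comp; [exact: continuous_affine|exact: continuous_cos].
under eq_Rintegral do rewrite E.
rewrite RintegralD//; [|exact/rintZ/I|exact/rintZ/I].
rewrite !(RintegralZl _ measurableT (I _ _)) !torus_cos_intE.
rewrite subr_eq0 -PoszD !eqz_nat addn_eq0 [n == j]eq_sym.
have [->|jn] := eqVneq j n.
  rewrite andbb /mult; case: eqVneq => [->|n0].
    by rewrite !mul0r !subrr addr0 mulr0 oppr0 cos0 cosn0; field.
  by rewrite mulr0 addr0 /cosn -mulrBr mulrA.
case: ifP => [/andP[/eqP n0 /eqP j0]|_]; last by rewrite !mulr0 addr0.
by rewrite n0 j0 eqxx in jn.
Qed.

Lemma measurable_kernel_sum K d (T : measurableType d) (f g : T -> R) :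
  measurable_fun setT f -> measurable_fun setT g ->
  measurable_fun setT (fun w => kernel_sum K (f w) (g w)).
Proof.
move=> mf mg; apply: measurable_sum => k.
apply: measurable_funM => //; apply: measurable_funM.
  apply: measurableT_comp; first exact: measurable_expR.
  by apply: measurableT_comp => //; apply: measurable_funM.
exact: (measurableT_comp (measurable_cosn k) mg).
Qed.

Lemma kernel_sum_convolution K t n x z :
  \int[torus_mu]_y (kernel_sum K t (x - y) * cosn n (y - z)) =
  if (n < K)%N then expR (- (lam n * t)) * cosn n (x - z) else 0.
Proof.
have I k : (@torus_mu R).-integrable setT
    (EFin \o (fun y => cosn k (x - y) * cosn n (y - z))).
  apply: (@torus_bounded_integrable 1) => [|y]; last first.
    by rewrite normrM mulr_ile1 ?cosn_norm.
  apply: measurable_funM; apply: measurableT_comp (measurable_cosn _) _;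
    exact: measurable_funB.
under eq_Rintegral do rewrite /kernel_sum /series/= mulr_suml.
under eq_Rintegral do under eq_bigr do rewrite /kernel_mode -(mulrA (mult _)) -(mulrA (expR _)).
rewrite Rintegral_sum => [|k _]; last exact/rintZ/rintZ/I.
under eq_bigr => k _.
  rewrite (RintegralZl _ measurableT (rintZ _ (I k))) (RintegralZl _ measurableT (I k)).
  rewrite torus_cosn_convolution; over.
case: ltnP => nK.
  rewrite (bigD1_seq n) ?mem_index_iota ?iota_uniq//= eqxx big1 => [|k /negPf ->]; last by rewrite !mulr0.
  by rewrite addr0 mulrCA mulVKf// gt_eqF// mult_gt0.
rewrite big_nat big1// => k /andP[_ kK].
by rewrite ltn_eqF ?mulr0// (leq_trans kK nK).
Qed.

Lemma lam_ge k : 4 * pi ^+ 2 * k%:R <= lam k.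
Proof.
apply: ler_wpM2l; first by rewrite mulr_ge0 ?sqr_ge0.
rewrite expr2 -natrM ler_nat.
by case: k => // k; rewrite leq_pmulr.
Qed.

(** From k <= k^2. The crude bound gives convergence and a bound on the partial sums uniform in x
    and K, as dominated convergence needs. *)
Lemma kernel_mode_geometric t x k : 0 < t ->
  `|kernel_mode t x k| <= geometric 2 (expR (- (4 * pi ^+ 2 * t))) k.
Proof.
move=> t0; rewrite /kernel_mode /geometric/= !normrM (gtr0_norm (mult_gt0 k)) (ger0_norm (expR_ge0 _)).
rewrite ler_pM ?mult_le2// ?(ltW (mult_gt0 k)) ?mulr_ge0 ?expR_ge0//.
rewrite -[leRHS]mulr1 ler_pM ?expR_ge0 ?cosn_norm// -expRM_natr ler_expR.
by rewrite mulNr lerN2 mulrAC ler_pM2r ?lam_ge.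
Qed.

Lemma heat_ratio_lt1 t : 0 < t -> expR (- (4 * pi ^+ 2 * t)) < 1 :> R.
Proof. by move=> t0; rewrite -expR0 ltr_expR oppr_lt0 mulr_gt0 ?mulr_gt0 ?exprn_gt0 ?pi_gt0. Qed.

Lemma cvg_kernel_sum t x : 0 < t -> cvgn (fun K => kernel_sum K t x).
Proof.
move=> t0; apply: normed_cvg.
apply: (@series_le_cvg _ _ (geometric 2 (expR (- (4 * pi ^+ 2 * t))))) => //.
- by move=> k; exact: normr_ge0.
- by move=> k; rewrite /geometric/= mulr_ge0// exprn_ge0 ?expR_ge0.
- by move=> k; exact: kernel_mode_geometric.
- by apply: is_cvg_geometric_series; rewrite ger0_norm ?expR_ge0 ?heat_ratio_lt1.
Qed.

Lemma kernel_sum_bounded t K x : 0 < t ->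
  `|kernel_sum K t x| <= 2 / (1 - expR (- (4 * pi ^+ 2 * t))).
Proof.
move=> t0; have q1 := heat_ratio_lt1 t0.
rewrite /kernel_sum /series/=; apply: (le_trans (ler_norm_sum _ _ _)).
apply: (@le_trans _ _ (series (geometric 2 (expR (- (4 * pi ^+ 2 * t)))) K)).
  by apply: ler_sum => k _; exact: kernel_mode_geometric.
rewrite geometric_seriesE ?lt_eqF//= ler_pM2r ?invr_gt0 ?subr_gt0//.
by rewrite -[leRHS]mulr1 ler_wpM2l// gerBl exprn_ge0// expR_ge0.
Qed.

End Calculus.

Arguments lam {R} k.
Arguments mult {R} k.

(** * Wiener integrals *)

Section NoiseIntegral.
Context {R : realType} {d : measure_display} {Omega : measurableType d}.
Variable P : probability Omega R.
Variables (xi : set (R * R) -> Omega -> R) (I : (R * R -> R) -> Omega -> R).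
Hypotheses (Hxi : white_noise P xi) (HI : stochastic_integral P xi I).
Local Notation smu := (@spacetime_mu R).
Local Notation L2 phi := (L2_spacetime R phi).
Implicit Types phi psi : R * R -> R.

Lemma I_L2 phi : L2 phi -> I phi \in Lfun P 2%:E.
Proof. by case: HI => h _ _ /h[]. Qed.

Lemma I_isometry phi : L2 phi -> ip P (I phi) (I phi) = ip smu phi phi.
Proof.
case: HI => h _ _ Lphi; have [LI] := h _ Lphi.
by rewrite !Lnorm2E// => -[] /eqP; rewrite eqr_sqrt ?ip_ge0// => /eqP.
Qed.

Lemma I_comb a b phi psi : L2 phi -> L2 psi ->
  ae_eq P setT (I (fun z => a * phi z + b * psi z)) (fun w => a * I phi w + b * I psi w).
Proof. by case: HI => _ h _ Lphi Lpsi; apply: filterS (h a b _ _ Lphi Lpsi) => w. Qed.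

Lemma I_scale a phi : L2 phi -> ae_eq P setT (I (fun z => a * phi z)) (fun w => a * I phi w).
Proof.
move=> Lphi; have := I_comb a 0 Lphi Lphi.
rewrite (_ : (fun z => a * phi z + 0 * phi z) = (fun z => a * phi z)); last first.
  by apply/funext => z; rewrite mul0r addr0.
by apply: filterS => w /(_ Logic.I) -> _; rewrite mul0r addr0.
Qed.

Lemma I_zero : ae_eq P setT (I (fun=> 0)) (cst 0).
Proof.
have := I_scale 0 (@Lfun2_0 _ _ _ smu).
rewrite (_ : (fun z : R * R => 0 * 0) = (fun=> 0)); last by apply/funext => z; rewrite mul0r.
by apply: filterS => w /(_ Logic.I) -> _; rewrite mul0r.
Qed.

Lemma I_sum (J : Type) (r : seq J) (a : J -> R) (phi : J -> R * R -> R) :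
  (forall j, L2 (phi j)) ->
  ae_eq P setT (I (fun z => \sum_(j <- r) a j * phi j z))
    (fun w => \sum_(j <- r) a j * I (phi j) w).
Proof.
move=> Lphi; elim: r => [|j r IH].
  rewrite (_ : (fun z => _) = (fun=> 0)); last by apply/funext => z; rewrite big_nil.
  by apply: filterS I_zero => w /(_ Logic.I) -> _; rewrite big_nil.
have Ls : L2 (fun z => \sum_(j <- r) a j * phi j z).
  by apply: Lfun2_sum => i _; exact: Lfun2Z.
rewrite (_ : (fun z => _) = (fun z => a j * phi j z + 1 * \sum_(j0 <- r) a j0 * phi j0 z)).
  move: IH (I_comb (a j) 1 (Lphi j) Ls).
  by apply: filterS2 => w /(_ Logic.I) h1 /(_ Logic.I) -> _; rewrite mul1r h1 big_cons.
by apply/funext => z; rewrite big_cons mul1r.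
Qed.

(** [I] is only constrained up to null sets and acts on functions, not on classes. That it respects
    almost everywhere equality follows from the isometry applied to the difference. *)
Lemma I_ae_eq phi psi : L2 phi -> L2 psi -> ae_eq smu setT phi psi ->
  ae_eq P setT (I phi) (I psi).
Proof.
move=> Lphi Lpsi pp.
have LB := Lfun2_comb 1 (-1) Lphi Lpsi.
have B0 : ip smu (fun z => 1 * phi z + (-1) * psi z) (fun z => 1 * phi z + (-1) * psi z) = 0.
  rewrite (@ip_ae _ _ _ _ _ (fun=> 0)) ?ip0l//; try exact: Lfun2_measurable LB.
  by apply: filterS pp => z /(_ Logic.I) -> _; ring.
have := ip_eq0 (I_L2 LB); rewrite I_isometry// B0 => /(_ erefl).
move: (I_comb 1 (-1) Lphi Lpsi).
by apply: filterS2 => w /(_ Logic.I) -> /(_ Logic.I)/= h _; lra.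
Qed.

Lemma I_ip phi psi : L2 phi -> L2 psi -> ip P (I phi) (I psi) = ip smu phi psi.
Proof.
move=> Lphi Lpsi.
have := I_isometry (Lfun2D Lphi Lpsi).
have LI := I_L2 Lphi; have LJ := I_L2 Lpsi; have LS := I_L2 (Lfun2D Lphi Lpsi).
have h : ae_eq P setT (I (fun z => phi z + psi z)) (fun w => I phi w + I psi w).
  have := I_comb 1 1 Lphi Lpsi.
  rewrite (_ : (fun z => 1 * phi z + 1 * psi z) = (fun z => phi z + psi z)).
    by apply: filterS => w /(_ Logic.I) -> _; rewrite !mul1r.
  by apply/funext => z; rewrite !mul1r.
have mIJ := Lfun2_measurable (Lfun2D LI LJ); have mS := Lfun2_measurable LS.
rewrite (ip_ae mS mIJ mS h) ipC (ip_ae mS mIJ mIJ h) ip_sqrD// (ip_sqrD Lphi Lpsi).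
rewrite !I_isometry//; lra.
Qed.

Lemma I_indic A : borel_spacetime A -> ae_eq P setT (I \1_A) (xi A).
Proof. by case: HI => _ _ h bA; apply: filterS (h _ bA) => w. Qed.

Definition borel_steps (s : seq (R * set (R * R))) := forall p, p \in s -> borel_spacetime p.2.

Lemma indic_L2 A : borel_spacetime A -> L2 (\1_A : R * R -> R).
Proof.
move=> [mA _]; apply/Lfun2P; split; first exact: measurable_indic.
apply: measurable_bounded_integrable => //.
- by rewrite (le_lt_trans (probability_le1 _ _))// ltry.
- by apply: measurable_funX; exact: measurable_indic.
- exists 1; split => // M M1 z _ /=; rewrite (le_trans _ (ltW M1))//.
  by rewrite indicE; case: (_ \in _); rewrite ?expr1n ?expr0n ?normr1 ?normr0.
Qed.

Lemma step_fun_tnth (s : seq (R * set (R * R))) z :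
  step_fun s z = \sum_(i < size s) (tnth (in_tuple s) i).1 * \1_((tnth (in_tuple s) i).2) z.
Proof. by rewrite /step_fun big_tnth. Qed.

Lemma I_step s : borel_steps s -> ae_eq P setT (I (step_fun s))
  (fun w => \sum_(i < size s) (tnth (in_tuple s) i).1 * xi (tnth (in_tuple s) i).2 w).
Proof.
move=> bs.
have Lt (i : 'I_(size s)) : L2 (\1_((tnth (in_tuple s) i).2) : R * R -> R).
  by apply: indic_L2; apply: bs; exact: mem_tnth.
rewrite (_ : step_fun s = (fun z => \sum_(i < size s) (tnth (in_tuple s) i).1 *
  \1_((tnth (in_tuple s) i).2) z)); last by apply/funext => z; rewrite step_fun_tnth.
have h := I_sum (index_enum _) (fun i => (tnth (in_tuple s) i).1) Lt.
have : {ae P, forall w, forall i : 'I_(size s),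
    I \1_((tnth (in_tuple s) i).2) w = xi (tnth (in_tuple s) i).2 w}.
  apply: filter_forall => i.
  have := I_indic (bs _ (mem_tnth i (in_tuple s))).
  by apply: filterS => w /(_ Logic.I).
move: h; apply: filterS2 => w /(_ Logic.I) -> h _.
by apply: eq_bigr => i _; rewrite h.
Qed.

Lemma step_L2 s : borel_steps s -> L2 (step_fun s).
Proof.
move=> bs; rewrite (_ : step_fun s = (fun z => \sum_(i < size s) (tnth (in_tuple s) i).1 *
  \1_((tnth (in_tuple s) i).2) z)); last by apply/funext => z; rewrite step_fun_tnth.
apply: Lfun2_sum => i _; apply: Lfun2Z; apply: indic_L2.
by apply: bs; exact: mem_tnth.
Qed.

(** Only for step functions is the integral directly a linear combination of noise values, and hence
    Gaussian by the axioms of white noise. *)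
Lemma I_step_law s t (f : R -> R) : borel_steps s -> borel_steps t ->
  ip smu (step_fun s) (step_fun s) = ip smu (step_fun t) (step_fun t) ->
  measurable_fun setT f -> (forall x, `|f x| <= 1) ->
  \int[P]_w f (I (step_fun s) w) = \int[P]_w f (I (step_fun t) w).
Proof.
move=> bs bt st mf f1.
pose X (s : seq (R * set (R * R))) w :=
  \sum_(i < size s) (tnth (in_tuple s) i).1 * xi (tnth (in_tuple s) i).2 w.
have gX u : borel_steps u -> centred_gaussian P (X u).
  move=> bu; have [_ hx] := Hxi.
  have [h _] := hx _ (fun i => (tnth (in_tuple u) i).2) (fun i => bu _ (mem_tnth i (in_tuple u))).
  exact: h.
have E u : borel_steps u -> [/\ X u \in Lfun P 2%:E, ip P (X u) (X u) = ip smu (step_fun u) (step_fun u)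
    & \int[P]_w f (I (step_fun u) w) = \int[P]_w f (X u w)].
  move=> bu; have LI := I_L2 (step_L2 bu); have hI := I_step bu.
  have mI := Lfun2_measurable LI; have mX : measurable_fun setT (X u) by case: (gX _ bu).
  split.
  - exact: Lfun2_ae hI LI.
  - rewrite -(I_isometry (step_L2 bu)) (ip_ae mI mX mI hI) (ipC _ (X u)).
    by rewrite (ip_ae mI mX mX hI).
  - apply: ae_eq_Rintegral; try exact: measurableT_comp.
    by apply: filterS hI => w /(_ Logic.I) -> _.
have [LXs nXs ->] := E _ bs; have [LXt nXt ->] := E _ bt.
apply: Rintegral_law_eq => //.
- exact: Lfun2_measurable LXs.
- exact: Lfun2_measurable LXt.
- by apply: centred_gaussian_law_eq => //; [exact: gX|exact: gX|rewrite nXs nXt].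
Qed.

End NoiseIntegral.

Lemma Lfun2_rint d (T : measurableType d) (R : realType) (mu : {finite_measure set T -> \bar R})
    (f : T -> R) : f \in Lfun mu 2%:E -> mu.-integrable setT (EFin \o f).
Proof.
move=> /Lfun2P[mf intf]; apply: (@rint_le _ _ _ _ _ (fun x => 1 + f x ^+ 2)) => //.
  by apply: rintD => //; exact: (finite_measure_integrable_cst mu).
move=> x; have := sqr_ge0 (`|f x| - 1); rewrite -[f x ^+ 2]real_normK ?num_real//.
by have := normr_ge0 (f x); nra.
Qed.

(** Approximants of two integrands of equal norm can be compared by [I_step_law] only if their own
    norms are equal; rescaling achieves this and at most doubles the error. The bound by half the
    norm of [phi] keeps [s] away from 0. *)
Lemma nrm_rescale d (T : measurableType d) (R : realType) (mu : {measure set T -> \bar R})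
    (phi s : T -> R) (e : R) :
  phi \in Lfun mu 2%:E -> s \in Lfun mu 2%:E -> 0 < nrm mu phi ->
  nrm mu (fun z => s z - phi z) <= Num.min (e / 2) (nrm mu phi / 2) ->
  exists c, nrm mu (fun z => c * s z) = nrm mu phi /\
    nrm mu (fun z => c * s z - phi z) <= e.
Proof.
move=> Lphi Ls np; rewrite le_min => /andP[se sn].
have t1 : nrm mu phi <= nrm mu s + nrm mu (fun z => s z - phi z).
  rewrite [X in nrm _ X](_ : _ = (fun z => s z + (phi z - s z))).
    by rewrite (le_trans (nrmD Ls (Lfun2B Lphi Ls)))// lerD2l nrmB.
  by apply/funext => z; ring.
have t2 : nrm mu s <= nrm mu phi + nrm mu (fun z => s z - phi z).
  rewrite [X in nrm _ X](_ : _ = (fun z => phi z + (s z - phi z))).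
    by rewrite (le_trans (nrmD Lphi (Lfun2B Ls Lphi))).
  by apply/funext => z; ring.
have sp : 0 < nrm mu s by lra.
have c0 : 0 < nrm mu phi / nrm mu s by rewrite divr_gt0.
exists (nrm mu phi / nrm mu s); split.
  by rewrite nrmZ// gtr0_norm// divfK ?gt_eqF.
rewrite [X in nrm _ X](_ : _ = (fun z => (nrm mu phi / nrm mu s - 1) * s z + (s z - phi z))).
  rewrite (le_trans (nrmD (Lfun2Z _ Ls) (Lfun2B Ls Lphi)))// nrmZ//.
  have : `|nrm mu phi / nrm mu s - 1| * nrm mu s <= nrm mu (fun z => s z - phi z).
    rewrite -[X in _ * X <= _](gtr0_norm sp) -normrM mulrBl mul1r divfK ?gt_eqF//.
    by rewrite ler_norml; apply/andP; split; lra.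
  lra.
by apply/funext => z; ring.
Qed.

Section NoiseLaw.
Context {R : realType} {d : measure_display} {Omega : measurableType d}.
Variable P : probability Omega R.
Variables (xi : set (R * R) -> Omega -> R) (I : (R * R -> R) -> Omega -> R).
Hypotheses (Hxi : white_noise P xi) (HI : stochastic_integral P xi I).
Local Notation smu := (@spacetime_mu R).
Local Notation L2 phi := (L2_spacetime R phi).
Implicit Types phi psi : R * R -> R.

(** The noise lives on subsets of [spacetime_dom]; cutting the sets down to it changes the step
    function on a null set only. *)
Lemma borel_step_dense phi (e : R) : L2 phi -> 0 < e -> exists s,
  borel_steps s /\ nrm smu (fun z => step_fun s z - phi z) <= e.
Proof.
move=> Lphi e0; have [s [ms Ls se]] := step_dense Lphi (exprn_gt0 2 e0).
pose t := [seq (p.1, p.2 `&` spacetime_dom) | p <- s].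
have bt : borel_steps t.
  move=> _ /mapP[p ps ->]/=; split; last exact: subIsetr.
  by apply: measurableI; [exact: ms|exact: measurable_spacetime_dom].
have ts z : spacetime_dom z -> step_fun t z = step_fun s z.
  move=> Dz; rewrite /step_fun big_map; apply: eq_bigr => p _ /=.
  by rewrite !indicE in_setI (mem_set Dz) andbT.
exists t; split => //; have Lt := step_L2 bt.
rewrite -(@ler_pXn2r _ 2)// ?nnegrE ?nrm_ge0 ?(ltW e0)// nrm_sqr.
apply: le_trans se; rewrite le_eqVlt; apply/orP; left; apply/eqP.
have mt := Lfun2_measurable (Lfun2B Lt Lphi); have ms' := Lfun2_measurable (Lfun2B Ls Lphi).
have E : ae_eq smu setT (fun z => step_fun t z - phi z) (fun z => step_fun s z - phi z).
  by apply: spacetime_ae => z Dz; rewrite ts.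
by rewrite (ip_ae mt ms' mt E) ipC (ip_ae mt ms' ms' E).
Qed.

Lemma borel_step_dense_norm phi (e : R) : L2 phi -> 0 < e -> exists s,
  [/\ borel_steps s, nrm smu (step_fun s) = nrm smu phi &
     nrm smu (fun z => step_fun s z - phi z) <= e].
Proof.
move=> Lphi e0; have [n0|n0] := eqVneq (nrm smu phi) 0.
  have E : step_fun [::] = (fun=> 0 : R) :> (R * R -> R).
    by apply/funext => z; rewrite /step_fun big_nil.
  exists [::]; rewrite E; split => //.
    by rewrite n0 /nrm ip0l sqrtr0.
  rewrite nrmB//; last exact: Lfun2_0.
  rewrite (_ : (fun z => _) = phi); last by apply/funext => z; rewrite subr0.
  by rewrite n0 ltW.
have np : 0 < nrm smu phi by rewrite lt_neqAle eq_sym n0 nrm_ge0.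
have e'0 : 0 < Num.min (e / 2) (nrm smu phi / 2) by rewrite lt_min !divr_gt0.
have [s [bs se]] := borel_step_dense Lphi e'0; have Ls := step_L2 bs.
have [c [h1 h2]] := nrm_rescale Lphi Ls np se.
have E z : step_fun [seq (c * p.1, p.2) | p <- s] z = c * step_fun s z by exact: step_fun_scale.
by exists [seq (c * p.1, p.2) | p <- s]; rewrite (funext E); split => // _ /mapP[p /bs ? ->].
Qed.

(** Both integrands are approximated by step functions of exactly the same norm, whose integrals
    have the same law; the Lipschitz property bounds the error by an L^1 norm, hence by the L^2
    norm. The law of [I phi] itself need not be identified. *)
Lemma I_law_eq phi psi (f : R -> R) : L2 phi -> L2 psi -> ip smu phi phi = ip smu psi psi ->
  measurable_fun setT f -> (forall x, `|f x| <= 1) -> (forall x y, `|f x - f y| <= `|x - y|) ->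
  \int[P]_w f (I phi w) = \int[P]_w f (I psi w).
Proof.
move=> Lphi Lpsi pp mf f1 flip.
have intf u : L2 u -> P.-integrable setT (EFin \o (fun w => f (I u w))).
  move=> Lu; apply: measurable_bounded_integrable => //.
  - by rewrite (le_lt_trans (probability_le1 _ _))// ltry.
  - by apply: measurableT_comp => //; exact: Lfun2_measurable (I_L2 HI Lu).
  - by exists 1; split => // M M1 w _ /=; rewrite (le_trans (f1 _))// ltW.
have close u (e : R) : L2 u -> 0 < e -> exists s, [/\ borel_steps s,
    ip smu (step_fun s) (step_fun s) = ip smu u u &
    `|\int[P]_w f (I (step_fun s) w) - \int[P]_w f (I u w)| <= e].
  move=> Lu e0; have [s [bs ns se]] := borel_step_dense_norm Lu e0; have Ls := step_L2 bs.
  exists s; split => //; first by rewrite -!nrm_sqr ns.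
  have LIs := I_L2 HI Ls; have LIu := I_L2 HI Lu; have LB := Lfun2B LIs LIu.
  have [mB iB] : measurable_fun setT (fun w => I (step_fun s) w - I u w) /\
      P.-integrable setT (EFin \o (fun w => I (step_fun s) w - I u w)).
    split; first exact: Lfun2_measurable LB.
    exact: Lfun2_rint LB.
  rewrite -RintegralB//=; try exact: intf.
  rewrite (le_trans (le_normr_Rintegral _ _))//; first exact: (rintB (intf _ Ls) (intf _ Lu)).
  apply: (@le_trans _ _ (\int[P]_w `|I (step_fun s) w - I u w|)).
    apply: le_Rintegral => //=; first exact: integrable_norm (rintB (intf _ Ls) (intf _ Lu)).
    exact: integrable_norm iB.
  rewrite (le_trans (ip1_le_nrm LB))//; apply: le_trans se.
  rewrite -(@ler_pXn2r _ 2)// ?nnegrE ?nrm_ge0// !nrm_sqr -(I_isometry HI); last exact: Lfun2B.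
  have h : ae_eq P setT (I (fun z => step_fun s z - u z)) (fun w => I (step_fun s) w - I u w).
    have := I_comb HI 1 (-1) Ls Lu.
    rewrite (_ : (fun z => 1 * step_fun s z + (-1) * u z) = (fun z => step_fun s z - u z)).
      by apply: filterS => w /(_ Logic.I) -> _; ring.
    by apply/funext => z; ring.
  have mI := Lfun2_measurable (I_L2 HI (Lfun2B Ls Lu)).
  by rewrite (ip_ae mI mB mI h) ipC (ip_ae mI mB mB h).
apply/eqP; rewrite -subr_eq0 -normr_le0; apply/ler_addgt0Pr => e e0; rewrite add0r.
have e2 : 0 < e / 2 by rewrite divr_gt0.
have [s [bs ns se]] := close _ _ Lphi e2; have [t [bt nt te]] := close _ _ Lpsi e2.
have st := I_step_law Hxi HI bs bt (etrans ns (etrans pp (esym nt))) mf f1.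
rewrite st in se; rewrite distrC in se.
rewrite [X in `|X|](_ : _ = (\int[P]_w f (I phi w) - \int[P]_w f (I (step_fun t) w)) +
  (\int[P]_w f (I (step_fun t) w) - \int[P]_w f (I psi w))); last by ring.
rewrite (le_trans (ler_normD _ _))//; lra.
Qed.

End NoiseLaw.

Lemma ip_comb_orth d (T : measurableType d) (R : realType) (mu : {measure set T -> \bar R})
    (a b : R) (f g : T -> R) : f \in Lfun mu 2%:E -> g \in Lfun mu 2%:E -> ip mu f g = 0 ->
  ip mu (fun x => a * f x + b * g x) (fun x => a * f x + b * g x) =
  a ^+ 2 * ip mu f f + b ^+ 2 * ip mu g g.
Proof.
move=> Lf Lg fg; have LL := Lfun2_comb a b Lf Lg.
by rewrite ip_combl// !ip_combr// (ipC _ g f) fg; ring.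
Qed.

(** * Orthogonal integrands and independence *)

Section GaussianIndependence.
Context {R : realType} {d : measure_display} {Omega : measurableType d}.
Variable P : probability Omega R.
Variables (xi : set (R * R) -> Omega -> R) (I : (R * R -> R) -> Omega -> R).
Hypotheses (Hxi : white_noise P xi) (HI : stochastic_integral P xi I).
Local Notation smu := (@spacetime_mu R).
Local Notation L2 phi := (L2_spacetime R phi).
Implicit Types phi psi : R * R -> R.

Let bounded_rint (h : Omega -> R) : measurable_fun setT h -> (forall w, `|h w| <= 1) ->
  P.-integrable setT (EFin \o h).
Proof.
move=> mh h1; apply: measurable_bounded_integrable => //.
- by rewrite (le_lt_trans (probability_le1 _ _))// ltry.
- by exists 1; split => // M M1 w _ /=; rewrite (le_trans (h1 _))// ltW.
Qed.

(** The integrals of [phi] and of its opposite have the same law, and the sine is odd. *)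
Lemma I_sin0 phi : L2 phi -> \int[P]_w sin (I phi w) = 0.
Proof.
move=> Lphi; have LN := Lfun2Z (-1) Lphi.
have : \int[P]_w sin (I phi w) = \int[P]_w sin (I (fun z => -1 * phi z) w).
  apply: (I_law_eq Hxi HI Lphi LN); first by rewrite ipZl// ipZr//; ring.
  - exact: measurable_sin.
  - exact: sin_max.
  - exact: sin_lipschitz.
have mI := Lfun2_measurable (I_L2 HI Lphi).
have mN := Lfun2_measurable (I_L2 HI LN).
have iS : P.-integrable setT (EFin \o (fun w => sin (I phi w))).
  apply: bounded_rint; last by move=> w; exact: sin_max.
  by apply: (measurableT_comp (@measurable_sin R)).
rewrite [X in _ = X](@ae_eq_Rintegral _ _ _ _ _ (fun w => -1 * sin (I phi w))).
- by rewrite RintegralZl//; lra.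
- by apply: (measurableT_comp (@measurable_sin R)).
- by apply: measurable_funM => //; apply: (measurableT_comp (@measurable_sin R)).
- by apply: filterS (I_scale HI (-1) Lphi) => w /(_ Logic.I) -> _; rewrite !mulN1r sinN.
Qed.

Lemma I_cos_eq phi psi : L2 phi -> L2 psi -> ip smu phi phi = ip smu psi psi ->
  \int[P]_w cos (I phi w) = \int[P]_w cos (I psi w).
Proof.
move=> Lphi Lpsi pp; apply: (I_law_eq Hxi HI Lphi Lpsi) => //.
- exact: measurable_cos.
- by move=> x; rewrite ler_norml cos_geN1 cos_le1.
- exact: cos_lipschitz.
Qed.

(** Put p = t phi + psi and m = t phi - psi. Expanding the product gives cos(e)/2 times sin(I p) +
    sin(I m), whose terms have mean 0, plus sin(e)/2 times cos(I p) - cos(I m), whose mean vanishes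
    because orthogonality makes the norms of p and m equal. *)
Lemma I_orthogonal_sin_cos phi psi t e : L2 phi -> L2 psi -> ip smu phi psi = 0 ->
  \int[P]_w (sin (t * I phi w) * cos (I psi w + e)) = 0.
Proof.
move=> Lphi Lpsi orth.
have Lp := Lfun2_comb t 1 Lphi Lpsi; have Lm := Lfun2_comb t (-1) Lphi Lpsi.
set p := (fun z => t * phi z + 1 * psi z) in Lp.
set m := (fun z => t * phi z + (-1) * psi z) in Lm.
have nE : ip smu p p = ip smu m m.
  by rewrite [LHS](ip_comb_orth t 1 Lphi Lpsi orth) [RHS](ip_comb_orth t (-1) Lphi Lpsi orth) sqrrN.
have mI := Lfun2_measurable (I_L2 HI Lphi); have mJ := Lfun2_measurable (I_L2 HI Lpsi).
have mp := Lfun2_measurable (I_L2 HI Lp); have mm := Lfun2_measurable (I_L2 HI Lm).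
have msin (h : Omega -> R) : measurable_fun setT h -> measurable_fun setT (fun w => sin (h w)).
  by move=> mh; apply: (measurableT_comp (@measurable_sin R)).
have mcos (h : Omega -> R) : measurable_fun setT h -> measurable_fun setT (fun w => cos (h w)).
  by move=> mh; apply: (measurableT_comp (@measurable_cos R)).
have isin (h : Omega -> R) : measurable_fun setT h -> P.-integrable setT (EFin \o (fun w => sin (h w))).
  by move=> mh; apply: bounded_rint; [exact: msin|move=> w; exact: sin_max].
have icos (h : Omega -> R) : measurable_fun setT h -> P.-integrable setT (EFin \o (fun w => cos (h w))).
  by move=> mh; apply: bounded_rint; [exact: mcos|move=> w; rewrite ler_norml cos_geN1 cos_le1].
have b1 := rintZ (cos e / 2) (isin _ mp); have b2 := rintZ (cos e / 2) (isin _ mm).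
have b3 := rintZ (sin e / 2) (icos _ mp); have b4 := rintZ (- (sin e / 2)) (icos _ mm).
have a1 := rintD b1 b2; have a2 := rintD b3 b4.
rewrite (@ae_eq_Rintegral _ _ _ P _ (fun w =>
  (cos e / 2 * sin (I p w) + cos e / 2 * sin (I m w)) +
  (sin e / 2 * cos (I p w) + (- (sin e / 2)) * cos (I m w)))).
- rewrite (RintegralD measurableT a1 a2) (RintegralD measurableT b1 b2) (RintegralD measurableT b3 b4).
  rewrite (RintegralZl _ measurableT (isin _ mp)) (RintegralZl _ measurableT (isin _ mm)).
  rewrite (RintegralZl _ measurableT (icos _ mp)) (RintegralZl _ measurableT (icos _ mm)).
  by rewrite !I_sin0// (I_cos_eq Lp Lm nE); ring.
- apply: measurable_funM; first by apply: msin; exact: measurable_funM.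
  by apply: mcos; exact: measurable_funD.
- exact: rint_measurable (rintD a1 a2).
- move: (I_comb HI t 1 Lphi Lpsi) (I_comb HI t (-1) Lphi Lpsi).
  apply: filterS2 => w /(_ Logic.I) hp /(_ Logic.I) hm _; rewrite hp hm mul1r mulN1r.
  by rewrite cosD !sinD !cosD sinN cosN; field.
Qed.

(** The limit of the preceding identity for t = 1/(n+1), multiplied by n+1; |I phi| dominates. *)
Lemma I_orthogonal_wave phi psi e : L2 phi -> L2 psi -> ip smu phi psi = 0 ->
  \int[P]_w (I phi w * cos (I psi w + e)) = 0.
Proof.
move=> Lphi Lpsi orth.
have mI := Lfun2_measurable (I_L2 HI Lphi); have mJ := Lfun2_measurable (I_L2 HI Lpsi).
have mc : measurable_fun setT (fun w => cos (I psi w + e)).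
  by apply: (measurableT_comp (@measurable_cos R)); exact: measurable_funD.
have : \int[P]_w (n.+1%:R * sin (I phi w / n.+1%:R) * cos (I psi w + e)) @[n --> \oo] -->
    \int[P]_w (I phi w * cos (I psi w + e)).
  apply: (@dominated_Rintegral _ _ _ _ _ _ (fun w => `|I phi w|)).
  - move=> n; apply: measurable_funM => //; apply: measurable_funM => //.
    by apply: (measurableT_comp (@measurable_sin R)); exact: measurable_funM.
  - exact: measurable_funM.
  - by move=> w; apply: cvgMr_tmp; exact: cvg_sin_scale.
  - by apply: integrable_norm; exact: Lfun2_rint (I_L2 HI Lphi).
  - move=> n w; rewrite normrM -[leRHS]mulr1 ler_pM//; last by rewrite ler_norml cos_geN1 cos_le1.
    have n0 : 0 < n.+1%:R :> R by rewrite ltr0n.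
    rewrite normrM (gtr0_norm n0) mulrC -ler_pdivlMr//.
    have := sin_lipschitz (I phi w / n.+1%:R) 0; rewrite sin0 !subr0 => /le_trans; apply.
    by rewrite normrM normfV (gtr0_norm n0).
under eq_fun => n.
  under eq_Rintegral do rewrite -mulrA [I phi _ / _]mulrC.
  rewrite RintegralZl//=; last first.
    apply: bounded_rint.
      apply: measurable_funM => //; apply: (measurableT_comp (@measurable_sin R)).
      exact: measurable_funM.
    by move=> w; rewrite normrM -[leRHS]mulr1 ler_pM// ?sin_max// ler_norml cos_geN1 cos_le1.
  rewrite I_orthogonal_sin_cos// mulr0.
over.
move=> /(cvg_lim (@Rhausdorff R)) <-.
by apply: (cvg_lim (@Rhausdorff R)); exact: cvg_cst.
Qed.

(** A linear combination of the [Y j] is almost surely the integral of the same combination of the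
    [psi j], which is again orthogonal to [phi]; so every wave of the [Y j] is a cosine of a single
    Wiener integral. *)
Lemma orthogonal_integral_eq0 (J : finType) (psi : J -> R * R -> R) (Y : J -> Omega -> R)
    (phi : R * R -> R) (X : Omega -> R) (A : set Omega) :
  (forall j, L2 (psi j)) -> L2 phi -> (forall j, ip smu phi (psi j) = 0) ->
  measurable_fun setT X -> (forall j, measurable_fun setT (Y j)) ->
  ae_eq P setT X (I phi) -> (forall j, ae_eq P setT (Y j) (I (psi j))) ->
  <<s [set E | exists j B, measurable B /\ E = Y j @^-1` B] >> A ->
  \int[P]_(w in A) X w = 0.
Proof.
move=> Lpsi Lphi orth mX mY XI YI.
have mI := Lfun2_measurable (I_L2 HI Lphi).
have iX : P.-integrable setT (EFin \o X).
  apply: rint_ae mX _ (Lfun2_rint (I_L2 HI Lphi)).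
  by apply: filterS XI => w /(_ Logic.I) -> _.
apply: (annihilated_integral_eq0 mY iX) => a e.
have Ls : L2 (fun z => \sum_j a j * psi j z) by apply: Lfun2_sum => j _; exact: Lfun2Z.
have o : ip smu phi (fun z => \sum_j a j * psi j z) = 0.
  rewrite ipC ip_suml//; last by move=> j _; exact: Lfun2Z.
  by rewrite big1// => j _; rewrite ipZl// ipC orth mulr0.
rewrite -[RHS](I_orthogonal_wave e Lphi Ls o).
have mS := Lfun2_measurable (I_L2 HI Ls).
apply: ae_eq_Rintegral.
- by apply: measurable_funM => //; exact: measurable_wave.
- apply: measurable_funM => //.
  by apply: (measurableT_comp (@measurable_cos R)); exact: measurable_funD.
have YIall : {ae P, forall w, forall j, Y j w = I (psi j) w}.
  by apply: filter_forall => j; apply: filterS (YI j) => w /(_ Logic.I).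
have h := I_sum HI (index_enum J) a Lpsi.
move: h YIall XI; apply: filterS3 => w h1 h2 h3 _.
rewrite mulrC /wave h3// h1//; congr (_ * cos (_ + _)).
by apply: eq_bigr => j _; rewrite h2.
Qed.

End GaussianIndependence.

(** * Fatou's lemma and Tonelli's theorem for real integrals *)

Section RealLimits.
Context d (T : measurableType d) (R : realType) (mu : {measure set T -> \bar R}).

Lemma fatou_Rintegral (F : nat -> T -> R) (f : T -> R) c :
  (forall n x, 0 <= F n x) -> (forall n, mu.-integrable setT (EFin \o F n)) ->
  (forall x, F n x @[n --> \oo] --> f x) -> (forall n, \int[mu]_x F n x <= c) ->
  mu.-integrable setT (EFin \o f) /\ \int[mu]_x f x <= c.
Proof.
move=> F0 iF Ff Fc; have f0 x : 0 <= f x.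
  by apply: (cvgr_to_ge (Ff x)); apply: nearW => n; exact: F0.
have mf : measurable_fun setT f.
  by apply: (measurable_fun_cvg (h := F)) => // n; exact: rint_measurable (iF n).
have H : (\int[mu]_x (f x)%:E <= c%:E)%E.
  have := @fatou _ _ _ mu setT measurableT (fun n x => (F n x)%:E).
  have E x : limn_einf (fun n => (F n x)%:E) = (f x)%:E.
    by apply: (cvg_limn_einf_sup _).1; apply/fine_cvgP => /=; split; [exact: nearW|exact: Ff].
  under eq_integral do rewrite E.
  move=> /(_ _ _)/le_trans; apply => //.
  - by move=> n; apply/measurable_EFinP; exact: rint_measurable (iF n).
  - by move=> n x _; rewrite lee_fin.
  rewrite limn_einf_lim; apply: lime_le; first exact: is_cvg_einfs.
  apply: nearW => n; apply: (le_trans (ereal_inf_le _)) => //=.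
    exists (\int[mu]_x (F n x)%:E)%E; first by exists n => //=.
  rewrite -[leLHS]fineK ?lee_fin; first exact: Fc.
  exact: (integrable_fin_num measurableT (iF n)).
have intf : mu.-integrable setT (EFin \o f).
  apply/integrableP; split; first exact/measurable_EFinP.
  under eq_integral do rewrite /= ger0_norm//.
  by apply: (le_lt_trans H); rewrite ltry.
split => //; rewrite -lee_fin fineK//; exact: (integrable_fin_num measurableT intf).
Qed.

End RealLimits.

Section RealTonelli.
Context d1 d2 (T1 : measurableType d1) (T2 : measurableType d2) (R : realType).
Variables (m1 : {sigma_finite_measure set T1 -> \bar R})
  (m2 : {sigma_finite_measure set T2 -> \bar R}).

Lemma tonelli_integrable (f : T1 * T2 -> R) (g : T1 -> R) : measurable_fun setT f ->
  (forall x, m2.-integrable setT (EFin \o (fun y => f (x, y)))) ->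
  (forall x, \int[m2]_y `|f (x, y)| <= g x) -> m1.-integrable setT (EFin \o g) ->
  (m1 \x m2)%E.-integrable setT (EFin \o f).
Proof.
move=> mf if2 fg ig; apply/integrableP; split; first exact/measurable_EFinP.
rewrite fubini_tonelli1//=; last first.
  by apply/measurable_EFinP; exact: measurableT_comp.
have mg := rint_measurable ig.
apply: (@le_lt_trans _ _ (\int[m1]_x (g x)%:E)%E); last first.
  by have := integrable_lty measurableT ig.
apply: ge0_le_integral => //.
- by move=> x _; exact: integral_ge0.
- apply: measurable_fun_fubini_tonelli_F => //.
  by apply/measurable_EFinP; exact: measurableT_comp.
- exact/measurable_EFinP.
move=> x _; rewrite /fubini_F/=.
rewrite -[leLHS]fineK ?lee_fin; first exact: fg.
have := integrable_fin_num measurableT (integrable_norm (if2 x)).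
by [].
Qed.

End RealTonelli.

(** * The heat kernel *)

Section HeatKernel.
Variable R : realType.
Implicit Types (s t x y z : R).

Lemma torus_dominated (F : nat -> R -> R) (f : R -> R) (B : R) :
  (forall n, measurable_fun setT (F n)) -> measurable_fun setT f ->
  (forall x, F n x @[n --> \oo] --> f x) -> (forall n x, `|F n x| <= B) ->
  \int[torus_mu]_x F n x @[n --> \oo] --> \int[torus_mu]_x f x.
Proof.
move=> mF mf Ff FB; apply: (@dominated_Rintegral _ (measurableTypeR R) R (@torus_mu R) F f (fun=> B)) => //.
exact: finite_measure_integrable_cst.
Qed.

Lemma sum_absz_centred (g : nat -> R) K :
  \sum_(0 <= j < (2 * K).+1) g `|j%:Z - K%:Z|%N = \sum_(0 <= k < K.+1) mult k * g k.
Proof.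
elim: K => [|K IH]; first by rewrite muln0 !big_nat1 /mult eqxx mul1r.
rewrite [RHS]big_nat_recr//= -IH mulnS add2n big_nat_recl// big_nat_recr//=.
rewrite (_ : (K - 0)%N = K) ?subn0//.
rewrite (_ : `|(2 * K).+2%:Z - K.+1%:Z|%N = K.+1); last by lia.
rewrite /mult/= mulr_natl mulr2n addrCA; congr (_ + _).
by congr (_ + _); apply: eq_bigr => j _; congr g; lia.
Qed.

(** The symmetric sum includes |k| = K, whereas [kernel_sum] stops before its index; hence K.+1. *)
Lemma heat_partial_sum K t x :
  complex.Re (\sum_(0 <= j < (2 * K).+1)
    complex.real_complex_def (Phant R)
      (expR (- (4 * pi ^+ 2 * (j%:Z - K%:Z)%:~R ^+ 2 * t))) * expi (j%:Z - K%:Z) x) =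
  kernel_sum K.+1 t x.
Proof.
rewrite (big_morph (@complex.Re R) (id1 := 0) (op1 := +%R)); [|by case=> ? ? [? ?]|by []].
rewrite /kernel_sum /series/= -(sum_absz_centred (fun k => expR (- (lam k * t)) * cosn k x)).
apply: eq_bigr => j _; rewrite /expi /= mul0r subr0.
set k := (j%:Z - K%:Z); have [k0|k0] := leP 0 k.
  by rewrite /lam /cosn !(pmulrn 1 `|k|%N) gez0_abs.
rewrite /lam /cosn -(cosN (_ * x)) !(pmulrn 1 `|k|%N) ltz0_abs//.
by rewrite mulrNz sqrrN mulrN mulNr.
Qed.

Lemma cvg_heat_kernel t x : 0 < t -> kernel_sum K t x @[K --> \oo] --> heat_kernel t x.
Proof.
move=> t0; rewrite /heat_kernel.
under [X in _ --> limn X]eq_fun do rewrite heat_partial_sum.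
have C := @cvg_kernel_sum R t x t0.
have C1 : kernel_sum K.+1 t x @[K --> \oo] --> limn (fun K => kernel_sum K t x).
  by rewrite (cvg_shiftS (fun K => kernel_sum K t x)).
by rewrite (cvg_lim _ C1).
Qed.

(** At t <= 0 the series of [heat_kernel] has no meaning. The value 0 there makes the kernel
    measurable in both variables and absorbs the case distinction of [convolution_kernel]. *)
Definition hk t x := if 0 < t then heat_kernel t x else 0.

Lemma hk_gt0 t x : 0 < t -> hk t x = heat_kernel t x.
Proof. by rewrite /hk => ->. Qed.

Lemma convolution_kernelE t x (z : R * R) : convolution_kernel t x z = hk (t - z.1) (x - z.2).
Proof. by rewrite /convolution_kernel /hk subr_gt0. Qed.

Lemma cvg_hk t x : (if 0 < t then kernel_sum K t x else 0) @[K --> \oo] --> hk t x.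
Proof.
rewrite /hk; case: ifP => t0; first exact: cvg_heat_kernel.
exact: cvg_cst.
Qed.

Lemma measurable_hk d (T : measurableType d) (f g : T -> R) :
  measurable_fun setT f -> measurable_fun setT g ->
  measurable_fun setT (fun w => hk (f w) (g w)).
Proof.
move=> mf mg.
apply: (measurable_fun_cvg (h := fun K w => if 0 < f w then kernel_sum K (f w) (g w) else 0)).
  move=> K; apply: measurable_fun_ifT => //; last exact: measurable_kernel_sum.
  exact: measurable_fun_ltr.
by move=> z _; exact: cvg_hk.
Qed.

Lemma measurable_convolution_kernel d (T : measurableType d) (t x s y : T -> R) :
  measurable_fun setT t -> measurable_fun setT x ->
  measurable_fun setT s -> measurable_fun setT y ->
  measurable_fun setT (fun w => convolution_kernel (t w) (x w) (s w, y w)).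
Proof.
move=> mt mx ms my; under eq_fun do rewrite convolution_kernelE /=.
by apply: measurable_hk; apply: measurable_funB.
Qed.

Lemma hk_bounded t : exists B, forall x, `|hk t x| <= B.
Proof.
have [t0|t0] := ltP 0 t; last first.
  by exists 0 => x; rewrite /hk ltNge t0 normr0.
exists (2 / (1 - expR (- (4 * pi ^+ 2 * t)))) => x.
have C : `|kernel_sum K t x| @[K --> \oo] --> `|hk t x|.
  by rewrite hk_gt0//; apply: cvg_norm; exact: cvg_heat_kernel.
apply: (cvgr_to_le C); apply: nearW => K; exact: kernel_sum_bounded.
Qed.

(** Against a fixed cosine the integrals of the partial sums are constant from K = n + 1 on, and the
    limit may be taken under the integral. *)
Lemma hk_cosn n t x z : 0 < t ->
  \int[torus_mu]_y (hk t (x - y) * cosn n (y - z)) = expR (- (lam n * t)) * cosn n (x - z).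
Proof.
move=> t0; pose B := 2 / (1 - expR (- (4 * pi ^+ 2 * t))).
have mc : measurable_fun setT (fun y : R => cosn n (y - z)).
  by apply: (measurableT_comp (@measurable_cosn R n)); exact: measurable_funB.
have mK K : measurable_fun setT (fun y : R => kernel_sum K t (x - y) * cosn n (y - z)).
  by apply: measurable_funM => //; apply: measurable_kernel_sum => //; exact: measurable_funB.
have mh : measurable_fun setT (fun y : R => hk t (x - y) * cosn n (y - z)).
  by apply: measurable_funM => //; apply: measurable_hk => //; exact: measurable_funB.
have C : \int[torus_mu]_y (kernel_sum K t (x - y) * cosn n (y - z)) @[K --> \oo] -->
   \int[torus_mu]_y (hk t (x - y) * cosn n (y - z)).
  apply: (@torus_dominated _ _ B mK mh).
  - by move=> y; apply: cvgM; [rewrite hk_gt0//; exact: cvg_heat_kernel|exact: cvg_cst].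
  - by move=> K y; rewrite normrM -[leRHS]mulr1 ler_pM ?cosn_norm//; exact: kernel_sum_bounded.
apply: (cvg_unique _ C) => //; apply: cvg_near_cst; exists n.+1 => // K /= nK.
by rewrite kernel_sum_convolution nK.
Qed.

(** Only the second kernel is expanded: each of its modes is an eigenfunction for the first, by
    [hk_cosn]. *)
Lemma hk_semigroup s t x z : 0 < s -> 0 < t ->
  \int[torus_mu]_y (hk s (x - y) * hk t (y - z)) = hk (s + t) (x - z).
Proof.
move=> s0 t0; have [A hA] := hk_bounded s.
pose B := 2 / (1 - expR (- (4 * pi ^+ 2 * t))).
have mhs : measurable_fun setT (fun y : R => hk s (x - y)).
  by apply: measurable_hk => //; exact: measurable_funB.
have mK K : measurable_fun setT (fun y : R => hk s (x - y) * kernel_sum K t (y - z)).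
  by apply: measurable_funM => //; apply: measurable_kernel_sum => //; exact: measurable_funB.
have mh : measurable_fun setT (fun y : R => hk s (x - y) * hk t (y - z)).
  by apply: measurable_funM => //; apply: measurable_hk => //; exact: measurable_funB.
have C : \int[torus_mu]_y (hk s (x - y) * kernel_sum K t (y - z)) @[K --> \oo] -->
   \int[torus_mu]_y (hk s (x - y) * hk t (y - z)).
  apply: (@torus_dominated _ _ (A * B) mK mh).
  - by move=> y; apply: cvgM; [exact: cvg_cst|rewrite hk_gt0//; exact: cvg_heat_kernel].
  - by move=> K y; rewrite normrM ler_pM//; exact: kernel_sum_bounded.
have I k : (@torus_mu R).-integrable setT (EFin \o (fun y => hk s (x - y) * cosn k (y - z))).
  apply: (@torus_bounded_integrable _ A) => [|y].
    apply: measurable_funM => //.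
    by apply: (measurableT_comp (@measurable_cosn R k)); exact: measurable_funB.
  by rewrite normrM -[leRHS]mulr1 ler_pM ?cosn_norm.
have E K : \int[torus_mu]_y (hk s (x - y) * kernel_sum K t (y - z)) = kernel_sum K (s + t) (x - z).
  under eq_Rintegral do rewrite /kernel_sum /series/= mulr_sumr.
  under eq_Rintegral do under eq_bigr do rewrite /kernel_mode mulrCA (mulrCA (hk _ _)).
  rewrite Rintegral_sum => [|k _]; last exact/rintZ/rintZ/I.
  apply: eq_bigr => k _.
  rewrite (RintegralZl _ measurableT (rintZ _ (I k))) (RintegralZl _ measurableT (I k)).
  by rewrite hk_cosn// /kernel_mode mulrDr opprD expRD; ring.
move: C; rewrite (funext E) => C; apply: (cvg_unique _ C) => //.
by rewrite hk_gt0 ?addr_gt0//; apply: cvg_heat_kernel; rewrite addr_gt0.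
Qed.

End HeatKernel.

Section KernelNorm.
Variable R : realType.
Implicit Types (s t x y : R).

Lemma kernel_sumN K t x : kernel_sum K t (- x) = kernel_sum K t x.
Proof. by apply: eq_bigr => k _; rewrite /kernel_mode cosnN. Qed.

Lemma hkN t x : hk t (- x) = hk t x.
Proof.
rewrite /hk; case: ifP => // t0; have C := @cvg_heat_kernel R t (- x) t0.
move: C; rewrite (funext (fun K => kernel_sumN K t x)) => C.
exact: (cvg_unique _ C (@cvg_heat_kernel R t x t0)).
Qed.

Lemma unit_exp_int (a t : R) : a != 0 -> 0 <= t <= 1 ->
  \int[unit_mu]_s (if s < t then expR (- (a * (t - s))) else 0) = (1 - expR (- (a * t))) / a.
Proof.
move=> a0 t01.
have E s : expR (- (a * (t - s))) = a^-1 * (expR (a * s + (- (a * t))) * a).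
  by rewrite mulrCA mulVf// mulr1; congr expR; ring.
under eq_Rintegral do rewrite E.
have dF (s : R) : is_derive s 1 (fun s => a^-1 * expR (a * s + (- (a * t))))
    (a^-1 * (expR (a * s + (- (a * t))) * a)).
  exact: (@is_derive_comp_affine _ a^-1 a (- (a * t)) expR expR s (fun y => is_derive_expR y)).
rewrite (unit_FTC dF _ t01); last first.
  move=> s; apply: cvgM; first exact: cvg_cst.
  apply: cvgM; last exact: cvg_cst.
  by apply: continuous_comp; [exact: continuous_affine|exact: continuous_expR].
by rewrite mulr0 add0r subrr expR0; ring.
Qed.

Lemma unit_lt_int t : 0 <= t <= 1 -> \int[unit_mu]_s (if s < t then 1 else 0) = t :> R.
Proof.
move=> t01; rewrite (@unit_FTC _ id (fun=> 1))//; first by rewrite subr0.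
by move=> x; exact: cvg_cst.
Qed.

Lemma unit_bounded_integrable (f : R -> R) (c : R) : measurable_fun setT f ->
  (forall x, `|f x| <= c) -> (@unit_mu R).-integrable setT (EFin \o f).
Proof.
move=> mf fc; apply: (@rint_le _ _ _ _ _ (fun=> c)) => //.
exact: finite_measure_integrable_cst.
Qed.

Lemma measurable_heat_mode (a t : R) : 
  measurable_fun setT (fun s : R => if s < t then expR (- (a * (t - s))) else 0).
Proof.
apply: measurable_fun_ifT => //; first exact: measurable_fun_ltr.
apply: measurableT_comp; first exact: measurable_expR.
by apply: measurableT_comp => //; apply: measurable_funM => //; exact: measurable_funB.
Qed.

Lemma heat_mode_norm (a t s : R) : 0 <= a ->
  `|if s < t then expR (- (a * (t - s))) else 0| <= 1.
Proof.
move=> a0; case: ifP => st; last by rewrite normr0.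
by rewrite ger0_norm ?expR_ge0// -expR0 ler_expR oppr_le0 mulr_ge0// subr_ge0 ltW.
Qed.

(** The product of consecutive integers is chosen so that the sum of the inverses telescopes. *)
Lemma lam_gt (k : nat) : (k.+1 * k.+2)%:R <= lam k.+1 :> R.
Proof.
have p1 : 1 <= @pi R by have := pi_ge2 R; lra.
rewrite /lam; apply: (@le_trans _ _ (4 * 1 * k.+1%:R ^+ 2)); last first.
  by rewrite ler_wpM2r ?sqr_ge0// ler_wpM2l// exprn_ege1.
by rewrite mulr1 -natrX -natrM ler_nat; nia.
Qed.

(** Integrated in time, the mode k contributes at most 1/lam k, and the mode 0 at most 1. Since
    1/lam k <= 1/(k (k+1)), the total is at most 2. Fatou's lemma passes from the partial sums to
    the kernel. *)
Lemma hk_square_int t : 0 <= t <= 1 ->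
  (@unit_mu R).-integrable setT (EFin \o (fun s => hk (2 * (t - s)) 0)) /\
  \int[unit_mu]_s hk (2 * (t - s)) 0 <= 2 :> R.
Proof.
move=> t01; have st2 s : (0 < 2 * (t - s)) = (s < t) by rewrite pmulr_rgt0// subr_gt0.
pose h (k : nat) (s : R) : R := if s < t then expR (- ((2 * lam k) * (t - s))) else 0.
have E K s : (if 0 < 2 * (t - s) then kernel_sum K (2 * (t - s)) 0 else 0) =
    \sum_(0 <= k < K) mult k * h k s.
  rewrite st2 /h; case: ifP => st; last by rewrite big1// => k _; rewrite mulr0.
  apply: eq_bigr => k _; rewrite /kernel_mode /cosn mulr0 cos0 mulr1.
  by congr (_ * expR _); ring.
have ih k : (@unit_mu R).-integrable setT (EFin \o h k).
  apply: (@unit_bounded_integrable _ 1); first exact: measurable_heat_mode.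
  by move=> s; apply: heat_mode_norm; rewrite mulr_ge0// lam_ge0.
apply: (@fatou_Rintegral _ (measurableTypeR R) R (@unit_mu R)
  (fun K s => \sum_(0 <= k < K) mult k * h k s) (fun s => hk (2 * (t - s)) 0) 2).
- move=> K s; apply: sumr_ge0 => k _; apply: mulr_ge0; first exact/ltW/mult_gt0.
  by rewrite /h; case: ifP => // _; exact: expR_ge0.
- by move=> K; apply: rint_sum => k _; exact: rintZ.
- by move=> s; under eq_fun do rewrite -E; exact: cvg_hk.
move=> K; rewrite Rintegral_sum; last by move=> k _; exact: rintZ.
under eq_bigr do rewrite (RintegralZl _ measurableT (ih _)).
case: K => [|K]; first by rewrite big_nil.
(* The sharper bound is the one that the telescoping induction preserves. *)
apply: (@le_trans _ _ (2 - K.+1%:R^-1)); last by rewrite gerBl invr_ge0.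
have [t0 t1] := andP t01.
elim: K => [|K IH].
  rewrite big_nat1 /mult/= mul1r /h /lam.
  under eq_Rintegral do rewrite expr0n/= !mulr0 mul0r oppr0 expR0.
  rewrite unit_lt_int// invr1; lra.
rewrite big_nat_recr//=.
have lp : 0 < lam K.+1 :> R by apply: lt_le_trans (lam_gt K); rewrite ltr0n.
have : mult K.+1 * \int[unit_mu]_x h K.+1 x <= (K.+1 * K.+2)%:R^-1.
  have l2 : 2 * lam K.+1 != 0 :> R by rewrite gt_eqF// pmulr_rgt0.
  rewrite /h unit_exp_int// /mult/=.
  apply: (@le_trans _ _ (lam K.+1)^-1); last by rewrite lef_pV2 ?posrE ?ltr0n// lam_gt.
  rewrite invfM (mulrCA _ 2^-1) mulVKf// -[leRHS]mul1r.
  by apply: ler_wpM2r; [rewrite invr_ge0 ltW|rewrite gerBl expR_ge0].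
have -> : (K.+1 * K.+2)%:R^-1 = K.+1%:R^-1 - K.+2%:R^-1 :> R.
  move: (ler0n R K); rewrite natrM -!natr1; move: (K%:R) => a a0.
  by field; rewrite !gt_eqF//; lra.
by move=> H; apply: (le_trans (lerD IH H)); rewrite addrA subrK.
Qed.

(** By symmetry and the semigroup property, the integral over y of p_{t-s}(x - y)^2 is
    p_{2(t-s)}(0). The bound is uniform in t and x, as the mixtures below require. *)
Lemma kernel_L2 t x : 0 <= t <= 1 ->
  L2_spacetime R (convolution_kernel t x) /\
  ip spacetime_mu (convolution_kernel t x) (convolution_kernel t x) <= 2.
Proof.
move=> t01; have [ig g2] := hk_square_int t01.
have mk : measurable_fun setT (convolution_kernel t x).
  rewrite (_ : convolution_kernel t x =
    (fun z : R * R => convolution_kernel t x (z.1, z.2))); last by apply/funext => -[].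
  by apply: measurable_convolution_kernel; [exact: measurable_cst|exact: measurable_cst|exact: measurable_fst|exact: measurable_snd].
have sq s y : `|convolution_kernel t x (s, y) ^+ 2| = hk (t - s) (x - y) * hk (t - s) (y - x).
  by rewrite ger0_norm ?sqr_ge0// convolution_kernelE/= -(hkN _ (y - x)) opprB.
have sqi s : \int[torus_mu]_y `|convolution_kernel t x (s, y) ^+ 2| = hk (2 * (t - s)) 0.
  under eq_Rintegral do rewrite sq.
  have [st|st] := ltP 0 (t - s); first by rewrite hk_semigroup// subrr mulr_natl mulr2n.
  under eq_Rintegral do rewrite /hk ltNge st/= mul0r.
  by rewrite Rintegral_cst// mul0r /hk pmulr_rgt0// ltNge st.
have if2 : (spacetime_mu (R := R)).-integrable setT (EFin \o (fun z => convolution_kernel t x z ^+ 2)).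
  apply/spacetime_integrable; apply: (tonelli_integrable _ _ _ ig).
  - exact: measurable_funX.
  - move=> s; have [B hB] := hk_bounded (t - s).
    apply: (@torus_bounded_integrable _ (B * B)).
      apply: measurable_funX; apply: measurable_convolution_kernel => //; exact: measurable_cst.
    by move=> y; rewrite normrX convolution_kernelE/= expr2 ler_pM.
  - by move=> s; rewrite sqi.
split; first by apply/Lfun2P.
rewrite /ip; under eq_Rintegral do rewrite -expr2.
rewrite spacetime_fubini//.
apply: le_trans g2; rewrite le_eqVlt; apply/orP; left; apply/eqP.
apply: eq_Rintegral => s _; rewrite -sqi.
by apply: eq_Rintegral => y _; rewrite ger0_norm ?sqr_ge0.
Qed.

(** The heat flow acts on the l-th cosine by a factor, so pairing with a product chi(s) cos(2 pi l
    y) reduces space-time inner products to integrals over time. *)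
Lemma kernel_pairing l (chi : R -> R) (c t x : R) :
  measurable_fun setT chi -> (forall s, `|chi s| <= c) -> 0 <= t <= 1 ->
  L2_spacetime R (fun z => chi z.1 * cosn l z.2) /\
  ip spacetime_mu (fun z => chi z.1 * cosn l z.2) (convolution_kernel t x) =
  cosn l x * \int[unit_mu]_s (chi s * (if s < t then expR (- (lam l * (t - s))) else 0)).
Proof.
move=> mchi chic t01; have [kL2 _] := kernel_L2 x t01.
have c0 : 0 <= c by apply: le_trans (chic 0).
have psiL2 : L2_spacetime R (fun z => chi z.1 * cosn l z.2).
  apply: (@Lfun2_dominated _ _ _ _ _ (fun=> c ^+ 2)).
  - apply: measurable_funM; first exact: (measurableT_comp mchi measurable_fst).
    exact: (measurableT_comp (@measurable_cosn R l) measurable_snd).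
  - exact: finite_measure_integrable_cst.
  - move=> z; rewrite -real_normK ?num_real// ler_pXn2r ?nnegrE// normrM.
    by rewrite -[leRHS]mulr1 ler_pM ?cosn_norm.
split=> //; rewrite /ip spacetime_fubini; last exact: Lfun2_integrableM.
rewrite -RintegralZl//; last first.
  apply: (@unit_bounded_integrable _ (c * 1)) => [|s].
    by apply: measurable_funM => //; exact: measurable_heat_mode.
  by rewrite normrM ler_pM// heat_mode_norm// lam_ge0.
apply: eq_Rintegral => s _.
have [B hB] := hk_bounded (t - s).
transitivity (chi s * \int[torus_mu]_y (hk (t - s) (x - y) * cosn l (y - 0))).
  rewrite -RintegralZl//; last first.
    apply: (@torus_bounded_integrable _ (B * 1)) => [|y]; last by rewrite normrM ler_pM// cosn_norm.
    apply: measurable_funM; first by apply: measurable_hk => //; exact: measurable_funB.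
    by apply: (measurableT_comp (@measurable_cosn R l)); exact: measurable_funB.
  by apply: eq_Rintegral => y _ /=; rewrite convolution_kernelE/= subr0; ring.
case: ifP => st; first by rewrite hk_cosn ?subr_gt0// subr0; ring.
under eq_Rintegral do rewrite /hk subr_gt0 st mul0r.
by rewrite Rintegral_cst//; ring.
Qed.

End KernelNorm.

(** * The mild solution as a Wiener integral *)

Section MixtureFubini.
Context d1 d2 (S : measurableType d1) (T : measurableType d2) (R : realType).
Variables (nu : probability S R) (mu : probability T R).
Local Notation L2 f := (f \in Lfun mu 2%:E).

(** [h] replaces [f] by 0 wherever the bound fails, which happens on a null set. *)
Lemma Lfun2_dominated_ae (f g : T -> R) : measurable_fun setT f ->
  mu.-integrable setT (EFin \o g) -> {ae mu, forall y, f y ^+ 2 <= g y} -> L2 f.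
Proof.
move=> mf ig fg; have mg := rint_measurable ig.
pose h y := if f y ^+ 2 <= g y then f y else 0.
have mh : measurable_fun setT h.
  apply: measurable_fun_ifT => //; apply: measurable_fun_ler => //.
  exact: measurable_funX.
have Lh : L2 h.
  apply: (@Lfun2_dominated _ _ _ _ _ (fun y => `|g y|)) => //.
    exact: integrable_norm ig.
  move=> y; rewrite /h; case: ifP => [fgy|_]; first exact: le_trans fgy (ler_norm _).
  by rewrite expr0n/= normr_ge0.
by apply: Lfun2_ae Lh => //; apply: filterS fg => y fgy _; rewrite /h fgy.
Qed.

Variables (kappa : S -> T -> R) (rho : S -> R) (C : R).
Hypothesis mkappa : measurable_fun setT (fun p : S * T => kappa p.1 p.2).
Hypothesis Lkappa : forall z, L2 (kappa z).
Hypothesis kappaC : forall z, nrm mu (kappa z) <= C.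
Hypothesis Lrho : rho \in Lfun nu 2%:E.

(** The integral of a family of L^2 functions against a weight, taken pointwise in y. It serves for
    families of kernels on space-time and for random fields on the probability space alike. *)
Definition mixture (y : T) : R := \int[nu]_z (rho z * kappa z y).

Let C0 : 0 <= C.
Proof. exact: le_trans (nrm_ge0 _ _) (kappaC point). Qed.

Let irho : nu.-integrable setT (EFin \o rho).
Proof. exact: Lfun2_rint. Qed.

Let mfld : measurable_fun setT (fun p : S * T => rho p.1 * kappa p.1 p.2).
Proof.
apply: measurable_funM => //.
exact: (measurableT_comp (Lfun2_measurable Lrho) measurable_fst).
Qed.

Lemma mixture_product_integrable X : L2 X ->
  (nu \x mu)%E.-integrable setT (EFin \o (fun p => rho p.1 * kappa p.1 p.2 * X p.2)).
Proof.
move=> LX.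
have ikX z := Lfun2_integrableM (Lkappa z) LX.
apply: (@tonelli_integrable _ _ _ _ _ _ _ _ (fun z => `|rho z| * (C * nrm mu X))).
- apply: measurable_funM => //; exact: (measurableT_comp (Lfun2_measurable LX) measurable_snd).
- by move=> z; rewrite /=; under [X in EFin \o X]eq_fun do rewrite -mulrA; exact: rintZ.
- move=> z; rewrite /=; under eq_Rintegral do rewrite -mulrA normrM.
  rewrite (RintegralZl _ measurableT (integrable_norm (ikX z)))//.
  rewrite ler_wpM2l//.
  have Ln f : L2 f -> L2 (fun y => `|f y|).
    move=> Lf; apply: (@Lfun2_dominated _ _ _ _ _ (fun y => f y ^+ 2)).
    - by apply: measurableT_comp => //; exact: (Lfun2_measurable Lf).
    - by have /Lfun2P[] := Lf.
    - by move=> y; rewrite real_normK ?num_real.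
  have nn f : nrm mu (fun y => `|f y|) = nrm mu f.
    by congr Num.sqrt; rewrite !ipE; apply: eq_Rintegral => y _; rewrite real_normK ?num_real.
  under eq_Rintegral do rewrite /= normrM.
  apply: (le_trans (ip_le_nrm (Ln _ (Lkappa z)) (Ln _ LX))).
  by rewrite !nn ler_wpM2r ?nrm_ge0.
- under [X in EFin \o X]eq_fun do rewrite mulrC.
  by apply: rintZ; exact: integrable_norm irho.
Qed.

Let L1 : L2 (fun=> 1).
Proof. by apply: (@Lfun2_dominated _ _ _ _ _ (fun=> 1)) => [||y]; [by []|exact: finite_measure_integrable_cst|rewrite expr1n]. Qed.

Lemma mixture_integrable : (nu \x mu)%E.-integrable setT (EFin \o (fun p => rho p.1 * kappa p.1 p.2)).
Proof.
have := mixture_product_integrable L1.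
by under [X in EFin \o X]eq_fun do rewrite mulr1.
Qed.

Let isq : (nu \x mu)%E.-integrable setT (EFin \o (fun p => (rho p.1 * kappa p.1 p.2) ^+ 2)).
Proof.
have /Lfun2P[_ ir2] := Lrho.
apply: (@tonelli_integrable _ _ _ _ _ _ _ _ (fun z => rho z ^+ 2 * C ^+ 2)).
- exact: measurable_funX.
- move=> z; rewrite /=; under [X in EFin \o X]eq_fun do rewrite exprMn.
  by apply: rintZ; have /Lfun2P[] := Lkappa z.
- move=> z; rewrite /=; under eq_Rintegral do rewrite ger0_norm ?sqr_ge0// exprMn.
  rewrite RintegralZl//; last by have /Lfun2P[] := Lkappa z.
  rewrite ler_wpM2l ?sqr_ge0// -ipE -nrm_sqr ler_pXn2r// nnegrE; exact: nrm_ge0.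
- under [X in EFin \o X]eq_fun do rewrite mulrC.
  exact: rintZ.
Qed.

(** Since [nu] has mass 1, Cauchy-Schwarz in z bounds the square of the mixture by the integral of
    (rho z * kappa z y)^2, for almost every y. *)
Lemma mixture_L2 : L2 mixture.
Proof.
have mm : measurable_fun setT mixture by exact: (rint_measurable (rint_fubini2 mixture_integrable)).
apply: (Lfun2_dominated_ae mm (rint_fubini2 isq)).
have := ae_integrable2 isq; apply: filterS => y /= iy.
have Ly : (fun z => rho z * kappa z y) \in Lfun nu 2%:E.
  apply/Lfun2P; split=> //.
  exact: (measurableT_comp mfld (measurable_pair2 y)).
have N1 : (fun=> 1 : R) \in Lfun nu 2%:E.
  by apply: (@Lfun2_dominated _ _ _ _ _ (fun=> 1)) => [||z]; [by []|exact: finite_measure_integrable_cst|rewrite expr1n].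
have := ip_CS N1 Ly; rewrite /mixture -ipE.
have -> : ip nu (fun=> 1) (fun=> 1) = 1.
  by rewrite /ip mulr1 Rintegral_cst// [X in fine X]probability_setT mulr1.
by rewrite mul1r /ip; under eq_Rintegral do rewrite mul1r.
Qed.

Lemma ip_mixture_integrable X : L2 X ->
  nu.-integrable setT (EFin \o (fun z => rho z * ip mu (kappa z) X)).
Proof.
move=> LX; have := rint_fubini1 (mixture_product_integrable LX).
congr (_.-integrable _ _); apply/funext => z /=; congr EFin.
under eq_Rintegral do rewrite -mulrA.
by rewrite (RintegralZl _ measurableT (Lfun2_integrableM (Lkappa z) LX)).
Qed.

Lemma ip_mixture X : L2 X ->
  ip mu mixture X = \int[nu]_z (rho z * ip mu (kappa z) X).
Proof.
move=> LX; have iX := mixture_product_integrable LX.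
transitivity (\int[mu]_y \int[nu]_z (rho z * kappa z y * X y)).
  apply: ae_eq_Rintegral.
  - by apply: measurable_funM; [exact: Lfun2_measurable mixture_L2|exact: (Lfun2_measurable LX)].
  - exact: (rint_measurable (rint_fubini2 iX)).
  have := ae_integrable2 mixture_integrable; apply: filterS => y iy _ /=.
  by rewrite /mixture (RintegralZr _ measurableT iy).
rewrite -(Rintegral_fubini iX); apply: eq_Rintegral => z _ /=.
under eq_Rintegral do rewrite -mulrA.
by rewrite (RintegralZl _ measurableT (Lfun2_integrableM (Lkappa z) LX)).
Qed.

End MixtureFubini.

Section StochasticFubini.
Context {R : realType} {d : measure_display} {Omega : measurableType d}.
Variable P : probability Omega R.
Variables (xi : set (R * R) -> Omega -> R) (I : (R * R -> R) -> Omega -> R).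
Hypothesis HI : stochastic_integral P xi I.
Context d1 (S : measurableType d1) (nu : probability S R).
Variables (kappa : S -> R * R -> R) (O : S -> Omega -> R) (rho : S -> R) (C : R).
Local Notation smu := (@spacetime_mu R).
Hypothesis mkappa : measurable_fun setT
  (fun p : S * (measurableTypeR R * measurableTypeR R) => kappa p.1 p.2).
Hypothesis Lkappa : forall z, L2_spacetime R (kappa z).
Hypothesis kappaC : forall z, nrm smu (kappa z) <= C.
Hypothesis Lrho : rho \in Lfun nu 2%:E.
Hypothesis mO : measurable_fun setT (fun p : S * Omega => O p.1 p.2).
Hypothesis OI : forall z, ae_eq P setT (O z) (I (kappa z)).

Let mOz z : measurable_fun setT (O z).
Proof. exact: (measurableT_comp mO (measurable_pair1 z)). Qed.

Lemma gaussian_field_L2 z : O z \in Lfun P 2%:E.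
Proof.
apply: Lfun2_ae (I_L2 HI (Lkappa z)); first exact: mOz.
by apply: filterS (OI z) => w h /h.
Qed.

Lemma gaussian_field_ip z phi : L2_spacetime R phi ->
  ip P (O z) (I phi) = ip smu (kappa z) phi.
Proof.
move=> Lphi; rewrite -(I_ip HI)//.
by apply: ip_ae; [exact: mOz|exact: Lfun2_measurable (I_L2 HI _)|exact: Lfun2_measurable (I_L2 HI _)|exact: OI].
Qed.

Lemma gaussian_field_ip2 z z' : ip P (O z) (O z') = ip smu (kappa z) (kappa z').
Proof.
rewrite -(gaussian_field_ip z (Lkappa z')) ipC [RHS]ipC.
by apply: ip_ae; [exact: mOz|exact: Lfun2_measurable (I_L2 HI _)|exact: mOz|exact: OI].
Qed.

Lemma gaussian_field_nrm z : nrm P (O z) <= C.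
Proof. by rewrite /nrm gaussian_field_ip2; exact: kappaC. Qed.

Lemma field_mixture_L2 : mixture nu O rho \in Lfun P 2%:E.
Proof. exact: (mixture_L2 mO gaussian_field_L2 gaussian_field_nrm Lrho). Qed.

(** With [Y] and [psi] the mixtures of the field and of the kernels, the products <Y, Y>, <Y, I psi>
    and <I psi, I psi> all equal <psi, psi>, because the field and the kernels have the same
    covariance; so Y - I psi has norm 0. Joint measurability is asked of the field only, never of z,
    w |-> I (kappa z) w. *)
Theorem stochastic_fubini : ae_eq P setT (mixture nu O rho) (I (mixture nu kappa rho)).
Proof.
pose Y := mixture nu O rho; pose psi := mixture nu kappa rho.
have Lpsi : L2_spacetime R psi by exact: (mixture_L2 mkappa Lkappa kappaC Lrho).
have LY : Y \in Lfun P 2%:E by exact: field_mixture_L2.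
have LI := I_L2 HI Lpsi.
have ipY X : X \in Lfun P 2%:E -> ip P Y X = \int[nu]_z (rho z * ip P (O z) X).
  exact: (ip_mixture mO gaussian_field_L2 gaussian_field_nrm Lrho).
have ippsi phi : L2_spacetime R phi -> ip smu psi phi = \int[nu]_z (rho z * ip smu (kappa z) phi).
  exact: (ip_mixture mkappa Lkappa kappaC Lrho).
have YI : ip P Y (I psi) = ip smu psi psi.
  by rewrite ipY// ippsi//; apply: eq_Rintegral => z _; rewrite gaussian_field_ip.
have YY : ip P Y Y = ip smu psi psi.
  rewrite (ipY _ LY) (ippsi _ Lpsi); apply: eq_Rintegral => z _; congr (_ * _).
  transitivity (ip P Y (O z)); first exact: ipC.
  transitivity (ip smu psi (kappa z)); last exact: ipC.
  rewrite (ipY _ (gaussian_field_L2 z)) (ippsi _ (Lkappa z)).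
  by apply: eq_Rintegral => z' _; rewrite gaussian_field_ip2.
have LB := Lfun2B LY LI.
have := ip_eq0 LB; rewrite ipBl// !ipBr// YY YI ipC YI (I_isometry HI)// !subrr => /(_ erefl).
by apply: filterS => w /(_ Logic.I)/= /eqP; rewrite subr_eq0 => /eqP.
Qed.

End StochasticFubini.

(** * Paths on [0, 1] extended to the whole line *)

Section Clamp.
Variable R : realType.
Implicit Types s t x y : R.

(** The retraction onto [0, 1]. Composition with it turns statements about times in [0, 1] into
    statements on the whole type, where measurability and uniform bounds hold without side
    conditions. *)
Definition clamp s : R := Num.max 0 (Num.min s 1).

Lemma clamp_itv s : 0 <= clamp s <= 1.
Proof. by rewrite /clamp le_max lexx ge_max ler01 ge_min lexx orbT. Qed.

Lemma clamp_id s : 0 <= s <= 1 -> clamp s = s.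
Proof. by move=> /andP[s0 s1]; rewrite /clamp min_l// max_r. Qed.

Lemma clamp_clamp s : clamp (clamp s) = clamp s.
Proof. exact/clamp_id/clamp_itv. Qed.

Lemma continuous_clamp : continuous clamp.
Proof.
move=> s; apply: (@continuous_max R R (fun=> 0) (fun s => Num.min s 1)); first exact: cvg_cst.
by apply: (@continuous_min R R id (fun=> 1)); [exact: cvg_id|exact: cvg_cst].
Qed.

Lemma measurable_clamp : measurable_fun setT clamp.
Proof. by apply: continuous_measurable_fun; exact: continuous_clamp. Qed.

Lemma path_jointly_continuous (v : R -> R -> R) : path_CT v ->
  continuous (fun z : R * R => v (clamp z.1) z.2).
Proof.
move=> [cx _ /subspace_continuousP cu] [s y] /=.
have cs : clamp s \in `[0, 1] by rewrite in_itv/= clamp_itv.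
apply/cvgrPdist_lt => e e0; have e20 : 0 < e / 2 by rewrite divr_gt0.
have H1 : \forall z \near (s, y), `|v (clamp s) y - v (clamp s) z.2| < e / 2.
  have C : v (clamp s) z.2 @[z --> (s, y)] --> v (clamp s) y.
    by apply: cvg_comp; [exact: cvg_snd|exact: cx].
  by move/cvgrPdist_lt : C => /(_ _ e20).
have H2 : \forall s' \near s, forall y', `|v (clamp s) y' - v (clamp s') y'| < e / 2.
  have : nbhs (v (clamp s) : {uniform R -> R}) [set h | forall y', `|v (clamp s) y' - h y'| < e / 2].
    apply/uniform_nbhs; exists [set p : R * R | ball p.1 (e / 2) p.2]; split.
      exact: (@entourage_ball R R (PosNum e20)).
    by move=> h /= H y'; have := H y' Logic.I; rewrite /ball/=.
  move=> /(cu (clamp s) cs) W.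
  have W' : nbhs (clamp s) [set t | `[0, 1]%classic t -> forall y', `|v (clamp s) y' - v t y'| < e / 2].
    exact: W.
  have W2 : \forall s' \near s, `[0, 1]%classic (clamp s') -> forall y', `|v (clamp s) y' - v (clamp s') y'| < e / 2.
    exact: (@continuous_clamp s _ W').
  apply: filterS W2 => s' /=; apply.
  by rewrite in_itv/= clamp_itv.
have H3 : \forall z \near (s, y), forall y', `|v (clamp s) y' - v (clamp z.1) y'| < e / 2.
  exact: (@cvg_fst _ _ (nbhs s) (nbhs y) _ _ H2).
apply: filterS2 H1 H3 => z h1 /(_ z.2) h3.
rewrite -(subrKA (v (clamp s) z.2)) (splitr e).
by apply: (le_lt_trans (ler_normD _ _)); exact: ltrD.
Qed.

Lemma path_bounded (v : R -> R -> R) : path_CT v ->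
  exists B, forall z : R * R, `|v (clamp z.1) (clamp z.2)| <= B.
Proof.
move=> /path_jointly_continuous cv; pose K : set (R * R) := `[0, 1] `*` `[0, 1].
have cK : compact K by apply: compact_setX; exact: segment_compact.
have := continuous_compact (continuous_subspaceT cv) cK.
move=> /compact_bounded[M [_ hM]]; exists (M + 1) => z.
apply: (hM (M + 1)); first by rewrite ltrDl.
exists (clamp z.1, clamp z.2); last by rewrite /= clamp_clamp.
by split; rewrite /= in_itv/= clamp_itv.
Qed.

(* Caratheodory functions are jointly measurable: round the continuous
   variable down to the grid of mesh [1 / n]. *)
Lemma caratheodory_measurable d (T : measurableType d) (f : R -> T -> R) :
  (forall s, measurable_fun setT (f s)) -> (forall w, continuous (f^~ w)) ->
  measurable_fun setT (fun p : R * T => f (clamp p.1) p.2).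
Proof.
move=> mf cf.
pose k (n : nat) s : nat := Num.truncn (n.+1%:R * clamp s).
have kn n s : (k n s < n.+2)%N.
  rewrite /k truncn_lt_nat ?mulr_ge0//; last by have /andP[] := clamp_itv s.
  have /andP[_ c1] := clamp_itv s.
  by rewrite (@le_lt_trans _ _ n.+1%:R)// ?ltr_nat// ler_piMr.
pose F n (p : R * T) := \sum_(i < n.+2) (if k n p.1 == i then f (i%:R / n.+1%:R) p.2 else 0).
have FE n p : F n p = f ((k n p.1)%:R / n.+1%:R) p.2.
  rewrite /F (bigD1 (Ordinal (kn n p.1)))//= eqxx big1 ?addr0// => i.
  by rewrite -val_eqE/= eq_sym => /negPf ->.
apply: (measurable_fun_cvg (h := F)) => [n|p _].
  apply: measurable_sum => i; apply: measurable_fun_ifT => //; last first.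
    exact: (measurableT_comp (mf _) measurable_snd).
  rewrite (_ : (fun _ => _) = (fun p : R * T => (i%:R <= n.+1%:R * clamp p.1) && (n.+1%:R * clamp p.1 < i.+1%:R))).
    have mc : measurable_fun setT (fun p : R * T => n.+1%:R * clamp p.1).
      by apply: measurable_funM => //; exact: (measurableT_comp measurable_clamp measurable_fst).
    by apply: measurable_and; [exact: measurable_fun_ler|exact: measurable_fun_ltr].
  apply/funext => q; rewrite /k truncn_eq// mulr_ge0//.
  by have /andP[] := clamp_itv q.1.
under eq_fun do rewrite FE.
suff C : (k n p.1)%:R / n.+1%:R @[n --> \oo] --> clamp p.1.
  exact: (cvg_comp _ _ C (cf p.2 (clamp p.1))).
apply/cvgrPdist_le => e e0; near=> n.
have n0 : 0 < n.+1%:R :> R by rewrite ltr0n.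
have c0 : 0 <= n.+1%:R * clamp p.1 by rewrite mulr_ge0//; have /andP[] := clamp_itv p.1.
have /andP[k1 k2] := truncn_itv c0.
have -> : clamp p.1 - (k n p.1)%:R / n.+1%:R = (n.+1%:R * clamp p.1 - (k n p.1)%:R) / n.+1%:R.
  by rewrite mulrBl mulrAC mulfV ?mul1r// gt_eqF.
rewrite normrM normfV (ger0_norm (ltW n0)) ger0_norm ?subr_ge0//.
apply: (@le_trans _ _ (1 / n.+1%:R)).
  rewrite ler_pM2r ?invr_gt0// lerBlDl; apply/ltW; rewrite natr1; exact: k2.
rewrite div1r; apply/ltW; near: n.
exact: (near_infty_natSinv_lt (PosNum e0)).
Unshelve. all: by end_near. Qed.

End Clamp.

Section Resolvent.
Variable R : realType.
Local Notation smu := (@spacetime_mu R).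
Local Notation leb := (@lebesgue_measure R).
Implicit Types (s t x y : R) (z : R * R) (v : R -> R -> R).

Lemma torus_eq_Rintegral (f g : R -> R) : measurable_fun setT f -> measurable_fun setT g ->
  (forall y, 0 <= y < 1 -> f y = g y) -> \int[torus_mu]_y f y = \int[torus_mu]_y g y.
Proof.
move=> mf mg fg; apply: ae_eq_Rintegral => //.
by apply: ae_eq_mrestr => y; rewrite /torus_dom/= in_itv/=; exact: fg.
Qed.

Lemma unit_eq_Rintegral (f g : R -> R) : measurable_fun setT f -> measurable_fun setT g ->
  (forall s, 0 <= s <= 1 -> f s = g s) -> \int[unit_mu]_s f s = \int[unit_mu]_s g s.
Proof.
move=> mf mg fg; apply: ae_eq_Rintegral => //.
by apply: ae_eq_mrestr => y; rewrite /= in_itv/=; exact: fg.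
Qed.

Lemma Lfun2_bounded_mul d (T : measurableType d) (mu : {measure set T -> \bar R})
    (a f : T -> R) (c : R) : measurable_fun setT a -> (forall w, `|a w| <= c) ->
  f \in Lfun mu 2%:E ->
  (fun w => a w * f w) \in Lfun mu 2%:E /\ nrm mu (fun w => a w * f w) <= c * nrm mu f.
Proof.
move=> ma ac Lf; have /Lfun2P[mf if2] := Lf.
have le w : (a w * f w) ^+ 2 <= c ^+ 2 * f w ^+ 2.
  rewrite exprMn ler_wpM2r ?sqr_ge0// -real_normK ?num_real// ler_pXn2r ?nnegrE//.
  exact: le_trans (ac w).
have i2 := rintZ (c ^+ 2) if2.
have L : (fun w => a w * f w) \in Lfun mu 2%:E.
  by apply: (Lfun2_dominated _ i2 le); exact: measurable_funM.
have c0 : 0 <= c by exact: le_trans (ac point).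
split => //; rewrite -(@ler_pXn2r _ 2)// ?nnegrE ?mulr_ge0 ?nrm_ge0// exprMn !nrm_sqr !ipE.
rewrite -(RintegralZl _ measurableT if2).
by apply: le_Rintegral => //; have /Lfun2P[] := L.
Qed.

(** Agrees with the path on the fundamental domain, and is measurable and bounded everywhere. *)
Definition vfield v z := v (clamp z.1) (clamp z.2).

Lemma vfield_dom v s y : 0 <= s <= 1 -> 0 <= y < 1 -> vfield v (s, y) = v s y.
Proof.
by move=> s01 /andP[y0 /ltW y1]; rewrite /vfield/= !clamp_id// y0 y1.
Qed.

(** Two applications of [caratheodory_measurable]: in time at a fixed position, then in the position
    with the pair of time and sample point as parameter. *)
Lemma measurable_random_vfield d (T : measurableType d) (O : R -> T -> R -> R) :
  (forall s y, 0 <= s <= 1 -> measurable_fun setT (fun w => O s w y)) ->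
  (forall w, path_CT (fun s => O s w)) ->
  measurable_fun setT (fun p : (R * R) * T => vfield (fun s => O s p.2) p.1).
Proof.
move=> mO pO.
have m1 y : measurable_fun setT (fun p : R * T => O (clamp p.1) p.2 y).
  have := @caratheodory_measurable R _ T (fun s w => O (clamp s) w y).
  under [X in _ -> _ -> measurable_fun _ X]eq_fun do rewrite clamp_clamp.
  apply; first by move=> s; apply: mO; exact: clamp_itv.
  move=> w s; have := path_jointly_continuous (pO w).
  move=> /(_ (s, y)) C.
  apply: (@continuous_comp _ _ _ (fun s => (s, y)) (fun z : R * R => O (clamp z.1) w z.2)) => //.
  exact: (cvg_pair cvg_id (cvg_cst y)).
have m2 := @caratheodory_measurable R _ (R * T)%type (fun y q => O (clamp q.1) q.2 y) m1.
have {}m2 : measurable_fun setT (fun p : R * (R * T) => O (clamp p.2.1) p.2.2 (clamp p.1)).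
  apply: m2 => -[s w] /=; have [cx _ _] := pO w.
  by apply: cx; rewrite in_itv/= clamp_itv.
have mg : measurable_fun setT (fun p : (R * R) * T => (p.1.2, (p.1.1, p.2))).
  apply/measurable_fun_pair => /=; first exact: (measurableT_comp measurable_snd measurable_fst).
  by apply/measurable_fun_pair => //=; exact: (measurableT_comp measurable_fst measurable_fst).
exact: (measurableT_comp m2 mg).
Qed.

Lemma measurable_vfield v : path_CT v -> measurable_fun setT (vfield v).
Proof.
move=> pv.
have m := @measurable_random_vfield _ R (fun s _ => v s) (fun s y _ => measurable_cst _) (fun=> pv).
exact: (measurableT_comp m (measurable_pair2 (0 : R))).
Qed.

Lemma vfield_L2 v : path_CT v -> L2_spacetime R (vfield v).
Proof.
move=> pv; have [B hB] := path_bounded pv.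
apply: (@Lfun2_dominated _ _ _ _ _ (fun=> B ^+ 2)).
- exact: measurable_vfield.
- exact: finite_measure_integrable_cst.
- have B0 : 0 <= B by exact: le_trans (hB (0, 0)).
  by move=> z; rewrite -real_normK ?num_real// ler_pXn2r ?nnegrE//; exact: hB.
Qed.

Lemma measurable_section (f : R * R -> R) s : measurable_fun setT f ->
  measurable_fun setT (fun y : R => f (s, y)).
Proof. by move=> mf; exact: (measurableT_comp mf (measurable_pair1 s)). Qed.

Lemma measurable_kernel t x : measurable_fun setT (convolution_kernel t x).
Proof.
by apply: (@measurable_convolution_kernel R _ (R * R)%type (fun=> t) (fun=> x) fst snd).
Qed.

(** The drift term of the mild equation becomes an inner product on space-time, so that the L^2
    calculus of kernels applies to it. *)
Lemma heat_semigroup_int t x v : 0 <= t <= 1 -> path_CT v ->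
  \int[leb]_(s in `[0, t]) heat_semigroup (t - s) (v s) x =
  ip smu (convolution_kernel t x) (vfield v).
Proof.
move=> t01 pv; have [t0 t1] := andP t01.
have [kL _] := kernel_L2 x t01; have vL := vfield_L2 pv.
have ikv := Lfun2_integrableM kL vL.
rewrite /ip spacetime_fubini//.
pose g s := \int[torus_mu]_y (convolution_kernel t x (s, y) * vfield v (s, y)).
have mg : measurable_fun setT g.
  exact: (rint_measurable (rint_fubini1 ((spacetime_integrable _).1 ikv))).
have gH s : 0 <= s < t -> g s = heat_semigroup (t - s) (v s) x.
  move=> /andP[s0 st]; rewrite /heat_semigroup subr_gt0 st.
  have s01 : 0 <= s <= 1 by rewrite s0 (le_trans (ltW st)).
  have [cx _ _] := pv.
  apply: torus_eq_Rintegral.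
  - apply: measurable_funM; first exact: (measurable_section s (measurable_kernel t x)).
    exact: (measurable_section s (measurable_vfield pv)).
  - apply: measurable_funM; last by apply: continuous_measurable_fun; exact: cx.
    have -> : (fun y => heat_kernel (t - s) (x - y)) = (fun y => hk (t - s) (x - y)).
      by apply/funext => y; rewrite hk_gt0// subr_gt0.
    by apply: measurable_hk => //; exact: measurable_funB.
  by move=> y y01; rewrite vfield_dom// convolution_kernelE/= hk_gt0// subr_gt0.
have g0 s : t <= s -> g s = 0.
  move=> ts; rewrite /g; under eq_Rintegral do rewrite convolution_kernelE/= /hk subr_gt0 ltNge ts/= mul0r.
  by rewrite Rintegral_cst// mul0r.
transitivity (\int[leb]_(s in `[0, 1]) g s); last by symmetry; exact: Rintegral_mrestr.
(* At s = t the semigroup is the identity while the kernel is 0; this single point is negligible. *)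
transitivity (\int[leb]_(s in `[0, t[) g s).
  rewrite (_ : \int[leb]_(s in `[0, t[) g s = \int[leb]_(s in `[0, t[) heat_semigroup (t - s) (v s) x).
    rewrite /Rintegral integral_itv_bndo_bndc//; apply/measurable_EFinP.
    apply: (eq_measurable_fun g); last exact: measurable_funTS.
    by move=> s; rewrite inE/= in_itv/=; exact: gH.
  by apply: eq_Rintegral => s; rewrite inE/= in_itv/=; exact: gH.
rewrite Rintegral_mkcond [RHS]Rintegral_mkcond; apply: eq_Rintegral => s _.
rewrite !patchE !mem_setE !in_itv/=; case: (leP 0 s) => //= s0.
case: (ltP s t) => st; first by rewrite (le_trans (ltW st)).
by rewrite (g0 _ st); case: ifP.
Qed.

Lemma unit_FTC2 (F f : R -> R) r t : (forall x : R, is_derive x 1 F (f x)) -> continuous f ->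
  0 <= r -> r <= t -> t <= 1 ->
  \int[unit_mu]_s (if (r < s) && (s < t) then f s else 0) = F t - F r.
Proof.
move=> dF cf r0 rt t1; rewrite -(RFTC rt dF cf).
have mf : measurable_fun setT f by exact: continuous_measurable_fun.
have it := continuous_itv_integrable r t cf.
rewrite -Rintegral_itv_bndo_bndc; last by apply: integrableS it => //; apply: subset_itvl; rewrite bnd_simp.
rewrite -Rintegral_itv_obnd_cbnd; last by apply: integrableS it => //; apply: subset_itv; rewrite bnd_simp.
rewrite Rintegral_mrestr; last first.
  by apply: measurable_fun_ifT => //; apply: measurable_and; exact: measurable_fun_ltr.
rewrite Rintegral_mkcond [RHS]Rintegral_mkcond; apply: eq_Rintegral => s _.
rewrite !patchE !mem_setE !in_itv/=; case: (ltP r s) => rs; last by case: ifP.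
case: (ltP s t) => st; last by case: ifP.
by rewrite (le_trans r0 (ltW rs)) (le_trans (ltW st) t1).
Qed.

(** The convolution kernels as a family indexed by space-time points, clamped so that the norm bound
    holds for every index. *)
Definition kfield z := convolution_kernel (clamp z.1) (clamp z.2).

Local Notation S := (measurableTypeR R * measurableTypeR R)%type.

Lemma measurable_kfield : measurable_fun setT (fun p : S * S => kfield p.1 p.2).
Proof.
suff m : measurable_fun setT (fun p : (R * R) * (R * R) => kfield p.1 p.2) by exact: m.
have mc (f : (R * R) * (R * R) -> R) : measurable_fun setT f -> measurable_fun setT (fun p => clamp (f p)).
  exact: (measurableT_comp (@measurable_clamp R)).
apply: (@measurable_convolution_kernel R _ _ (fun p : (R * R) * (R * R) => clamp p.1.1)
  (fun p => clamp p.1.2) (fun p => p.2.1) (fun p => p.2.2)).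
- exact: (mc _ (measurableT_comp measurable_fst measurable_fst)).
- exact: (mc _ (measurableT_comp measurable_snd measurable_fst)).
- exact: (measurableT_comp measurable_fst measurable_snd).
- exact: (measurableT_comp measurable_snd measurable_snd).
Qed.

Lemma kfield_L2 z : L2_spacetime R (kfield z).
Proof. by have [] := kernel_L2 (clamp z.2) (clamp_itv z.1). Qed.

Lemma kfield_nrm z : nrm smu (kfield z) <= Num.sqrt 2.
Proof. by have [_] := kernel_L2 (clamp z.2) (clamp_itv z.1); rewrite /nrm ler_sqrt. Qed.

(** The kernel of the semigroup e^t P_t generated by the Laplacian plus the identity; clamping keeps
    the exponential factor bounded off the domain. *)
Definition Phi x z := expR (1 - clamp z.1) * convolution_kernel 1 x z.

Lemma Phi_L2_nrm x : L2_spacetime R (Phi x) /\ nrm smu (Phi x) <= expR 1 * Num.sqrt 2.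
Proof.
have [kL k2] := kernel_L2 x (t := 1) ltac:(by rewrite ler01 lexx).
have m : measurable_fun setT (fun z : R * R => expR (1 - clamp z.1)).
  apply: measurableT_comp; first exact: measurable_expR.
  by apply: measurable_funB => //; exact: (measurableT_comp (@measurable_clamp R) measurable_fst).
have b z : `|expR (1 - clamp z.1)| <= expR 1 :> R.
  by rewrite ger0_norm ?expR_ge0// ler_expR gerBl; have /andP[] := clamp_itv z.1.
have [L n] := @Lfun2_bounded_mul _ _ smu (fun z : R * R => expR (1 - clamp z.1))
  (convolution_kernel 1 x) (expR 1) m b kL.
split => //; apply: (le_trans n); rewrite ler_wpM2l ?expR_ge0//.
by rewrite /nrm ler_sqrt.
Qed.

Lemma hk_le0 t x : t <= 0 -> hk t x = 0.
Proof. by rewrite /hk leNgt => /negPf ->. Qed.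

(** The resolvent identity. By the semigroup property, integrating e^{1-s} p_{1-s}(x - y) p_{s-r}(y
    - y') over y and over s in ]r, 1[ gives p_{1-r}(x - y') times the integral of e^{1-s}, which is
    e^{1-r} - 1. *)
Lemma mixture_kfield x : ae_eq smu setT (mixture smu kfield (Phi x))
  (fun z => Phi x z - convolution_kernel 1 x z).
Proof.
have [LP _] := Phi_L2_nrm x.
have iM := @mixture_integrable _ _ S S R smu smu kfield (Phi x) _ measurable_kfield kfield_L2 kfield_nrm LP.
have aeI := ae_integrable2 iM.
have dom : ae_eq smu setT (fun z => `[< spacetime_dom z >]) (fun=> true).
  by apply: spacetime_ae => z dz; apply/asboolP.
apply: filterS2 aeI dom => -[r y'] iz /(_ Logic.I)/asboolP[] /=.
rewrite !in_itv/= => r01 y01 _.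
rewrite /mixture spacetime_fubini; last exact: iz.
have [r0 r1] := andP r01; pose c := hk (1 - r) (x - y').
have mg : measurable_fun setT (fun s : R => \int[torus_mu]_y (Phi x (s, y) * kfield (s, y) (r, y'))).
  exact: (rint_measurable (rint_fubini1 ((spacetime_integrable _).1 iz))).
have ce : continuous (fun s : R => (- c) * (expR (-1 * s + 1) * -1)).
  move=> s; apply: cvgM; first exact: cvg_cst.
  apply: cvgM; last exact: cvg_cst.
  by apply: continuous_comp; [exact: continuous_affine|exact: continuous_expR].
transitivity (\int[unit_mu]_s (if (r < s) && (s < 1) then (- c) * (expR (-1 * s + 1) * -1) else 0)).
  apply: unit_eq_Rintegral => //.
    apply: measurable_fun_ifT => //.
      by apply: measurable_and; exact: measurable_fun_ltr.
    exact: continuous_measurable_fun.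
  move=> s s01.
  have mh : measurable_fun setT (fun y : R => hk (1 - s) (x - y) * hk (s - r) (y - y')).
    by apply: measurable_funM; apply: measurable_hk => //; exact: measurable_funB.
  transitivity (\int[torus_mu]_y (expR (1 - s) * (hk (1 - s) (x - y) * hk (s - r) (y - y')))).
    apply: torus_eq_Rintegral; last 2 first.
    - exact: measurable_funM.
    - move=> y /andP[y0 /ltW y1].
      by rewrite /Phi /kfield /= !clamp_id ?y0// !convolution_kernelE/= mulrA.
    apply: measurable_funM; last first.
      exact: (measurable_convolution_kernel (measurable_cst (clamp s)) (@measurable_clamp R)
        (measurable_cst (r : R)) (measurable_cst (y' : R))).
    exact: (measurable_funM (measurable_cst (expR (1 - clamp s)))
      (measurable_section s (measurable_kernel 1 x))).
  have [B1 hB1] := hk_bounded (1 - s); have [B2 hB2] := hk_bounded (s - r).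
  rewrite RintegralZl//; last first.
    by apply: (@torus_bounded_integrable _ (B1 * B2)) => // y; rewrite normrM ler_pM.
  case: ifP => [/andP[rs s1]|/negbT].
    rewrite hk_semigroup ?subr_gt0// /c addrA subrK mulN1r [- s + 1]addrC; ring.
  rewrite negb_and -!leNgt => /orP[sr|s1].
    by under eq_Rintegral do rewrite [hk (s - r) _]hk_le0 ?subr_le0// mulr0; rewrite Rintegral_cst// mul0r mulr0.
  by under eq_Rintegral do rewrite hk_le0 ?subr_le0// mul0r; rewrite Rintegral_cst// mul0r mulr0.
rewrite (@unit_FTC2 (fun s => (- c) * expR (-1 * s + 1)) _ r 1 _ ce)//; last first.
  move=> s; exact: (@is_derive_comp_affine _ (- c) (-1) 1 expR expR s (fun y => is_derive_expR y)).
rewrite /Phi convolution_kernelE /= clamp_id// -/c !mulN1r addNr expR0 [- r + 1]addrC; ring.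
Qed.

Lemma heat_semigroup0 t x : heat_semigroup t (fun=> 0) x = 0.
Proof.
rewrite /heat_semigroup; case: ifP => // _.
by under eq_Rintegral do rewrite mulr0; rewrite Rintegral_cst// mul0r.
Qed.

(** Write the equation as o = v - K v and pair it with [Phi x]. By Fubini, <Phi, K v> is the pairing
    of v with the mixture of the kernels, that is <Phi - k, v> with k the kernel at time 1. Hence
    <Phi, o> = <k, v> = v(1, x) - o(1, x). The argument is pathwise and needs neither iteration nor
    uniqueness. *)
Lemma mild_resolvent (v o : R -> R -> R) : path_CT v -> path_CT o ->
  (forall t x, t \in `[0, 1] -> v t x = heat_semigroup t (fun=> 0) x +
     \int[leb]_(s in `[0, t]) heat_semigroup (t - s) (v s) x + o t x) ->
  forall x, v 1 x = o 1 x + \int[smu]_z (Phi x z * vfield o z).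
Proof.
move=> pv po mild x; have LV := vfield_L2 pv; have [LP _] := Phi_L2_nrm x.
have ME t y : 0 <= t <= 1 -> v t y = ip smu (convolution_kernel t y) (vfield v) + o t y.
  by move=> t01; rewrite mild ?in_itv// heat_semigroup0 add0r heat_semigroup_int.
have t1 : 0 <= (1 : R) <= 1 by rewrite ler01 lexx.
have [kL _] := kernel_L2 x t1.
have E z : Phi x z * vfield o z = Phi x z * vfield v z - Phi x z * ip smu (kfield z) (vfield v).
  by rewrite /vfield (ME (clamp z.1) (clamp z.2) (clamp_itv _)) /kfield; ring.
rewrite (ME _ _ t1) addrC; congr (_ + _).
under eq_Rintegral do rewrite E.
have iP : smu.-integrable setT (EFin \o (fun z => Phi x z * ip smu (kfield z) (vfield v))).
  exact: (@ip_mixture_integrable _ _ S S R smu smu kfield (Phi x) _ measurable_kfield kfield_L2 kfield_nrm LP _ LV).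
rewrite (RintegralB measurableT (Lfun2_integrableM LP LV) iP).
have E1 := @ip_mixture _ _ S S R smu smu kfield (Phi x) _ measurable_kfield kfield_L2 kfield_nrm LP _ LV.
have LM := @mixture_L2 _ _ S S R smu smu kfield (Phi x) _ measurable_kfield kfield_L2 kfield_nrm LP.
have E2 := ip_ae (Lfun2_measurable LM) (Lfun2_measurable (Lfun2B LP kL)) (Lfun2_measurable LV) (mixture_kfield x).
transitivity (ip smu (Phi x) (vfield v) - (ip smu (Phi x) (vfield v) -
  ip smu (convolution_kernel 1 x) (vfield v))); first by rewrite subKr.
congr (_ - _); exact: (esym (etrans (esym E1) (etrans E2 (ipBl LP kL LV)))).
Qed.

End Resolvent.

Section Representation.
Context {R : realType} {d : measure_display} {Omega : measurableType d}.
Variable P : probability Omega R.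
Variables (xi : set (R * R) -> Omega -> R) (I : (R * R -> R) -> Omega -> R).
Variables (O u : R -> Omega -> R -> R).
Hypotheses (HI : stochastic_integral P xi I) (HO : stochastic_convolution P I O).
Hypothesis Hu : mild_solution P xi O (fun v : R => v) (fun _ : R => 0) u.
Local Notation smu := (@spacetime_mu R).

Definition ofield (z : R * R) (w : Omega) : R := vfield (fun t => O t w) z.

Local Notation S := (measurableTypeR R * measurableTypeR R)%type.

Lemma measurable_ofield : measurable_fun setT (fun p : S * Omega => ofield p.1 p.2).
Proof.
have [mO _ pO] := HO.
exact: (@measurable_random_vfield R _ Omega O mO pO).
Qed.

Lemma ofield_kfield z : ae_eq P setT (ofield z) (I (kfield z)).
Proof.
have [_ aO _] := HO; have := aO (clamp z.1) (clamp z.2).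
by rewrite in_itv/= clamp_itv => /(_ isT); apply: filterS => w h _.
Qed.

(** O_1(x) is the integral of the kernel k at time 1, and by stochastic Fubini <Phi, O> is the
    integral of the mixture, equal to Phi - k; the sum is the integral of Phi. *)
Lemma mild_solution_gaussian x : ae_eq P setT (fun w => u 1 w x) (I (Phi x)).
Proof.
have [_ aO pO] := HO; have [_ pu mild] := Hu.
have t1 : 0 <= (1 : R) <= 1 by rewrite ler01 lexx.
have [kL _] := kernel_L2 x t1; have [LP _] := Phi_L2_nrm x.
have SF := @stochastic_fubini _ _ _ P xi I HI _ S smu _ _ (Phi x) _ (@measurable_kfield R)
  (@kfield_L2 R) (@kfield_nrm R) LP measurable_ofield ofield_kfield.
have LM := @mixture_L2 _ _ S S R smu smu _ (Phi x) _ (@measurable_kfield R) (@kfield_L2 R) (@kfield_nrm R) LP.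
have O1 := aO 1 x; rewrite in_itv/= t1 in O1; have {}O1 := O1 isT.
have A := I_comb HI 1 1 kL LM.
have B : ae_eq P setT (I (fun z => 1 * convolution_kernel 1 x z + 1 * mixture smu (@kfield R) (Phi x) z)) (I (Phi x)).
  apply: (I_ae_eq HI) => //; first exact: Lfun2_comb.
  by apply: filterS (mixture_kfield x) => z /(_ Logic.I) h _; rewrite h !mul1r addrC subrK.
have AB : ae_eq P setT (I (Phi x))
    (fun w => I (convolution_kernel 1 x) w + I (mixture smu (@kfield R) (Phi x)) w).
  by apply: filterS2 A B => w /(_ Logic.I) + /(_ Logic.I) <- _ => ->; rewrite !mul1r.
have H : ae_eq P setT (fun w => u 1 w x)
    (fun w => I (convolution_kernel 1 x) w + I (mixture smu (@kfield R) (Phi x)) w).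
  move: mild SF O1; apply: filterS3 => w mw /(_ Logic.I) <- <- _.
  exact: (mild_resolvent (pu w) (pO w) mw x).
by apply: filterS2 AB H => w /(_ Logic.I) + /(_ Logic.I) + _ => -> ->.
Qed.

End Representation.

(** * Conditional expectations as projections *)

Section UnconditionalMonotone.
Context d (T : measurableType d) (R : realType) (mu : {measure set T -> \bar R}).

(* The integral of a nonnegative function is a supremum over the simple
   functions below it, so no measurability is needed. *)
Lemma ge0_le_integral_nonmeasurable (f g : T -> \bar R) :
  (forall x, 0 <= f x)%E -> (forall x, f x <= g x)%E ->
  (\int[mu]_x f x <= \int[mu]_x g x)%E.
Proof.
move=> f0 fg; have g0 x : (0 <= g x)%E by exact: le_trans (fg x).
rewrite !ge0_integralTE//; apply: ereal_sup_le => _ [h hf <-].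
by exists h => // x; exact: le_trans (fg x).
Qed.

End UnconditionalMonotone.

Section SimpleApproximation.
Import HBNNSimple.

Lemma nonneg_step_approx d (T : measurableType d) (R : realType) (f : T -> R) :
  measurable_fun setT f -> (forall x, 0 <= f x) ->
  exists s : nat -> seq (R * set T), [/\ forall n p, p \in s n -> measurable p.2,
    forall n x, 0 <= step_fun (s n) x <= f x
    & forall x, step_fun (s n) x @[n --> \oo] --> f x].
Proof.
move=> mf f0; have mf' : measurable_fun setT (EFin \o f) by exact/measurable_EFinP.
pose p := nnsfun_approx measurableT mf'.
have /choice[s hs] n : exists s : seq (R * set T),
    (forall q, q \in s -> measurable q.2) /\ step_fun s = p n.
  by have [s] := nnsfun_step (p n); exists s.
exists s; split=> [n q|n x|x].
- by have [ms _] := hs n; exact: ms.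
- have [_ ->] := hs n; apply/andP; split; first exact: fun_ge0.
  by rewrite /p nnsfun_approxE -lee_fin; apply: le_approx => // y _; rewrite lee_fin.
- rewrite (_ : (fun n => step_fun (s n) x) = (fun n => p n x)); last first.
    by apply/funext => n; have [_ ->] := hs n.
  have := @cvg_nnsfun_approx _ _ _ _ measurableT _ mf' (fun y _ => ltac:(by rewrite /= lee_fin)) x Logic.I.
  by move=> /fine_cvg.
Qed.

End SimpleApproximation.

Section SubSigmaAlgebra.
Context d (T : measurableType d) (R : realType) (P : probability T R).
Variable G0 : set (set T).
Hypothesis G0m : <<s G0>> `<=` measurable.
Implicit Types f D : T -> R.

(** Stated through preimages, since [T] already carries its own measurable structure; [GmeasurableP]
    passes to the type equipped with the generated one. *)
Definition Gmeasurable f := forall B : set R, measurable B -> <<s G0>> (f @^-1` B).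

Lemma GmeasurableP f : Gmeasurable f <-> measurable_fun [set: g_sigma_algebraType G0] f.
Proof.
split=> [h _ B mB|h B mB]; first by rewrite setTI; exact: h.
by have := h measurableT B mB; rewrite setTI.
Qed.

Lemma Gmeasurable_measurable f : Gmeasurable f -> measurable_fun setT f.
Proof. by move=> h _ B mB; rewrite setTI; exact: (G0m (h B mB)). Qed.

Lemma indic_L2P A : measurable A -> (\1_A : T -> R) \in Lfun P 2%:E.
Proof.
move=> mA; apply: (@Lfun2_dominated _ _ _ _ _ (fun=> 1)).
- exact: measurable_indic.
- exact: finite_measure_integrable_cst.
- by move=> w; rewrite indicE; case: (_ \in _); rewrite ?expr1n// expr0n.
Qed.

Lemma ip_indic f A : measurable A -> \int[P]_(w in A) f w = ip P f \1_A.
Proof.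
move=> mA; rewrite Rintegral_mkcond; apply: eq_Rintegral => w _.
by rewrite patchE indicE; case: ifPn; rewrite ?mulr1 ?mulr0.
Qed.

(** From indicators to simple functions by linearity, to nonnegative functions by dominated
    convergence, to [D] by its positive and negative parts. *)
Lemma Gorthogonal f D : f \in Lfun P 2%:E -> D \in Lfun P 2%:E -> Gmeasurable D ->
  (forall A, <<s G0>> A -> ip P f \1_A = 0) -> ip P f D = 0.
Proof.
move=> Lf LD GD f0.
suff nn (E : T -> R) : Gmeasurable E -> (forall w, 0 <= E w <= `|D w|) -> ip P f E = 0 /\ E \in Lfun P 2%:E.
  have mD := (GmeasurableP D).1 GD.
  have [||p0 Lp] := nn (D^\+).
  - exact/GmeasurableP/measurable_funrpos.
  - move=> w; rewrite funrpos_ge0/= /funrpos ge_max normr_ge0 andbT; exact: ler_norm.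
  have [||q0 Lq] := nn (D^\-).
  - exact/GmeasurableP/measurable_funrneg.
  - move=> w; rewrite funrneg_ge0/= /funrneg ge_max normr_ge0 andbT -normrN; exact: ler_norm.
  have -> : D = (fun w => D^\+ w - D^\- w) by apply/funext => w; rewrite -[in LHS](funrposBneg D).
  by rewrite ipBr// p0 q0 subrr.
move=> GE E0; have mE := Gmeasurable_measurable GE.
have LE : E \in Lfun P 2%:E.
  have /Lfun2P[_ iD2] := LD; apply: (Lfun2_dominated mE iD2) => w.
  by have /andP[E0w ED] := E0 w; rewrite -(real_normK (num_real (D w))) ler_pXn2r// nnegrE.
split=> //.
(* The approximation takes place in the generated structure, so that the level sets belong to the
   sub-sigma-algebra. *)
have [s' [ms' s0' sE']] := @nonneg_step_approx _ (g_sigma_algebraType G0) R E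
  ((GmeasurableP E).1 GE) (fun w => proj1 (andP (E0 w))).
pose s : nat -> seq (R * set T) := s'.
have Gs n p : p \in s n -> <<s G0>> p.2 by exact: ms'.
have ms n p : p \in s n -> measurable p.2 by move=> /Gs /G0m.
have s0 n w : 0 <= step_fun (s n) w <= E w by exact: s0'.
have sE w : step_fun (s n) w @[n --> \oo] --> E w by exact: sE'.
clearbody s; clear s' ms' s0' sE'.
have z n : ip P f (step_fun (s n)) = 0.
  rewrite ipC (_ : step_fun (s n) = (fun w => \sum_(p <- s n | p \in s n) p.1 * \1_(p.2) w)); last first.
    by apply/funext => w; rewrite /step_fun big_seq.
  rewrite ip_suml; [|by move=> p /ms mp; exact: (Lfun2Z _ (indic_L2P mp))|exact: Lf].
  rewrite big1_seq// => p /andP[_ ps].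
  rewrite (ipZl _ (indic_L2P (ms _ _ ps)) Lf) ipC f0 ?mulr0//; exact: Gs ps.
have ifE := integrable_norm (Lfun2_integrableM Lf LE).
have C : ip P f (step_fun (s n)) @[n --> \oo] --> ip P f E.
  apply: (@dominated_Rintegral _ _ _ P (fun n w => f w * step_fun (s n) w) _ _ _ _ _ ifE).
  - move=> n; apply: measurable_funM; first exact: (Lfun2_measurable Lf).
    by apply: measurable_step_fun => p; exact: ms.
  - by apply: measurable_funM => //; exact: (Lfun2_measurable Lf).
  - by move=> w; apply: cvgM; [exact: cvg_cst|exact: sE].
  - move=> n w; have /andP[a b] := s0 n w; rewrite /= !normrM ler_wpM2l//.
    by rewrite !ger0_norm// (le_trans a).
by move: C; under eq_fun do rewrite z; move/cvg_lim => <-//; rewrite lim_cst.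
Qed.

(** Testing with the events D > 0 and D < 0 shows that the integral of |D| vanishes. *)
Lemma Gmeasurable_ae0 D : P.-integrable setT (EFin \o D) -> Gmeasurable D ->
  (forall A, <<s G0>> A -> \int[P]_(w in A) D w = 0) -> ae_eq P setT D (cst 0).
Proof.
move=> iD GD D0; have mD := rint_measurable iD.
have GA : <<s G0>> [set w | 0 < D w].
  rewrite (_ : [set w | _] = D @^-1` `]0, +oo[); last by apply/funext => w; rewrite /= in_itv/= andbT.
  by apply: GD; exact: measurable_itv.
have GB : <<s G0>> [set w | D w < 0].
  rewrite (_ : [set w | _] = D @^-1` `]-oo, 0[); last by apply/funext => w; rewrite /= in_itv/=.
  by apply: GD; exact: measurable_itv.
have E w : `|D w| = D w * \1_[set w | 0 < D w] w - D w * \1_[set w | D w < 0] w.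
  have mw (Q : T -> bool) : (w \in [set v | Q v]) = Q w by apply/idP/idP => [/set_mem|/mem_set].
  rewrite !indicE !mw; have [h|h|h] := ltgtP 0 (D w).
  - by rewrite mulr1 mulr0 subr0 gtr0_norm.
  - by rewrite mulr1 mulr0 sub0r ltr0_norm.
  - by rewrite -h normr0 !mul0r subrr.
have mA := G0m GA; have mB := G0m GB.
have i1 A : measurable A -> P.-integrable setT (EFin \o (fun w => D w * \1_A w)).
  move=> mA'; under [X in EFin \o X]eq_fun do rewrite mulrC.
  apply: (@rintM_bounded _ _ _ _ 1) iD; first exact: measurable_indic.
  by move=> w; rewrite indicE; case: (_ \in _); rewrite ?normr1// normr0.
have : \int[P]_w `|D w| = 0.
  under eq_Rintegral do rewrite E.
  rewrite RintegralB//; [|exact: i1|exact: i1].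
  transitivity (ip P D \1_[set w | 0 < D w] - ip P D \1_[set w | D w < 0]); first by [].
  by rewrite -!ip_indic// !D0// subrr.
move=> H; have : (\int[P]_w `|(EFin \o D) w| = 0)%E.
  have F := integrable_fin_num measurableT (integrable_norm iD).
  by rewrite -(fineK F); congr EFin; exact: H.
move/(ae_eq_integral_abs P measurableT _).1 => /(_ ltac:(exact/measurable_EFinP)).
by apply: filterS => w /(_ Logic.I)/= [->].
Qed.

End SubSigmaAlgebra.

Section GramProjection.
Context d (T : measurableType d) (R : realType) (mu : {measure set T -> \bar R}).
Variables (n : nat) (psi : 'I_n -> T -> R).
Hypothesis Lpsi : forall i, psi i \in Lfun mu 2%:E.

Definition gram : 'M[R]_n := \matrix_(i, k) ip mu (psi i) (psi k).

(** The Gram matrix of the observed kernels is singular: those at time 0 vanish almost everywhere,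
    and the frequencies n and -n carry the same information. Hence [pinvmx]. The explicit formula
    also shows that for [Phi x] the coefficients are measurable and bounded in x. *)
Definition proj_coef (phi : T -> R) (j : 'I_n) : R :=
  \sum_i ip mu phi (psi i) * pinvmx gram i j.

Lemma Lfun2_lincomb (a : 'I_n -> R) : (fun x => \sum_i a i * psi i x) \in Lfun mu 2%:E.
Proof. by apply: Lfun2_sum => i _; exact: Lfun2Z. Qed.

Lemma ip_lincombl (a : 'I_n -> R) phi : phi \in Lfun mu 2%:E ->
  ip mu (fun x => \sum_i a i * psi i x) phi = \sum_i a i * ip mu (psi i) phi.
Proof.
move=> Lphi; rewrite ip_suml//; last by move=> i _; exact: Lfun2Z.
by apply: eq_bigr => i _; rewrite ipZl.
Qed.

Lemma ip_lincombr (a : 'I_n -> R) phi : phi \in Lfun mu 2%:E ->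
  ip mu phi (fun x => \sum_i a i * psi i x) = \sum_i a i * ip mu phi (psi i).
Proof. by move=> Lphi; rewrite ipC ip_lincombl//; apply: eq_bigr => i _; rewrite ipC. Qed.

(* The vector of the [ip phi (psi i)] lies in the row space of the Gram matrix:
   a linear relation between the columns of that matrix is a linear relation
   between the [psi i]. *)
Lemma proj_coefP phi k : phi \in Lfun mu 2%:E ->
  ip mu (fun x => phi x - \sum_j proj_coef phi j * psi j x) (psi k) = 0.
Proof.
move=> Lphi; rewrite ipBl//; last exact: Lfun2_lincomb.
rewrite ip_lincombl//; pose b : 'rV[R]_n := \row_i ip mu phi (psi i).
suff sub : (b <= gram)%MS.
  have /matrixP/(_ 0 k) := mulmxKpV sub; rewrite !mxE => <-; apply/eqP; rewrite subr_eq0; apply/eqP.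
  apply: eq_bigr => j _; rewrite !mxE; congr (_ * _).
  by apply: eq_bigr => i _; rewrite mxE.
rewrite submxE; apply/eqP/matrixP => i0 m; rewrite mxE [RHS]mxE.
pose v i := cokermx gram i m.
have G0 j : \sum_i gram j i * v i = 0.
  by have /matrixP/(_ j m) := mulmx_coker gram; rewrite !mxE.
pose f x := \sum_i v i * psi i x.
have Lf : f \in Lfun mu 2%:E by exact: Lfun2_lincomb.
have ff : ip mu f f = 0.
  rewrite ip_lincombl// big1// => j _; rewrite ip_lincombr//.
  rewrite (eq_bigr (fun i => gram j i * v i)) ?G0 ?mulr0// => i _.
  by rewrite mxE mulrC.
have := ip_CS Lphi Lf; rewrite ff mulr0 => H.
have : ip mu phi f ^+ 2 == 0 by rewrite eq_le H sqr_ge0.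
rewrite sqrf_eq0 ip_lincombr// => /eqP Ev; transitivity (\sum_i v i * ip mu phi (psi i)) => //.
by apply: eq_bigr => i _; rewrite mxE mulrC.
Qed.

Lemma nrm_lincomb (a : 'I_n -> R) :
  nrm mu (fun x => \sum_i a i * psi i x) <= \sum_i `|a i| * nrm mu (psi i).
Proof.
suff H (r : seq 'I_n) : nrm mu (fun x => \sum_(i <- r) a i * psi i x) <= \sum_(i <- r) `|a i| * nrm mu (psi i).
  exact: H.
elim: r => [|i r IH].
  rewrite big_nil (_ : (fun x => _) = (fun=> 0)); last by apply/funext => x; rewrite big_nil.
  by rewrite /nrm ip0l sqrtr0.
rewrite big_cons (_ : (fun x => _) = (fun x => a i * psi i x + \sum_(j <- r) a j * psi j x)); last first.
  by apply/funext => x; rewrite big_cons.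
apply: (le_trans (nrmD (Lfun2Z _ (Lpsi i)) _)).
  by apply: Lfun2_sum => j _; exact: Lfun2Z.
by rewrite nrmZ// lerD2l.
Qed.

End GramProjection.

Section TorusL2.
Variable R : realType.
Local Notation tmu := (@torus_mu R).
Implicit Types g h : R -> R.

Lemma L2T_normE g : L2_torus R g -> L2T_norm g = (nrm tmu g)%:E.
Proof. exact: Lnorm2E. Qed.

Lemma ip_abs_le_nrm d (T : measurableType d) (mu : {measure set T -> \bar R}) (f g : T -> R) :
  f \in Lfun mu 2%:E -> g \in Lfun mu 2%:E -> `|ip mu f g| <= nrm mu f * nrm mu g.
Proof.
move=> Lf Lg; rewrite ler_norml ip_le_nrm// andbT lerNl.
have := ip_le_nrm (Lfun2Z (-1) Lf) Lg; rewrite ipZl// nrmZ// normrN1 !mul1r mulN1r.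
exact.
Qed.

(** Half-spaces suffice to make every inner product with a random variable measurable. The 1 added
    to the norm of [h] in the radius covers h = 0. *)
Lemma L2T_open_halfspace h c : L2_torus R h ->
  L2T_open [set g | L2T g /\ c < L2T_inner g h].
Proof.
move=> Lh; split=> [g []//|g [Lg cg]].
have n0 : 0 < nrm tmu h + 1 by rewrite ltr_wpDl ?nrm_ge0.
exists ((L2T_inner g h - c) / (nrm tmu h + 1)); first by rewrite divr_gt0// subr_gt0.
move=> f Lf; have LB := Lfun2B Lg Lf.
rewrite (L2T_normE LB) lte_fin ltr_pdivlMr// => H; split => //.
have H2 := le_trans (ler_norm _) (ip_abs_le_nrm LB Lh).
have H3 := ler_wpM2l (nrm_ge0 tmu (fun x => g x - f x)) ((ltac:(by rewrite lerDl) : nrm tmu h <= nrm tmu h + 1)).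
have := le_lt_trans (le_trans H2 H3) H.
by rewrite (ipBl Lg Lf Lh) -/(L2T_inner g h) -/(L2T_inner f h) ltrD2l ltrN2.
Qed.

Variables (d : measure_display) (T : measurableType d) (G0 : set (set T)).

Lemma L2T_inner_Gmeasurable (Z : T -> R -> R) h : L2T_random_variable <<s G0>> Z ->
  L2_torus R h -> Gmeasurable G0 (fun w => L2T_inner (Z w) h).
Proof.
move=> [LZ GZ] Lh B mB; pose f w := L2T_inner (Z w) h.
have : <<s [set A : set R | exists x, A = `]x, +oo[%classic] >> B by move: mB; rewrite /= [X in X B](RGenOInfty.measurableE R).
suff sub : <<s [set A : set R | exists x, A = `]x, +oo[%classic] >> `<=` [set B | <<s G0>> (f @^-1` B)] by exact: sub.
apply: smallest_sub.
  split=> /=.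
  - by rewrite preimage_set0; exact: (@measurable0 _ (g_sigma_algebraType G0)).
  - by move=> A GA; rewrite setTD preimage_setC; exact: (@measurableC _ (g_sigma_algebraType G0)).
  - by move=> A GA; rewrite preimage_bigcup; apply: (@bigcupT_measurable _ (g_sigma_algebraType G0)).
move=> _ [c ->] /=.
have -> : f @^-1` `]c, +oo[ = Z @^-1` [set g | L2T g /\ c < L2T_inner g h].
  apply/seteqP; split=> w; rewrite /= in_itv/= andbT; first by move=> ch; split => //; exact: LZ.
  by case.
by apply: GZ; apply: sub_sigma_algebra; exact: L2T_open_halfspace.
Qed.

Variables (n : nat) (c : 'I_n -> R -> R) (Y : 'I_n -> T -> R).
Hypothesis Lc : forall j, L2_torus R (c j).
Hypothesis GY : forall j, Gmeasurable G0 (Y j).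

(** The combination depends continuously on finitely many real coefficients, so the preimage of an
    open set is the countable union, over boxes with rational centre and radius 1/(k+1) that are
    mapped into it, of the events that the coefficients lie in the box. Separability of L^2(T) is
    not involved. *)
Lemma L2T_random_variable_lincomb :
  L2T_random_variable <<s G0>> (fun w x => \sum_j Y j w * c j x).
Proof.
pose V (y : 'I_n -> R) (x : R) := \sum_j y j * c j x.
have LV y : L2_torus R (V y) by exact: Lfun2_lincomb.
split=> [w|]; first exact: LV.
suff H U : L2T_open U -> <<s G0>> [set w | U (V (Y^~ w))].
  apply: smallest_sub; last by move=> U /H.
  split=> /=.
  - by rewrite preimage_set0; exact: (@measurable0 _ (g_sigma_algebraType G0)).
  - move=> A GA; rewrite (_ : _ @^-1` _ = ~` ((fun w x => \sum_j Y j w * c j x) @^-1` A)).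
      exact: (@measurableC _ (g_sigma_algebraType G0)).
    by apply/seteqP; split=> w /=; [case|move=> nA; split => //; exact: LV].
  - move=> A GA; rewrite preimage_bigcup.
    by apply: (@bigcupT_measurable _ (g_sigma_algebraType G0)).
move=> [UL Uo].
pose box (p : {ffun 'I_n -> rat} * nat) (y : 'I_n -> R) := forall j, `|y j - ratr (p.1 j)| < p.2.+1%:R^-1.
pose good p := forall y, box p y -> U (V y).
pose E p : set T := [set w | good p /\ box p (Y^~ w)].
rewrite (_ : [set w | _] = \bigcup_p E p); last first.
  apply/seteqP; split=> w /=; last by case=> p _ [+ bp]; apply.
  move=> Uw; have [e e0 he] := Uo _ Uw.
  pose S := \sum_j nrm tmu (c j); have S0 : 0 <= S by apply: sumr_ge0 => j _; exact: nrm_ge0.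
  (* Two points of a box differ by at most 2/(k+1) in each coordinate, which moves the combination
     by at most 2 S/(k+1). *)
  have e1 : 0 < e / (2 * S + 1) by rewrite divr_gt0// ltr_wpDl// mulr_ge0.
  have [k _ /(_ k (leqnn k)) /= hk] := near_infty_natSinv_lt (PosNum e1).
  have k0 : 0 < k.+1%:R^-1 :> R by rewrite invr_gt0.
  have /choice[q hq] j : exists q : rat, `|Y j w - ratr q| < k.+1%:R^-1.
    have lt : Y j w - k.+1%:R^-1 < Y j w + k.+1%:R^-1 by rewrite ltrBlDr -addrA ltrDl addr_gt0.
    by have [q] := rat_in_itvoo lt; rewrite in_itv/= => qY; exists q; rewrite distrC ltr_distl.
  have bw : box ([ffun j => q j], k) (Y^~ w) by move=> j /=; rewrite ffunE.
  exists ([ffun j => q j], k) => //; split => // y by_; apply: he; first exact: LV.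
  rewrite (L2T_normE (Lfun2B (LV _) (LV _))) lte_fin.
  rewrite (_ : (fun x => _) = (fun x => \sum_j (Y j w - y j) * c j x)); last first.
    by apply/funext => x; rewrite /V /= -sumrB; apply: eq_bigr => j _; rewrite mulrBl.
  apply: (le_lt_trans (nrm_lincomb Lc _)).
  apply: (@le_lt_trans _ _ (\sum_j (2 * k.+1%:R^-1) * nrm tmu (c j))).
    apply: ler_sum => j _; rewrite ler_wpM2r ?nrm_ge0//.
    have := bw j; have := by_ j; rewrite /= => a b.
    apply: (le_trans (ler_distD (ratr ([ffun j => q j] j)) _ _)).
    by rewrite mulr_natl mulr2n lerD// ltW// distrC.
  rewrite -mulr_sumr -/S; move: hk; rewrite ltr_pdivlMr; last by rewrite ltr_wpDl// mulr_ge0.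
  by apply: le_lt_trans; rewrite mulrDr mulr1 (mulrC 2) -mulrA lerDl ltW.
apply: (@countable_bigcupT_measurable _ (g_sigma_algebraType G0)); first exact: countableP.
move=> p; have [gp|ngp] := pselect (good p); last first.
  rewrite (_ : E p = set0); first exact: (@measurable0 _ (g_sigma_algebraType G0)).
  by apply/seteqP; split=> w // [].
rewrite (_ : E p = \bigcap_(j in [set: 'I_n]) (Y j @^-1` `](ratr (p.1 j) - p.2.+1%:R^-1), (ratr (p.1 j) + p.2.+1%:R^-1)[)); last first.
  apply/seteqP; split=> w /=.
    by move=> [_ bp] j _; have := bp j; rewrite /= in_itv/= ltr_distl.
  by move=> H; split => // j; have := H j Logic.I; rewrite /= in_itv/= ltr_distl.
apply: (@fin_bigcap_measurable _ (g_sigma_algebraType G0)) => // j _.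
by apply: GY; exact: measurable_itv.
Qed.

End TorusL2.

Section ConditionalProjection.
Context d (T : measurableType d) (R : realType) (P : probability T R).
Variable G0 : set (set T).
Hypothesis G0m : <<s G0>> `<=` measurable.
Local Notation tmu := (@torus_mu R).
Local Notation L2P f := (f \in Lfun P 2%:E).
Local Notation L2t f := (L2_torus R f).

Variables (U : R -> T -> R) (C : R).
Hypothesis mU : measurable_fun setT (fun p : measurableTypeR R * T => U p.1 p.2).
Hypothesis LU : forall x, L2P (U x).
Hypothesis nU : forall x, nrm P (U x) <= C.
Hypothesis LX : forall w, L2t (U^~ w).

Variables (n : nat) (c : 'I_n -> R -> R) (B : R) (Y : 'I_n -> T -> R).
Hypothesis mc : forall j, measurable_fun setT (c j).
Hypothesis cB : forall j x, `|c j x| <= B.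
Hypothesis LY : forall j, L2P (Y j).
Hypothesis GY : forall j, Gmeasurable G0 (Y j).

Let X (w : T) (x : R) := U x w.

Definition projection (w : T) (x : R) := \sum_j Y j w * c j x.

Local Notation V := projection.

Hypothesis orthogonal : forall x A, <<s G0>> A ->
  ip P (fun w => U x w - V w x) \1_A = 0.

Let Lc j : L2t (c j).
Proof.
have B0 : 0 <= B by exact: le_trans (cB j 0).
apply: (@Lfun2_dominated _ _ _ _ _ (fun=> B ^+ 2)).
- exact: mc.
- exact: finite_measure_integrable_cst.
- by move=> x; rewrite -real_normK ?num_real// ler_pXn2r ?nnegrE//; exact: cB.
Qed.

Let LV w : L2t (V w). Proof. exact: (Lfun2_lincomb Lc (Y^~ w)). Qed.

Definition residual (x : R) (w : T) := U x w - V w x.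

Let VE x : (fun w => V w x) = (fun w => \sum_j c j x * Y j w).
Proof. by apply/funext => w; apply: eq_bigr => j _; rewrite mulrC. Qed.

Let LVx x : L2P (fun w => V w x).
Proof. by rewrite VE; exact: Lfun2_lincomb. Qed.

Lemma residual_L2 x : L2P (residual x).
Proof. exact: Lfun2B (LU x) (LVx x). Qed.

Lemma residual_nrm x : nrm P (residual x) <= C + \sum_j B * nrm P (Y j).
Proof.
have -> : residual x = (fun w => U x w + (-1) * V w x).
  by apply/funext => w; rewrite mulN1r.
apply: (le_trans (nrmD (LU x) (Lfun2Z _ (LVx x)))).
rewrite lerD// nrmZ// normrN1 mul1r VE.
apply: (le_trans (nrm_lincomb LY _)); apply: ler_sum => j _.
by rewrite ler_wpM2r ?nrm_ge0.
Qed.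

Lemma measurable_residual : measurable_fun setT (fun p : measurableTypeR R * T => residual p.1 p.2).
Proof.
apply: measurable_funB => //; apply: measurable_sum => j; apply: measurable_funM.
  exact: (measurableT_comp (Lfun2_measurable (LY j)) measurable_snd).
exact: (measurableT_comp (mc j) measurable_fst).
Qed.

Lemma mixture_inner h : mixture tmu U h = (fun w => L2T_inner (X w) h).
Proof. by apply/funext => w; rewrite /mixture /L2T_inner; apply: eq_Rintegral => x _; rewrite mulrC. Qed.

Lemma mixture_residual h : L2t h ->
  mixture tmu residual h = (fun w => L2T_inner (X w) h - L2T_inner (V w) h).
Proof.
move=> Lh; apply/funext => w; rewrite -[RHS](ipBl (LX w) (LV w) Lh).
by apply: eq_Rintegral => x _; rewrite mulrC.
Qed.

Lemma inner_L2 h : L2t h -> L2P (fun w => L2T_inner (X w) h).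
Proof. by move=> Lh; rewrite -mixture_inner; exact: (mixture_L2 mU LU nU Lh). Qed.

Lemma residual_inner_L2 h : L2t h -> L2P (fun w => L2T_inner (X w) h - L2T_inner (V w) h).
Proof.
move=> Lh; rewrite -mixture_residual//.
exact: (mixture_L2 measurable_residual residual_L2 residual_nrm Lh).
Qed.

Lemma projection_innerE h w : L2t h ->
  L2T_inner (V w) h = \sum_j L2T_inner (c j) h * Y j w.
Proof.
move=> Lh; rewrite (_ : L2T_inner (V w) h = ip tmu (fun x => \sum_j Y j w * c j x) h)//.
by rewrite (ip_lincombl Lc _ Lh); apply: eq_bigr => j _; rewrite mulrC.
Qed.

Lemma projection_inner_L2 h : L2t h -> L2P (fun w => L2T_inner (V w) h).
Proof.
move=> Lh; rewrite (_ : (fun w => _) = (fun w => \sum_j L2T_inner (c j) h * Y j w)).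
  exact: Lfun2_lincomb.
by apply/funext => w; exact: projection_innerE.
Qed.

(** Orthogonality is known at each point x; Fubini transfers it to the inner products with [h]. *)
Lemma residual_inner_orthogonal h A : L2t h -> <<s G0>> A ->
  ip P (fun w => L2T_inner (X w) h - L2T_inner (V w) h) \1_A = 0.
Proof.
move=> Lh GA; rewrite -mixture_residual//.
rewrite (ip_mixture measurable_residual residual_L2 residual_nrm Lh (indic_L2P P (G0m GA))).
under eq_Rintegral do rewrite orthogonal// mulr0.
by rewrite Rintegral_cst// mul0r.
Qed.

Lemma projection_random_variable : L2T_random_variable <<s G0>> V.
Proof. exact: (L2T_random_variable_lincomb Lc GY). Qed.

Theorem projection_cond_expectation : cond_expectation P <<s G0>> X V.
Proof.
split; first exact: projection_random_variable.
- pose g w := \sum_j nrm tmu (c j) * `|Y j w|.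
  have ig : P.-integrable setT (EFin \o g).
    apply: rint_sum => j _; apply: rintZ; exact: (integrable_norm (Lfun2_rint (LY j))).
  apply: (@le_lt_trans _ _ (\int[P]_w (g w)%:E)%E).
    apply: ge0_le_integral_nonmeasurable => w; first exact: Lnorm_ge0.
    rewrite (L2T_normE (LV w)) lee_fin.
    by apply: (le_trans (nrm_lincomb Lc _)); apply: ler_sum => j _; rewrite mulrC.
  have := integrable_fin_num measurableT ig; rewrite fin_numE => /andP[_].
  by rewrite ltey.
- move=> A h GA Lh; have mA := G0m GA.
  have E := ipBl (inner_L2 Lh) (projection_inner_L2 Lh) (indic_L2P P mA).
  apply/esym/eqP; rewrite -subr_eq0 !(ip_indic _ _ mA); apply/eqP.
  exact: etrans (esym E) (residual_inner_orthogonal Lh GA).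
Qed.

(** Two versions have the same integrals over all events of the sub-sigma-algebra when tested
    against [h], and both inner products are measurable for it. The null set may depend on [h]. *)
Lemma cond_expectation_inner V0 h : cond_expectation P <<s G0>> X V0 -> L2t h ->
  ae_eq P setT (fun w => L2T_inner (V0 w) h) (fun w => L2T_inner (V w) h).
Proof.
move=> [rV0 iV0 eV0] Lh.
have G1 := L2T_inner_Gmeasurable rV0 Lh.
have G2 := L2T_inner_Gmeasurable projection_random_variable Lh.
have m1 := Gmeasurable_measurable G0m G1.
have i1 : P.-integrable setT (EFin \o (fun w => L2T_inner (V0 w) h)).
  pose a := nrm tmu h + 1; have a0 : 0 < a by rewrite ltr_wpDl ?nrm_ge0.
  suff ia : P.-integrable setT (EFin \o (fun w => a^-1 * L2T_inner (V0 w) h)).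
    by have := rintZ a ia; under [X in EFin \o X]eq_fun do rewrite mulVKf ?gt_eqF//.
  apply/integrableP; split; first by apply/measurable_EFinP; exact: measurable_funM.
  have [LV0 _] := rV0; apply: le_lt_trans iV0.
  apply: ge0_le_integral_nonmeasurable => w; first exact: abse_ge0.
  rewrite (L2T_normE (LV0 w)) /= lee_fin normrM gtr0_norm ?invr_gt0// ler_pdivrMl// mulrC.
  apply: (le_trans (ip_abs_le_nrm (LV0 w) Lh)).
  by rewrite ler_wpM2l ?nrm_ge0// lerDl.
have i2 := Lfun2_rint (projection_inner_L2 Lh).
have [_ _ eV] := projection_cond_expectation.
have H : ae_eq P setT (fun w => L2T_inner (V0 w) h - L2T_inner (V w) h) (cst 0).
  apply: (Gmeasurable_ae0 G0m); first exact: rintB.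
    by apply/GmeasurableP; apply: measurable_funB; exact/GmeasurableP.
  move=> A GA; have mA := G0m GA.
  by rewrite RintegralB//; [rewrite eV0// eV// subrr|exact: integrableS i1|exact: integrableS i2].
by apply: filterS H => w /(_ Logic.I)/eqP; rewrite subr_eq0 => /eqP.
Qed.

(** If the right-hand side is infinite the claim is trivial. Otherwise the difference of the two
    errors is square-integrable and measurable for the sub-sigma-algebra, hence orthogonal to the
    error of the projection, and Pythagoras applies. *)
Lemma cond_expectation_inner_optimal Z h : L2T_random_variable <<s G0>> Z -> L2t h ->
  (\int[P]_w ((L2T_inner (X w) h - L2T_inner (V w) h) ^+ 2)%:E <=
   \int[P]_w ((L2T_inner (X w) h - L2T_inner (Z w) h) ^+ 2)%:E)%E.
Proof.
move=> rZ Lh; have G1 := L2T_inner_Gmeasurable rZ Lh.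
have G2 := L2T_inner_Gmeasurable projection_random_variable Lh.
have LR := residual_inner_L2 Lh; have LI := inner_L2 Lh.
have m1 := Gmeasurable_measurable G0m G1.
set f := fun w => L2T_inner (X w) h - L2T_inner (V w) h in LR *.
pose g w := L2T_inner (X w) h - L2T_inner (Z w) h; rewrite -/(g _).
have mg : measurable_fun setT g by apply: measurable_funB => //; exact: (Lfun2_measurable LI).
have [/eqP goo|] := boolP ((\int[P]_w ((g w) ^+ 2)%:E)%E == +oo%E); first by rewrite goo leey.
rewrite -ltey => gfin.
have Lg : L2P g.
  apply/Lfun2P; split => //; apply/integrableP; split; first exact/measurable_EFinP/measurable_funX.
  by under eq_integral do rewrite /= ger0_norm ?sqr_ge0//.
pose D w := g w - f w.
have LD : L2P D by exact: Lfun2B.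
have GD : Gmeasurable G0 D.
  apply/GmeasurableP; have -> : D = (fun w => L2T_inner (V w) h - L2T_inner (Z w) h).
    by apply/funext => w; rewrite /D /g /f; ring.
  by apply: measurable_funB; [exact: (GmeasurableP _ _).1 G2|exact: (GmeasurableP _ _).1 G1].
have fD : ip P f D = 0.
  by apply: (Gorthogonal G0m LR LD GD) => A GA; exact: residual_inner_orthogonal.
rewrite (ip_integral LR) (ip_integral Lg) lee_fin.
have -> : g = (fun w => f w + D w) by apply/funext => w; rewrite /D subrKC.
by rewrite ip_sqrD// fD mulr0 addr0 lerDl ip_ge0.
Qed.

End ConditionalProjection.

(** * Distances in L^2 through cell averages *)

Section Bessel.
Context d (T : measurableType d) (R : realType) (mu : {measure set T -> \bar R}).
Variables (n : nat) (psi : 'I_n -> T -> R) (r : 'I_n -> R).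
Hypothesis Lpsi : forall i, psi i \in Lfun mu 2%:E.
Hypothesis r0 : forall i, 0 < r i.
Hypothesis orth : forall i j, ip mu (psi i) (psi j) = if i == j then r i else 0.

Lemma ip_orthogonal_sum (b : 'I_n -> R) :
  let p := fun x => \sum_i b i * psi i x in ip mu p p = \sum_i b i ^+ 2 * r i.
Proof.
have Lp := Lfun2_lincomb Lpsi b.
rewrite /= (ip_lincombl Lpsi _ Lp); apply: eq_bigr => i _.
rewrite (ip_lincombr Lpsi _ (Lpsi i)) (bigD1 i)//= orth eqxx big1 ?addr0 ?mulrA ?expr2// => j ji.
by rewrite orth eq_sym (negPf ji) mulr0.
Qed.

Lemma bessel g : g \in Lfun mu 2%:E ->
  \sum_i ip mu g (psi i) ^+ 2 / r i <= ip mu g g.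
Proof.
move=> Lg; pose b i := ip mu g (psi i) / r i.
have Lp := Lfun2_lincomb Lpsi b.
have := ip_ge0 mu (fun x => g x - \sum_i b i * psi i x).
rewrite (ipBl Lg Lp (Lfun2B Lg Lp)) (ipBr Lg Lp Lg) (ipBr Lg Lp Lp) (ip_orthogonal_sum b).
rewrite [ip mu (fun x => \sum_i b i * psi i x) g]ipC (ip_lincombr Lpsi _ Lg).
have -> : \sum_i b i * ip mu g (psi i) = \sum_i ip mu g (psi i) ^+ 2 / r i.
  by apply: eq_bigr => i _; rewrite /b mulrAC expr2.
have -> : \sum_i b i ^+ 2 * r i = \sum_i ip mu g (psi i) ^+ 2 / r i.
  by apply: eq_bigr => i _; rewrite /b exprMn exprVn -mulrA expr2 invfM mulfVK ?gt_eqF.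
by rewrite subrr subr0 subr_ge0.
Qed.

End Bessel.

Section TorusCells.
Variable R : realType.
Local Notation tmu := (@torus_mu R).
Local Notation leb := (@lebesgue_measure R).
Implicit Types (g : R -> R) (x : R) (m n : nat).

Definition grid_cell (m : nat) (k : int) : set R :=
  `[k%:~R / m.+1%:R, (k + 1)%:~R / m.+1%:R[%classic.

Lemma measurable_grid_cell m k : measurable (grid_cell m k).
Proof. exact: measurable_itv. Qed.

Lemma grid_cell_floor m k x : grid_cell m k x <-> k = Num.floor (m.+1%:R * x).
Proof.
have m0 : 0 < m.+1%:R :> R by rewrite ltr0n.
rewrite /grid_cell/= in_itv/= ler_pdivrMr// ltr_pdivlMr// mulrC.
split=> [H|->]; first by apply/esym/floor_def.
by rewrite floor_le_tmp/= floorD1_gt.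
Qed.

Lemma grid_cell_measure m k : leb (grid_cell m k) = (m.+1%:R^-1)%:E.
Proof.
have m0 : 0 < m.+1%:R :> R by rewrite ltr0n.
rewrite /grid_cell lebesgue_measure_itv/= lte_fin ltr_pM2r ?invr_gt0// ltr_int ltzD1 lexx.
by rewrite -EFinB -mulrBl -intrB addrC addKr mul1r.
Qed.

Definition floor_cell x m := grid_cell m (Num.floor (m.+1%:R * x)).

(** The point x is not the centre of its cell, so the differentiation theorem is used for sets
    comparable to balls. *)
Lemma floor_cell_nicely_shrinking x : nicely_shrinking x (floor_cell x).
Proof.
split=> [n|]; first exact: measurable_grid_cell.
have p n : 0 < 2 / n.+1%:R :> R by rewrite divr_gt0.
(* A cell of length 1/(n+1) containing x lies in the ball of radius 2/(n+1), whose measure is four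
   times as large. *)
exists (4, fun n => PosNum (p n)); split => //=.
- rewrite -[X in _ --> X](mulr0 2); apply: cvgM; first exact: cvg_cst.
  exact: cvg_harmonic.
- move=> n y /=; rewrite /floor_cell/grid_cell/= in_itv/= => /andP[y1 y2].
  have := (grid_cell_floor n _ x).2 erefl; rewrite /grid_cell/= in_itv/= => /andP[x1 x2].
  rewrite ball_itv/= in_itv/=.
  move: x2 y2; rewrite intrD mulrDl -[1%:~R / _]/(1 / n.+1%:R) div1r => x2 y2.
  have n0 : 0 < n.+1%:R^-1 :> R by rewrite invr_gt0.
  set a := _%:~R / _ in x1 x2 y1 y2 *; set b := n.+1%:R^-1 in x2 y2 n0 *; clearbody a b.
  by apply/andP; split; lra.
- move=> n; rewrite /floor_cell grid_cell_measure (lebesgue_measure_ball x (ltW (p n))).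
  rewrite -(EFinM 4) lee_fin.
  by rewrite mulr2n -mulrDl -natrD.
Qed.

Lemma torus_rint_integral g (E : set R) : measurable E -> measurable_fun setT g ->
  \int[tmu]_y (g y * \1_E y) = \int[leb]_(y in E) (g \_ (@torus_dom R)) y.
Proof.
move=> mE mg; rewrite Rintegral_mrestr; last exact: measurable_funM.
rewrite Rintegral_mkcond [RHS]Rintegral_mkcond; apply: eq_Rintegral => y _.
rewrite !patchE indicE; case: (y \in E); case: (y \in _) => //; by rewrite ?mulr1 ?mulr0.
Qed.

Lemma torus_ae (Q : R -> Prop) :
  {ae leb, forall x, torus_dom x -> Q x} -> {ae tmu, forall x, Q x}.
Proof.
move=> [N [mN N0 sub]]; have mD := @measurable_torus_dom R.
exists (N `|` ~` @torus_dom R); split.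
- by apply: measurableU => //; exact: measurableC.
- apply/eqP; rewrite eq_le measure_ge0 andbT -[leRHS]N0.
  apply: (le_measure leb); rewrite ?inE.
  + by apply: measurableI => //; apply: measurableU => //; exact: measurableC.
  + exact: mN.
  + by move=> x [[]].
- move=> x nQ; have [dx|ndx] := pselect (torus_dom x); last by right.
  by left; apply: sub => H; apply: nQ; exact: H.
Qed.

Lemma torus_cell_cvg g : L2_torus R g ->
  {ae tmu, forall x, torus_dom x /\
    (n.+1%:R * ip tmu g \1_(floor_cell x n) @[n --> \oo] --> g x)}.
Proof.
move=> Lg; have mg := Lfun2_measurable Lg; have ig := Lfun2_rint Lg.
have igD : leb.-integrable (@torus_dom R) (EFin \o g).
  apply/integrableP; split; first by apply/measurable_EFinP; exact: measurable_funTS.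
  have /integrableP[_] := ig; rewrite integral_mrestr//.
  by apply: measurableT_comp => //; exact/measurable_EFinP.
have lg := integrable_locally (@measurable_torus_dom R) igD.
have [N [mN N0 sub]] := lebesgue_differentiation lg.
apply: torus_ae; exists N; split => // x nQ; apply: sub => px; apply: nQ => dx; split => //.
have := nice_lebesgue_differentiation floor_cell_nicely_shrinking lg px.
rewrite [(g \_ _) x]patchE mem_set//.
have E n : ((leb (floor_cell x n))^-1 * \int[leb]_(y in floor_cell x n) ((g \_ (@torus_dom R)) y)%:E)%E =
    (n.+1%:R * ip tmu g \1_(floor_cell x n))%:E.
  have m0 : 0 < n.+1%:R :> R by rewrite ltr0n.
  have mc := measurable_grid_cell n (Num.floor (n.+1%:R * x)).
  rewrite grid_cell_measure inver invr_eq0 gt_eqF// invrK EFinM; congr (_ * _)%E.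
  rewrite /ip (torus_rint_integral mc mg) fineK//.
  apply: integrable_fin_num => //; apply: integrableS (_ : leb.-integrable setT _) => //.
  by have := (@integrable_mkcond _ (measurableTypeR R) R leb _ (EFin \o g) (@measurable_torus_dom R)).1 igD; rewrite restrict_EFin; exact.
rewrite (funext E) => /fine_cvg; exact.
Qed.

(** The squared norm of the projection of [g] onto the functions constant on the m + 1 cells,
    expressed by inner products alone. *)
Definition cell_sum m g := \sum_(j < m.+1) m.+1%:R * ip tmu g \1_(grid_cell m j%:Z) ^+ 2.

Lemma indic_L2t E : measurable E -> L2_torus R (\1_E : R -> R).
Proof. exact: (@indic_L2P _ _ _ (@torus_mu R)). Qed.

Lemma grid_cell_orth m (i j : 'I_m.+1) :
  ip tmu \1_(grid_cell m i%:Z) \1_(grid_cell m j%:Z) = if i == j then m.+1%:R^-1 else 0.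
Proof.
have m0 : 0 < m.+1%:R :> R by rewrite ltr0n.
case: eqP => [<-|ij]; last first.
  have E y : \1_(grid_cell m i%:Z) y * \1_(grid_cell m j%:Z) y = 0 :> R.
    rewrite !indicE; have [/set_mem/grid_cell_floor yi|] := boolP (y \in _); last by rewrite mul0r.
    rewrite mul1r memNset//= => /grid_cell_floor; rewrite -yi => -[] ji.
    by apply: ij; apply/val_inj.
  by rewrite /ip; under eq_Rintegral do rewrite E; rewrite Rintegral_cst// mul0r.
have mc := measurable_grid_cell m i%:Z.
have E y : \1_(grid_cell m i%:Z) y * \1_(grid_cell m i%:Z) y = \1_(grid_cell m i%:Z) y :> R.
  by rewrite indicE; case: (_ \in _); rewrite ?mulr1// mulr0.
rewrite /ip; under eq_Rintegral do rewrite E.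
rewrite /Rintegral integral_indic// setIT.
rewrite [X in fine X](_ : _ = leb (grid_cell m i%:Z `&` @torus_dom R))//.
have -> : grid_cell m i%:Z `&` torus_dom = grid_cell m i%:Z.
  apply/setIidPl => y; rewrite /grid_cell /torus_dom /= !in_itv/= => /andP[y1 y2]; apply/andP; split.
    by apply: le_trans y1; rewrite divr_ge0.
  apply: (lt_le_trans y2); rewrite ler_pdivrMr// mul1r.
  by rewrite intrD -[1%:~R]/(1 : R) -pmulrn natr1 ler_nat.
rewrite grid_cell_measure//.
Qed.

Lemma cell_sum_bessel m g : L2_torus R g -> cell_sum m g <= ip tmu g g.
Proof.
move=> Lg; have m0 : 0 < m.+1%:R^-1 :> R by rewrite invr_gt0 ltr0n.
have := @bessel _ (measurableTypeR R) R tmu m.+1 (fun j => \1_(grid_cell m j%:Z)) (fun=> m.+1%:R^-1)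
  (fun j => indic_L2t (measurable_grid_cell m j%:Z)) (fun=> m0) (grid_cell_orth (m := m)) g Lg.
by apply: le_trans; rewrite le_eqVlt; apply/orP; left; apply/eqP; apply: eq_bigr => j _; rewrite invrK mulrC.
Qed.

(** The averages over the cells around x converge to g(x) almost everywhere by Lebesgue
    differentiation, and Fatou's lemma applies to their squares. Together with [cell_sum_bessel]
    this recovers the norm. *)
Lemma le_limn_cell_sum g : L2_torus R g ->
  ((ip tmu g g)%:E <= limn_einf (fun m => (cell_sum m g)%:E))%E.
Proof.
move=> Lg; pose p m x := \sum_(j < m.+1) (m.+1%:R * ip tmu g \1_(grid_cell m j%:Z)) * \1_(grid_cell m j%:Z) x.
have Li m (j : 'I_m.+1) := indic_L2t (measurable_grid_cell m j%:Z).
have Lp m : L2_torus R (p m) by exact: Lfun2_lincomb (Li m) _.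
have pp m : ip tmu (p m) (p m) = cell_sum m g.
  have m0 : 0 < m.+1%:R^-1 :> R by rewrite invr_gt0 ltr0n.
  rewrite (ip_orthogonal_sum (Li m) (@grid_cell_orth m)); apply: eq_bigr => j _.
  by rewrite exprMn expr2 mulrAC mulfK ?pnatr_eq0// mulrC.
have pE m x : torus_dom x -> p m x = m.+1%:R * ip tmu g \1_(floor_cell x m).
  rewrite /torus_dom/= in_itv/= => /andP[x0 x1].
  have m0 : 0 < m.+1%:R :> R by rewrite ltr0n.
  have f0 : 0 <= Num.floor (m.+1%:R * x) by rewrite floor_ge0 mulr_ge0.
  have fm : (`|Num.floor (m.+1%:R * x)| < m.+1)%N.
    rewrite -ltz_nat gez0_abs// floor_lt_int -pmulrn.
    by rewrite -[ltRHS]mulr1 ltr_pM2l.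
  rewrite /p (bigD1 (Ordinal fm))//= gez0_abs// -/(floor_cell x m) big1 ?addr0.
    by rewrite indicE mem_set ?mulr1//; apply/grid_cell_floor.
  move=> j jf; rewrite indicE memNset ?mulr0// => /grid_cell_floor jE.
  by move: jf; rewrite -val_eqE/= -jE absz_nat eqxx.
have cp : ae_eq tmu setT (fun x => (g x ^+ 2)%:E) (fun x => limn_einf (fun m => (p m x ^+ 2)%:E)).
  have [N [mN N0 sub]] := torus_cell_cvg Lg.
  exists N; split => // x nQ; apply: sub => -[dx cx]; apply: nQ => _.
  have c1 : p m x @[m --> \oo] --> g x by rewrite (funext (fun m => pE m x dx)).
  have c2 : (p m x ^+ 2)%:E @[m --> \oo] --> (g x ^+ 2)%:E.
    by apply: cvg_EFin; [exact: nearW|exact: (cvgM c1 c1)].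
  by rewrite (cvg_limn_einf_sup c2).1.
rewrite -(ip_integral Lg).
have mp m : measurable_fun setT (fun x => (p m x ^+ 2)%:E).
  by apply/measurable_EFinP/measurable_funX; exact: (Lfun2_measurable (Lp m)).
have F := @fatou _ (measurableTypeR R) R tmu setT measurableT (fun m x => (p m x ^+ 2)%:E) mp
  (fun m x _ => ltac:(by rewrite lee_fin sqr_ge0)).
rewrite (ae_eq_integral _ _ _ _ _ cp)//; last 2 first.
- by apply/measurable_EFinP/measurable_funX; exact: (Lfun2_measurable Lg).
- apply: (emeasurable_fun_cvg (fun m x => einfs (fun m => (p m x ^+ 2)%:E) m)).
    exact: measurable_fun_einfs.
  by move=> x _; rewrite limn_einf_lim; exact: is_cvg_einfs.
apply: (le_trans F); under eq_fun do rewrite (ip_integral (Lp _)) pp.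
by [].
Qed.

End TorusCells.

Lemma le_poweR_half (R : realType) (x y : \bar R) :
  (0 <= x -> x <= y -> x `^ 2^-1 <= y `^ 2^-1)%E.
Proof.
move=> x0 xy; apply: gt0_ler_poweR => //; rewrite in_itv/= leey andbT//.
exact: le_trans xy.
Qed.

Section L2Distance.
Context d (T : measurableType d) (R : realType) (P : probability T R).
Local Notation tmu := (@torus_mu R).
Local Notation L2t f := (L2_torus R f).
Variables (X : T -> R -> R).
Hypothesis LX : forall w, L2t (X w).
Hypothesis mX : forall h, L2t h -> measurable_fun setT (fun w => L2T_inner (X w) h).

Definition sq_dist (Z : T -> R -> R) (w : T) : R :=
  ip tmu (fun x => X w x - Z w x) (fun x => X w x - Z w x).

Definition inner_diff (Z : T -> R -> R) (h : R -> R) (w : T) : R :=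
  L2T_inner (X w) h - L2T_inner (Z w) h.

Lemma L2_distanceE Z : (forall w, L2t (Z w)) ->
  L2_distance P X Z = ((\int[P]_w (sq_dist Z w)%:E) `^ 2^-1)%E.
Proof.
move=> LZ; rewrite /L2_distance unlock /Lnorm; congr (_ `^ _)%E.
apply: eq_integral => w _.
have LB := Lfun2B (LX w) (LZ w); rewrite (L2T_normE LB) /=.
rewrite ger0_norm ?nrm_ge0// powR_mulrn ?nrm_ge0// nrm_sqr.
by [].
Qed.

Lemma inner_diffE Z h w : L2t (Z w) -> L2t h ->
  ip tmu (fun x => X w x - Z w x) h = inner_diff Z h w.
Proof. by move=> LZ Lh; rewrite (ipBl (LX w) LZ Lh). Qed.

Lemma integral_cell_sum Z m : (forall w, L2t (Z w)) ->
  (forall h, L2t h -> measurable_fun setT (fun w => L2T_inner (Z w) h)) ->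
  measurable_fun setT (fun w => (cell_sum m (fun x => X w x - Z w x))%:E) /\
  (\int[P]_w (cell_sum m (fun x => X w x - Z w x))%:E =
   \sum_(j < m.+1) (m.+1%:R)%:E *
     \int[P]_w ((inner_diff Z \1_(grid_cell m j%:Z) w) ^+ 2)%:E)%E.
Proof.
move=> LZ mZ.
have Li (j : 'I_m.+1) : L2t \1_(grid_cell m j%:Z) := indic_L2t (measurable_grid_cell m j%:Z).
pose q (j : 'I_m.+1) w := inner_diff Z \1_(grid_cell m j%:Z) w ^+ 2.
have mq j : measurable_fun setT (q j).
  by apply: measurable_funX; apply: measurable_funB; [exact: (mX (Li j))|exact: (mZ _ (Li j))].
have E w : (cell_sum m (fun x => X w x - Z w x))%:E = (\sum_(j < m.+1) (m.+1%:R)%:E * (q j w)%:E)%E.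
  rewrite /cell_sum -sumEFin; apply: eq_bigr => j _.
  by rewrite -EFinM (inner_diffE (LZ w) (Li j)).
have mE j : measurable_fun setT (fun w => (m.+1%:R)%:E * (q j w)%:E)%E.
  by apply: measurable_funeM; exact/measurable_EFinP.
split; first by under eq_fun do rewrite E; apply: emeasurable_sum.
under eq_integral do rewrite E.
rewrite ge0_integral_sum//; last by move=> j w _; rewrite -EFinM lee_fin mulr_ge0// sqr_ge0.
apply: eq_bigr => j _; rewrite ge0_integralZl//.
- exact/measurable_EFinP.
- by move=> w _; rewrite lee_fin sqr_ge0.
Qed.

(** The integral of ||X - V||^2 is at most that of the lower limit of the cell sums, hence by Fatou
    at most the lower limit of their integrals. Each of these is a combination of squared inner
    errors, so it is at most the one for [Z], which Bessel bounds by the integral of ||X - Z||^2.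
    Only the cell sums need to be measurable in w. *)
Theorem L2_distance_le V Z : (forall w, L2t (V w)) -> (forall w, L2t (Z w)) ->
  (forall h, L2t h -> measurable_fun setT (fun w => L2T_inner (V w) h)) ->
  (forall h, L2t h -> measurable_fun setT (fun w => L2T_inner (Z w) h)) ->
  (forall h, L2t h -> (\int[P]_w ((inner_diff V h w) ^+ 2)%:E <=
                       \int[P]_w ((inner_diff Z h w) ^+ 2)%:E)%E) ->
  (L2_distance P X V <= L2_distance P X Z)%E.
Proof.
move=> LV LZ mV mZ VZ; rewrite (L2_distanceE LV) (L2_distanceE LZ).
have i0 W : (0 <= \int[P]_w (sq_dist W w)%:E)%E.
  by apply: integral_ge0 => w _; rewrite lee_fin ip_ge0.
apply: (le_poweR_half (i0 V)).
apply: (@le_trans _ _ (\int[P]_w limn_einf (fun m => (cell_sum m (fun x => X w x - V w x))%:E))%E).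
  apply: ge0_le_integral_nonmeasurable => w; first by rewrite lee_fin ip_ge0.
  exact: le_limn_cell_sum (Lfun2B (LX w) (LV w)).
have c0 m (g : R -> R) : 0 <= cell_sum m g by apply: sumr_ge0 => j _; rewrite mulr_ge0// sqr_ge0.
apply: (le_trans (@fatou _ _ _ P setT measurableT (fun m w => (cell_sum m (fun x => X w x - V w x))%:E) _ _)).
- by move=> m; have [] := integral_cell_sum m LV mV.
- by move=> m w _; rewrite lee_fin.
rewrite limn_einf_lim; apply: lime_le; first exact: is_cvg_einfs.
apply: nearW => m; apply: ereal_inf_le.
exists (\int[P]_w (cell_sum m (fun x => X w x - V w x))%:E)%E; first by exists m => //=.
have [_ ->] := integral_cell_sum m LV mV.
apply: (@le_trans _ _ (\int[P]_w (cell_sum m (fun x => X w x - Z w x))%:E)%E).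
  have [_ ->] := integral_cell_sum m LZ mZ; apply: lee_sum => j _.
  apply: lee_wpmul2l; first by rewrite lee_fin.
  by apply: VZ; exact: indic_L2t (measurable_grid_cell m j%:Z).
apply: ge0_le_integral_nonmeasurable => w; first by rewrite lee_fin.
by rewrite lee_fin; exact: cell_sum_bessel (Lfun2B (LX w) (LZ w)).
Qed.

(** Bessel's inequality in x at each w, integrated term by term; [l i] is a lower bound for the
    error in the direction [h i], whose squared norm is [r i]. *)
Lemma L2_distance_bessel V k (h : 'I_k -> R -> R) (r l : 'I_k -> R) (c : R) :
  (forall w, L2t (V w)) ->
  (forall f, L2t f -> measurable_fun setT (fun w => L2T_inner (V w) f)) ->
  (forall i, L2t (h i)) -> (forall i, 0 < r i) ->
  (forall i j, ip tmu (h i) (h j) = if i == j then r i else 0) ->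
  (forall i, ((l i)%:E <= \int[P]_w ((inner_diff V (h i) w) ^+ 2)%:E)%E) ->
  0 <= c -> c ^+ 2 <= \sum_i l i / r i ->
  (c%:E <= L2_distance P X V)%E.
Proof.
move=> LV mV Lh r0 orth hl c0 cl; rewrite (L2_distanceE LV).
have i0 : (0 <= \int[P]_w (sq_dist V w)%:E)%E.
  by apply: integral_ge0 => w _; rewrite lee_fin ip_ge0.
suff H : ((c ^+ 2)%:E <= \int[P]_w (sq_dist V w)%:E)%E.
  have -> : c%:E = ((c ^+ 2)%:E `^ 2^-1)%E.
    by rewrite poweR_EFin -powR_mulrn// -powRrM mulfV// powRr1.
  by apply: le_poweR_half => //; rewrite lee_fin sqr_ge0.
apply: (@le_trans _ _ (\sum_i l i / r i)%:E); first by rewrite lee_fin.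
have mq i : measurable_fun setT (fun w => inner_diff V (h i) w ^+ 2).
  by apply: measurable_funX; apply: measurable_funB; [exact: mX|exact: mV].
apply: (@le_trans _ _ (\int[P]_w (\sum_i (inner_diff V (h i) w ^+ 2) / r i)%:E)%E); last first.
  apply: ge0_le_integral_nonmeasurable => w.
    by rewrite lee_fin sumr_ge0// => i _; rewrite divr_ge0 ?sqr_ge0// ltW.
  rewrite lee_fin; have := bessel Lh r0 orth (Lfun2B (LX w) (LV w)).
  by apply: le_trans; rewrite le_eqVlt; apply/orP; left; apply/eqP; apply: eq_bigr => i _; rewrite inner_diffE.
under eq_integral do rewrite -sumEFin.
rewrite ge0_integral_sum//; last first.
- by move=> i w _; rewrite lee_fin divr_ge0 ?sqr_ge0// ltW.
- by move=> i; apply/measurable_EFinP; exact: measurable_funM.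
rewrite -sumEFin; apply: lee_sum => i _.
under eq_integral do rewrite EFinM muleC.
rewrite ge0_integralZl//; last 3 first.
- exact/measurable_EFinP.
- by move=> w _; rewrite lee_fin sqr_ge0.
- by rewrite lee_fin invr_ge0 ltW.
rewrite EFinM muleC; apply: lee_wpmul2l => //.
by rewrite lee_fin invr_ge0 ltW.
Qed.

End L2Distance.

(** * The observed Fourier modes *)

Section FourierModes.
Context {R : realType} {d : measure_display} {Omega : measurableType d}.
Variable P : probability Omega R.
Variables (xi : set (R * R) -> Omega -> R) (I : (R * R -> R) -> Omega -> R).
Variable O : R -> Omega -> R -> R.
Hypotheses (HI : stochastic_integral P xi I) (HO : stochastic_convolution P I O).
Local Notation smu := (@spacetime_mu R).
Local Notation tmu := (@torus_mu R).
Local Notation S := (measurableTypeR R * measurableTypeR R)%type.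

(** The real part ([b] true) or imaginary part of e^{-2 pi i n y}. *)
Definition fourier_weight (n : int) (b : bool) (y : R) : R :=
  if b then cos (2 * pi * (- n)%:~R * y) else sin (2 * pi * (- n)%:~R * y).

(** Written as a mixture, so that stochastic Fubini identifies the observed mode with the Wiener
    integral of [fourier_kernel]. *)
Definition fourier_mode (t : R) (n : int) (b : bool) : Omega -> R :=
  mixture tmu (fun y => ofield O (t, y)) (fourier_weight n b).

Definition fourier_kernel (t : R) (n : int) (b : bool) : R * R -> R :=
  mixture tmu (fun y => kfield (t, y)) (fourier_weight n b).

Lemma fourier_weight_norm n b y : `|fourier_weight n b y| <= 1.
Proof.
rewrite /fourier_weight; case: b; first by rewrite ler_norml cos_geN1 cos_le1.
exact: sin_max.
Qed.

Lemma measurable_fourier_weight n b : measurable_fun setT (fourier_weight n b).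
Proof.
apply: continuous_measurable_fun => y; rewrite /fourier_weight; case: b.
  by apply: continuous_comp; [exact: mulrl_continuous|exact: continuous_cos].
by apply: continuous_comp; [exact: mulrl_continuous|exact: continuous_sin].
Qed.

Lemma torus_bounded_L2 (f : R -> R) (c : R) : measurable_fun setT f ->
  (forall y, `|f y| <= c) -> L2_torus R f.
Proof.
move=> mf fc; have c0 : 0 <= c by exact: le_trans (fc 0).
apply: (@Lfun2_dominated _ _ _ _ _ (fun=> c ^+ 2)).
- exact: mf.
- exact: finite_measure_integrable_cst.
- by move=> y; rewrite -real_normK ?num_real// ler_pXn2r ?nnegrE//; exact: fc.
Qed.

Lemma fourier_weight_L2 n b : L2_torus R (fourier_weight n b).
Proof. exact: torus_bounded_L2 (measurable_fourier_weight n b) (fourier_weight_norm n b). Qed.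

Lemma measurable_kfield_slice (t : R) :
  measurable_fun setT (fun p : measurableTypeR R * S => kfield (t, p.1) p.2).
Proof.
have m : measurable_fun setT (fun p : measurableTypeR R * S => ((t, p.1), p.2) : S * S).
  apply/measurable_fun_pair => //=; apply/measurable_fun_pair => //=; exact: measurable_fst.
exact: (measurableT_comp (@measurable_kfield R) m).
Qed.

Lemma measurable_ofield_slice (t : R) :
  measurable_fun setT (fun p : measurableTypeR R * Omega => ofield O (t, p.1) p.2).
Proof.
have m : measurable_fun setT (fun p : measurableTypeR R * Omega => ((t, p.1), p.2) : S * Omega).
  apply/measurable_fun_pair => //=; apply/measurable_fun_pair => //=; exact: measurable_fst.
exact: (measurableT_comp (measurable_ofield HO) m).
Qed.

Let Lk (t : R) y := @kfield_L2 R (t, y).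
Let nk (t : R) y := @kfield_nrm R (t, y).

Lemma fourier_kernel_L2 t n b : L2_spacetime R (fourier_kernel t n b).
Proof.
exact: (@mixture_L2 _ _ (measurableTypeR R) S R tmu smu _ _ _
  (measurable_kfield_slice t) (Lk t) (nk t) (fourier_weight_L2 n b)).
Qed.

Lemma fourier_mode_L2 t n b : fourier_mode t n b \in Lfun P 2%:E.
Proof.
exact: (field_mixture_L2 HI (S := measurableTypeR R) (nu := tmu) (Lk t) (nk t)
  (fourier_weight_L2 n b) (measurable_ofield_slice t) (fun y => ofield_kfield HO (t, y))).
Qed.

Lemma fourier_mode_gaussian t n b :
  ae_eq P setT (fourier_mode t n b) (I (fourier_kernel t n b)).
Proof.
exact: (stochastic_fubini HI (S := measurableTypeR R) (nu := tmu) (measurable_kfield_slice t)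
  (Lk t) (nk t) (fourier_weight_L2 n b) (measurable_ofield_slice t)
  (fun y => ofield_kfield HO (t, y))).
Qed.

Lemma fourier_modeE t n w : 0 <= t <= 1 ->
  complex.Re (fourier (O t w) n) = fourier_mode t n true w /\
  complex.Im (fourier (O t w) n) = fourier_mode t n false w.
Proof.
move=> t01; have [_ _ pO] := HO; have [cO _ _] := pO w.
have mO : measurable_fun setT (O t w).
  by apply: continuous_measurable_fun; apply: cO; rewrite in_itv.
have mo : measurable_fun setT (fun y : R => ofield O (t, y) w).
  exact: (measurable_section t (measurable_vfield (pO w))).
have E b : \int[tmu]_y (fourier_weight n b y * O t w y) = fourier_mode t n b w.
  have mw := measurable_fourier_weight n b.
  apply: torus_eq_Rintegral; [exact: measurable_funM|exact: measurable_funM|].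
  by move=> y y01; rewrite /ofield (@vfield_dom R (fun t => O t w)).
rewrite -!E /fourier /cintegral /=; split; apply: eq_Rintegral => y _ /=.
  by rewrite mulr0 subr0.
by rewrite mulr0 add0r.
Qed.

Lemma ip_fourier_kernel t n b l (chi : R -> R) (c : R) : 0 <= t <= 1 ->
  measurable_fun setT chi -> (forall s, `|chi s| <= c) ->
  ip smu (fourier_kernel t n b) (fun z => chi z.1 * cosn l z.2) =
  (\int[unit_mu]_s (chi s * (if s < t then expR (- (lam l * (t - s))) else 0))) *
  \int[tmu]_y (fourier_weight n b y * cosn l y).
Proof.
move=> t01 mchi chic.
pose a := \int[unit_mu]_s (chi s * (if s < t then expR (- (lam l * (t - s))) else 0)).
have [Lz _] := kernel_pairing l 0 mchi chic t01.
have := @ip_mixture _ _ (measurableTypeR R) S R tmu smu _ _ _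
  (measurable_kfield_slice t) (Lk t) (nk t) (fourier_weight_L2 n b) _ Lz.
rewrite /fourier_kernel => ->; rewrite -/a.
have mw := measurable_fourier_weight n b; have mc := @measurable_cosn R l.
have iw : tmu.-integrable setT (EFin \o (fun y => fourier_weight n b y * cosn l y)).
  apply: (@torus_bounded_integrable _ (1 * 1)); first exact: measurable_funM.
  by move=> y; rewrite normrM ler_pM ?fourier_weight_norm ?cosn_norm.
rewrite -(RintegralZl _ measurableT iw).
transitivity (\int[tmu]_y (a * (fourier_weight n b y * cosn l (clamp y)))).
  apply: eq_Rintegral => y _.
  have [_ E] := kernel_pairing l (clamp y) mchi chic t01.
  by rewrite ipC /kfield /= clamp_id// [X in _ * X]E -/a; ring.
apply: torus_eq_Rintegral.
- apply: measurable_funM => //; apply: measurable_funM => //.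
  exact: (measurableT_comp mc (@measurable_clamp R)).
- by apply: measurable_funM => //; exact: measurable_funM.
- by move=> y /andP[y0 /ltW y1]; rewrite clamp_id// y0.
Qed.

(** With the sine written as a cosine of phase -pi/2, both parts reduce to the frequencies -n + l
    and -n - l, nonzero for |n| < l. This makes every observed kernel orthogonal to the high modes,
    whatever the factor in time. *)
Lemma fourier_weight_cosn n b l : (`|n| < l)%N ->
  \int[tmu]_y (fourier_weight n b y * cosn l y) = 0.
Proof.
move=> nl.
have I0 (m : int) (c : R) : tmu.-integrable setT (EFin \o (fun y => 2^-1 * cos (2 * pi * m%:~R * y + c))).
  apply: rintZ; apply: (@torus_bounded_integrable _ 1) => [|y]; last by rewrite ler_norml cos_geN1 cos_le1.
  apply: continuous_measurable_fun => y.
  by apply: continuous_comp; [exact: continuous_affine|exact: continuous_cos].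
pose p : R := if b then 0 else - (pi / 2).
have E y : fourier_weight n b y * cosn l y =
    2^-1 * cos (2 * pi * (- n + l%:Z)%:~R * y + p) + 2^-1 * cos (2 * pi * (- n - l%:Z)%:~R * y + p).
  rewrite /fourier_weight /cosn /p; set u := 2 * pi * (- n)%:~R * y; set v := 2 * pi * l%:R * y.
  have -> : 2 * pi * (- n + l%:Z)%:~R * y = u + v by rewrite intrD -pmulrn /u /v; ring.
  have -> : 2 * pi * (- n - l%:Z)%:~R * y = u - v by rewrite intrB -pmulrn /u /v; ring.
  case: (b); first by rewrite !addr0 cosD cosB; field.
  have h z : cos (z + - (pi / 2)) = sin z :> R by rewrite cosB cos_pihalf sin_pihalf mulr0 add0r mulr1.
  by rewrite !h sinD sinB; field.
under eq_Rintegral do rewrite E.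
rewrite (RintegralD measurableT (I0 _ _) (I0 _ _)).
have z (m : int) (c : R) : m != 0 -> \int[tmu]_y (2^-1 * cos (2 * pi * m%:~R * y + c)) = 0.
  move=> m0; rewrite RintegralZl//; first by rewrite torus_cos_int ?mulr0.
  by have := rintZ 2 (I0 m c); under [X in EFin \o X]eq_fun do rewrite mulVKf//.
by rewrite !z ?addr0//; lia.
Qed.

End FourierModes.

(** * Test integrands for the lower bound *)

Section TimeIntegrals.
Variable R : realType.
Local Notation smu := (@spacetime_mu R).
Local Notation tmu := (@torus_mu R).
Implicit Types (chi : R -> R) (l : nat).

Lemma cosn_L2 l : L2_torus R (cosn l).
Proof. by apply: (@torus_bounded_L2 R _ 1); [exact: measurable_cosn|exact: cosn_norm]. Qed.

Lemma ip_cosn j l : ip tmu (cosn j) (cosn l) = if j == l then (mult l)^-1 else 0.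
Proof.
have := torus_cosn_convolution j l 0 (0 : R).
under eq_Rintegral do rewrite sub0r subr0 cosnN.
by rewrite subr0 [cosn l 0]/cosn mulr0 cos0 mulr1.
Qed.

Lemma separable_ip chi l (c : R) : measurable_fun setT chi -> (forall s, `|chi s| <= c) ->
  ip smu (fun z => chi z.1 * cosn l z.2) (fun z => chi z.1 * cosn l z.2) =
  \int[unit_mu]_s (chi s ^+ 2) / mult l.
Proof.
move=> mchi chic; have t1 : 0 <= (1 : R) <= 1 by rewrite ler01 lexx.
have [Lz _] := kernel_pairing l 0 mchi chic t1.
have ic : tmu.-integrable setT (EFin \o (fun y => cosn l y * cosn l y)).
  exact: (Lfun2_integrableM (cosn_L2 l) (cosn_L2 l)).
have i2 : (@unit_mu R).-integrable setT (EFin \o (fun s => chi s ^+ 2)).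
  apply: (@unit_bounded_integrable _ _ (c ^+ 2)); first exact: measurable_funX.
  by move=> s; rewrite normrX ler_pXn2r ?nnegrE//; exact: le_trans (chic s).
rewrite /ip spacetime_fubini; last exact: (Lfun2_integrableM Lz Lz).
transitivity (\int[@unit_mu R]_s ((mult l)^-1 * chi s ^+ 2)).
  apply: eq_Rintegral => s _ /=.
  have E y : chi s * cosn l y * (chi s * cosn l y) = chi s ^+ 2 * (cosn l y * cosn l y) by ring.
  under eq_Rintegral do rewrite E.
  rewrite (RintegralZl _ measurableT ic) mulrC; congr (_ * _).
  by have := ip_cosn l l; rewrite eqxx.
by rewrite (RintegralZl _ measurableT i2) mulrC.
Qed.

(** The pairing of [Phi x] with chi(s) cos(2 pi l y), without its factor cos(2 pi l x). *)
Definition time_weight l chi : R :=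
  \int[unit_mu]_s (expR (1 - clamp s) * chi s * (if s < 1 then expR (- (lam l * (1 - s))) else 0)).

Lemma Phi_pairing chi l (c : R) : measurable_fun setT chi -> (forall s, `|chi s| <= c) ->
  \int[tmu]_x (cosn l x * ip smu (Phi x) (fun z => chi z.1 * cosn l z.2)) =
  time_weight l chi / mult l.
Proof.
move=> mchi chic; have t1 : 0 <= (1 : R) <= 1 by rewrite ler01 lexx.
pose psi s := expR (1 - clamp s) * chi s.
have mpsi : measurable_fun setT psi.
  apply: measurable_funM => //; apply: measurableT_comp; first exact: measurable_expR.
  by apply: measurable_funB => //; exact: measurable_clamp.
have psic s : `|psi s| <= expR 1 * c.
  rewrite normrM ler_pM// ger0_norm ?expR_ge0// ler_expR.
  by have := clamp_itv s; rewrite gerBl => /andP[].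
have E x : ip smu (Phi x) (fun z => chi z.1 * cosn l z.2) = cosn l x * time_weight l chi.
  have [_ <-] := kernel_pairing l x mpsi psic t1.
  by rewrite ipC; apply: eq_Rintegral => z _; rewrite /Phi /psi; ring.
under eq_Rintegral do rewrite E mulrA mulrC.
have ic : tmu.-integrable setT (EFin \o (fun y => cosn l y * cosn l y)).
  exact: (Lfun2_integrableM (cosn_L2 l) (cosn_L2 l)).
rewrite (RintegralZl _ measurableT ic); congr (_ * _).
by have := ip_cosn l l; rewrite eqxx.
Qed.

Lemma sin_lattice (M : nat) : sin (2 * pi * M%:R) = 0 :> R.
Proof. by rewrite -[2 * pi * _]add0r sinDn2pi sin0. Qed.

Lemma cos_lattice (M : nat) : cos (2 * pi * M%:R) = 1 :> R.
Proof. by rewrite -[2 * pi * _]add0r cosDn2pi cos0. Qed.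

(** As lam 0 = 0 there is no decay, and [0, k/M] consists of k full periods of the sine. *)
Lemma sin_mode_int (M k : nat) : (0 < M)%N -> (k <= M)%N ->
  \int[unit_mu]_s (sin (2 * pi * M%:R * s) *
    (if s < k%:R / M%:R then expR (- (lam 0 * (k%:R / M%:R - s))) else 0)) = 0 :> R.
Proof.
move=> M0 kM; have M0' : 0 < M%:R :> R by rewrite ltr0n.
pose a : R := 2 * pi * M%:R; have a0 : a != 0 by rewrite gt_eqF// !mulr_gt0// pi_gt0.
have t01 : 0 <= (k%:R / M%:R : R) <= 1 by rewrite divr_ge0//= ler_pdivrMr// mul1r ler_nat.
have E (s : R) : sin (2 * pi * M%:R * s) * (if s < k%:R / M%:R then expR (- (lam 0 * (k%:R / M%:R - s))) else 0)
    = if s < k%:R / M%:R then sin (a * s + 0) else 0.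
  by rewrite /lam expr0n/= mulr0 mul0r oppr0 expR0; case: ifP => _; rewrite ?mulr0// mulr1 addr0.
under eq_Rintegral do rewrite E.
have dF (s : R) : is_derive s 1 (fun s => - a^-1 * cos (a * s + 0)) (sin (a * s + 0)).
  rewrite (_ : sin (a * s + 0) = - a^-1 * (- sin (a * s + 0) * a)); last first.
    by rewrite mulNr mulNr mulrN opprK mulrCA mulVf// mulr1.
  exact: (@is_derive_comp_affine _ (- a^-1) a 0 cos (fun y => - sin y) s (fun y => is_derive_cos y)).
rewrite (unit_FTC dF _ t01); last first.
  by move=> s; apply: continuous_comp; [exact: continuous_affine|exact: continuous_sin].
rewrite mulr0 !addr0 cos0 (_ : a * _ = 2 * pi * k%:R); first by rewrite cos_lattice subrr.
by rewrite /a -mulrA (mulrC M%:R) divfK// gt_eqF.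
Qed.

(** With a = 2 pi M the value is (e - 1) a/(1 + a^2). Now e - 1 >= 1, 1 + a^2 <= 2 a^2, and a <= 8 M
    because pi <= 4. *)
Lemma sin_time_weight (M : nat) : (0 < M)%N ->
  (16 * M%:R)^-1 <= time_weight 0 (fun s => sin (2 * pi * M%:R * s)) :> R.
Proof.
move=> M0; have M1 : 1 <= M%:R :> R by rewrite ler1n.
pose a : R := 2 * pi * M%:R.
have [p2 p4] : 2 <= pi :> R /\ pi <= 4 :> R by 
  split; [exact: pi_ge2|by have /andP[_] := @pihalf_02 R; lra].
have a1 : 1 <= a by rewrite /a; nra.
have aM : a <= 8 * M%:R by rewrite /a; nra.
have a21 : 1 + a ^+ 2 != 0 by rewrite gt_eqF// ltr_wpDr ?sqr_ge0.
(* The antiderivative of e^{1-s} sin(a s) given by two integrations by parts. *)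
pose F (s : R) := - (1 + a ^+ 2)^-1 * (expR (1 - s) * (sin (a * s) + a * cos (a * s))).
pose f (s : R) := expR (1 - s) * sin (a * s).
have dF (s : R) : is_derive s 1 F (f s).
  have d1 : is_derive s 1 (fun s : R => expR (1 - s)) (- expR (1 - s)).
    have := @is_derive_comp_affine _ 1 (-1) 1 expR expR s (fun y => is_derive_expR y).
    rewrite (_ : (fun y : R => _) = (fun s => expR (1 - s))); last first.
      by apply/funext => y; rewrite mul1r mulN1r addrC.
    by rewrite mul1r mulrN1 mulN1r addrC.
  have d2 : is_derive s 1 (fun s : R => sin (a * s)) (cos (a * s) * a).
    have := @is_derive_comp_affine _ 1 a 0 sin cos s (fun y => is_derive_sin y).
    rewrite (_ : (fun y : R => _) = (fun s => sin (a * s))); last first.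
      by apply/funext => y; rewrite mul1r addr0.
    by rewrite mul1r addr0.
  have d3 : is_derive s 1 (fun s : R => a * cos (a * s)) (a * (- sin (a * s) * a)).
    have := @is_derive_comp_affine _ a a 0 cos (fun y => - sin y) s (fun y => is_derive_cos y).
    rewrite (_ : (fun y : R => _) = (fun s => a * cos (a * s))); last first.
      by apply/funext => y; rewrite addr0.
    by rewrite addr0.
  have d4 := is_deriveM d1 (is_deriveD d2 d3).
  have d5 := is_deriveZ (- (1 + a ^+ 2)^-1) d4.
  apply: is_derive_eq d5 _; rewrite /f !fctE /GRing.scale /=; field.
  exact: a21.
have cf : continuous f.
  move=> s; apply: cvgM; apply: continuous_comp.
  - by apply: cvgB; [exact: cvg_cst|exact: cvg_id].
  - exact: continuous_expR.
  - by apply: cvgM; [exact: cvg_cst|exact: cvg_id].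
  - exact: continuous_sin.
have -> : time_weight 0 (fun s => sin (2 * pi * M%:R * s)) = \int[unit_mu]_s (if s < 1 then f s else 0).
  have ms : measurable_fun setT (fun s : R => sin (2 * pi * M%:R * s)).
    apply: continuous_measurable_fun => s; apply: continuous_comp; last exact: continuous_sin.
    by apply: cvgM; [exact: cvg_cst|exact: cvg_id].
  apply: unit_eq_Rintegral.
  - apply: measurable_funM; last exact: measurable_heat_mode.
    apply: measurable_funM => //; apply: measurableT_comp; first exact: measurable_expR.
    by apply: measurable_funB => //; exact: measurable_clamp.
  - by apply: measurable_fun_ifT => //; [exact: measurable_fun_ltr|exact: continuous_measurable_fun].
  - move=> s s01; rewrite clamp_id// /lam expr0n/= mulr0 mul0r oppr0 expR0.
    by case: ifP => _; rewrite ?mulr1 ?mulr0.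
rewrite (unit_FTC dF cf) ?ler01 ?lexx//.
rewrite /F subrr subr0 expR0 mulr1 mulr0 sin0 cos0 /a sin_lattice cos_lattice -/a.
have e2 : 2 <= expR 1 :> R by have := expR_ge1Dx (1 : R).
rewrite (_ : _ - _ = (expR 1 - 1) * a / (1 + a ^+ 2)); last by field; exact: a21.
have ap : 0 < 1 + a ^+ 2 by rewrite ltr_wpDr ?sqr_ge0.
rewrite ler_pdivlMr// ler_pdivrMl ?mulr_gt0 ?ltr0n//.
have h1 : 0 <= (8 * M%:R - a) * a by rewrite mulr_ge0 ?subr_ge0//; lra.
have h2 : 0 <= (expR 1 - 2) * (M%:R * a) by rewrite !mulr_ge0 ?subr_ge0//; lra.
have h3 : 1 <= a ^+ 2 by rewrite exprn_ege1.
by move: h1 h2 h3; rewrite expr2; nra.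
Qed.

(** On [0, 1[ this is e^{1-s} e^{-lam l (1-s)}, the time factor of [Phi] in the mode l, hence the
    case of equality in Cauchy-Schwarz. *)
Definition decay l (s : R) : R := if s < 1 then expR (- ((lam l - 1) * (1 - s))) else 0.

Lemma lam_gt1 l : (0 < l)%N -> 1 < lam l :> R.
Proof.
case: l => // l _; apply: lt_le_trans (lam_gt R l).
by rewrite ltr1n; nia.
Qed.

Lemma measurable_decay l : measurable_fun setT (decay l).
Proof. exact: measurable_heat_mode. Qed.

Lemma decay_norm l s : (0 < l)%N -> `|decay l s| <= 1.
Proof. by move=> l0; apply: heat_mode_norm; rewrite subr_ge0 ltW// lam_gt1. Qed.

Lemma decay_time_weight l : (0 < l)%N ->
  time_weight l (decay l) = \int[unit_mu]_s (decay l s ^+ 2).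
Proof.
move=> l0; apply: unit_eq_Rintegral.
- apply: measurable_funM; last exact: measurable_heat_mode.
  apply: measurable_funM; last exact: measurable_decay.
  apply: measurableT_comp; first exact: measurable_expR.
  by apply: measurable_funB => //; exact: measurable_clamp.
- by apply: measurable_funX; exact: measurable_decay.
move=> s s01; rewrite clamp_id// /decay; case: ifP => _; last by rewrite mulr0 expr0n.
by rewrite expr2 -!expRD; congr expR; ring.
Qed.

(** With y = 2 (lam l - 1) the integral is (1 - e^{-y})/y, which is at least 1/(1 + y) because e^y
    >= 1 + y. Finally 1 + y <= 2 lam l <= 128 l^2, as pi <= 4. *)
Lemma decay_square_int l : (0 < l)%N ->
  (128 * l%:R ^+ 2)^-1 <= \int[unit_mu]_s (decay l s ^+ 2).
Proof.
move=> l0; have lam1 := lam_gt1 l0.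
have E s : decay l s ^+ 2 = if s < 1 then expR (- (2 * (lam l - 1) * (1 - s))) else 0.
  rewrite /decay; case: ifP => _; last by rewrite expr0n.
  by rewrite expr2 -expRD; congr expR; ring.
under eq_Rintegral do rewrite E.
have mu0 : 0 < 2 * (lam l - 1) :> R by lra.
rewrite unit_exp_int ?gt_eqF// ?ler01 ?lexx// mulr1.
have lamU : lam l <= 64 * l%:R ^+ 2 :> R.
  have p4 : pi <= 4 :> R by have /andP[_] := @pihalf_02 R; lra.
  have p0 := @pi_ge0 R.
  by rewrite /lam ler_wpM2r ?sqr_ge0//; nra.
move: lamU; set b : R := l%:R ^+ 2 => lamU.
move: mu0; set y := 2 * (lam l - 1) => y0.
have yb : 1 + y <= 128 * b by rewrite /y; lra.
have e1 : 1 + y <= expR y := expR_ge1Dx y.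
apply: (@le_trans _ _ (1 + y)^-1); first by rewrite lef_pV2 ?posrE//; lra.
rewrite ler_pdivlMr// expRN.
have : (expR y)^-1 <= (1 + y)^-1 by rewrite lef_pV2 ?posrE ?expR_gt0//; lra.
have -> : (1 + y)^-1 * y = 1 - (1 + y)^-1 by field; rewrite gt_eqF//; lra.
by lra.
Qed.

End TimeIntegrals.

(** The interval [-(m+1), m+1] is mapped affinely onto [0, 1], where the clamped version applies; at
    a fixed point the approximations are constant for large m. *)
Lemma caratheodory_line_measurable (R : realType) d (T : measurableType d) (f : R -> T -> R) :
  (forall s, measurable_fun setT (f s)) -> (forall w, continuous (f^~ w)) ->
  measurable_fun setT (fun p : R * T => f p.1 p.2).
Proof.
move=> mf cf.
pose g (m : nat) (s : R) (w : T) := f (m.+1%:R * (2 * s - 1)) w.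
have mg m : measurable_fun setT (fun p : R * T => g m (clamp p.1) p.2).
  apply: (@caratheodory_measurable R _ T (g m)) => [s|w s]; first exact: mf.
  apply: (@continuous_comp _ _ _ (fun s : R => m.+1%:R * (2 * s - 1)) (f^~ w)); last exact: cf.
  apply: cvgM; first exact: cvg_cst.
  by apply: cvgB; [apply: cvgM; [exact: cvg_cst|exact: cvg_id]|exact: cvg_cst].
apply: (measurable_fun_cvg (h := fun m (p : R * T) => g m (clamp ((p.1 / m.+1%:R + 1) / 2)) p.2)).
  move=> m.
  have mh : measurable_fun setT (fun p : R * T => ((p.1 / m.+1%:R + 1) / 2, p.2)).
    apply/measurable_fun_pair => //=; apply: measurable_funM => //; apply: measurable_funD => //.
    by apply: measurable_funM => //; exact: measurable_fst.
  exact: (measurableT_comp (mg m) mh).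
move=> [x w] _ /=; apply: cvg_near_cst.
exists (Num.truncn `|x|) => // m /= xm.
have m0 : 0 < m.+1%:R :> R by rewrite ltr0n.
have xm' : `|x / m.+1%:R| <= 1.
  rewrite normrM normfV (gtr0_norm m0) ler_pdivrMr// mul1r ltW//.
  by rewrite (lt_le_trans (truncnS_gt _))// ler_nat ltnS.
rewrite /g clamp_id; last first.
  by move: xm'; move: (x / m.+1%:R) => a; rewrite ler_norml => /andP[? ?]; apply/andP; split; lra.
congr (f _ w); rewrite (_ : 2 * ((x / m.+1%:R + 1) / 2) - 1 = x / m.+1%:R); last by field.
by rewrite mulrCA mulfV ?mulr1// gt_eqF.
Qed.

Lemma symmetric_itv_intP (R : realType) (N : nat) (n : int) :
  `[- N%:R, N%:R]%classic (n%:~R : R) <-> (`|n| <= N)%N.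
Proof.
rewrite /= in_itv/=.
have -> : (- N%:R : R) = (- N%:Z)%:~R by rewrite mulrNz.
rewrite (_ : N%:R = (N%:Z)%:~R :> R)// !ler_int; lia.
Qed.

(** * The observed sigma-algebra and the projection of the final state *)

Section Assembly.
Context {R : realType} {d : measure_display} {Omega : measurableType d}.
Variable P : probability Omega R.
Variables (xi : set (R * R) -> Omega -> R) (I : (R * R -> R) -> Omega -> R).
Variables (O u : R -> Omega -> R -> R).
Hypotheses (Hxi : white_noise P xi) (HI : stochastic_integral P xi I).
Hypothesis (HO : stochastic_convolution P I O).
Hypothesis Hu : mild_solution P xi O (fun v : R => v) (fun _ : R => 0) u.
Local Notation smu := (@spacetime_mu R).
Local Notation tmu := (@torus_mu R).
Local Notation S := (measurableTypeR R * measurableTypeR R)%type.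
Variables (M N : nat).
Hypothesis M0 : (0 < M)%N.

Lemma noise_filtration_measurable t A : noise_filtration P xi t A -> measurable A.
Proof.
have sub : noise_filtration P xi t `<=` measurable.
  apply: smallest_sub.
    split=> [|B mB|F mF]; [exact: measurable0|by rewrite setTD; exact: measurableC|exact: bigcupT_measurable].
  move=> E [[B [C [bB _ mC ->]]]|[]//].
  have [LX _] := Hxi; have := Lfun2_measurable (LX _ bB).
  by move=> /(_ measurableT _ mC); rewrite setTI.
exact: sub.
Qed.

Definition final_field (x : R) (w : Omega) : R := u 1 w x.

Lemma measurable_final_field :
  measurable_fun setT (fun p : measurableTypeR R * Omega => final_field p.1 p.2).
Proof.
have [au pu _] := Hu; have t1 : (1 : R) \in `[0, 1] by rewrite in_itv/= ler01 lexx.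
apply: (@caratheodory_line_measurable R _ Omega final_field) => [x|w].
  move=> _ B mB; rewrite setTI.
  by apply: (@noise_filtration_measurable 1); exact: au.
by have [cu _ _] := pu w; exact: cu.
Qed.

Lemma final_field_L2 x : final_field x \in Lfun P 2%:E.
Proof.
have [LP _] := Phi_L2_nrm x; apply: Lfun2_ae (I_L2 HI LP).
  exact: (measurableT_comp measurable_final_field (measurable_pair1 (x : measurableTypeR R))).
by have := mild_solution_gaussian HI HO Hu x; apply: filterS => w h /h.
Qed.

Lemma final_field_nrm x : nrm P (final_field x) <= expR 1 * Num.sqrt 2.
Proof.
have [LP n] := Phi_L2_nrm x; apply: le_trans n.
have mf := Lfun2_measurable (final_field_L2 x); have mI := Lfun2_measurable (I_L2 HI LP).
have ae := mild_solution_gaussian HI HO Hu x.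
rewrite /nrm -(I_isometry HI LP) (ip_ae mf mI mf ae) ipC (ip_ae mf mI mI ae).
by [].
Qed.

Lemma final_state_L2T w : L2_torus R (final_field^~ w).
Proof.
have [_ pu _] := Hu; have [cu _ _] := pu w; have [B hB] := path_bounded (pu w).
have t1 : (1 : R) \in `[0, 1] by rewrite in_itv/= ler01 lexx.
have mu1 : measurable_fun setT (u 1 w) by apply: continuous_measurable_fun; exact: cu.
apply: (@Lfun2_ae _ _ _ tmu (fun x => u 1 w (clamp x))).
- exact: mu1.
- apply: ae_eq_mrestr => x; rewrite /torus_dom/= in_itv/= => /andP[x0 /ltW x1].
  by rewrite clamp_id// x0.
- apply: (@torus_bounded_L2 R _ B).
    exact: (measurableT_comp mu1 (@measurable_clamp R)).
  by move=> x; have := hB (1, x); rewrite /= (@clamp_id _ 1)// ler01 lexx.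
Qed.

(** Time index, frequency shifted by N so that it runs through the 2N + 1 integers of [-N, N], and
    choice of real or imaginary part. The enumeration by [enum_val] supplies the ordinals that the
    Gram matrix needs. *)
Definition mode_index := ('I_M.+1 * 'I_(2 * N).+1 * bool)%type.

Definition mode_time (j : mode_index) : R := (j.1.1)%:R / M%:R.

Definition mode_freq (j : mode_index) : int := (j.1.2)%:Z - N%:Z.

Definition mode_kernel (i : 'I_#|{: mode_index}|) : R * R -> R :=
  let j := enum_val i in fourier_kernel (mode_time j) (mode_freq j) j.2.

Definition mode (i : 'I_#|{: mode_index}|) : Omega -> R :=
  let j := enum_val i in fourier_mode O (mode_time j) (mode_freq j) j.2.

(** The generating family of [sigma_fourier], named so that the results on [<<s G0>>] apply; the two
    sigma-algebras are convertible. *)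
Definition generators : set (set Omega) :=
  [set E | exists (k : nat) (n : int) (B1 B2 : set R),
       [/\ (k <= M)%N, `[- N%:R, N%:R]%classic (n%:~R : R), measurable B1, measurable B2
         & E = [set w | let z := fourier (O (k%:R / M%:R) w) n in
                        B1 (complex.Re z) /\ B2 (complex.Im z)]]].

Lemma mode_time_itv (j : mode_index) : 0 <= mode_time j <= 1.
Proof.
have M0' : 0 < M%:R :> R by rewrite ltr0n.
rewrite /mode_time divr_ge0//= ler_pdivrMr// mul1r ler_nat -ltnS; exact: ltn_ord.
Qed.

Lemma mode_freq_le (j : mode_index) : (`|mode_freq j| <= N)%N.
Proof. by rewrite /mode_freq; have := ltn_ord j.1.2; lia. Qed.

Lemma mode_indexP k n : (k <= M)%N -> `[- N%:R, N%:R]%classic (n%:~R : R) ->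
  exists j1 : 'I_M.+1, exists j2 : 'I_(2 * N).+1, forall b,
    mode_time (j1, j2, b) = k%:R / M%:R /\ mode_freq (j1, j2, b) = n.
Proof.
move=> kM /symmetric_itv_intP nN.
have h : (`|(n + N%:Z)%R| < (2 * N).+1)%N by lia.
exists (Ordinal (kM : (k < M.+1)%N)), (Ordinal h) => b.
by split=> //; rewrite /mode_freq /=; lia.
Qed.

Lemma measurable_mode i : measurable_fun setT (mode i).
Proof. exact: (Lfun2_measurable (fourier_mode_L2 HI HO _ _ _)). Qed.

Lemma mode_Gmeasurable i : Gmeasurable generators (mode i).
Proof.
move=> B mB; apply: sub_sigma_algebra; rewrite /mode; set j := enum_val i.
have E w := fourier_modeE HO (mode_freq j) w (mode_time_itv j).
have jM : (j.1.1 <= M)%N by rewrite -ltnS; exact: ltn_ord.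
have jN : `[- N%:R, N%:R]%classic ((mode_freq j)%:~R : R).
  by apply/symmetric_itv_intP; exact: mode_freq_le.
exists j.1.1, (mode_freq j), (if j.2 then B else setT), (if j.2 then setT else B); split=> //.
- by case: ifP.
- by case: ifP.
apply/seteqP; split=> w; rewrite /preimage /mkset; move: (E w); rewrite /mode_time => -[-> ->];
  by case: (j.2) => //; case.
Qed.

Lemma generators_sub : <<s generators>> `<=`
  <<s [set E | exists i B, measurable B /\ E = mode i @^-1` B] >>.
Proof.
set G' := <<s _ >>.
apply: smallest_sub; first exact: smallest_sigma_algebra.
move=> _ [k [n [B1 [B2 [kM nN mB1 mB2 ->]]]]].
have [j1 [j2 H]] := mode_indexP kM nN.
have X b : mode (enum_rank (j1, j2, b)) = fourier_mode O (k%:R / M%:R) n b.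
  by rewrite /mode enum_rankK /=; have [-> ->] := H b.
have t01 : 0 <= (k%:R / M%:R : R) <= 1 by have [<- _] := H true; exact: mode_time_itv.
have -> : [set w | let z := fourier (O (k%:R / M%:R) w) n in B1 (complex.Re z) /\ B2 (complex.Im z)] =
    mode (enum_rank (j1, j2, true)) @^-1` B1 `&` mode (enum_rank (j1, j2, false)) @^-1` B2.
  apply/seteqP; split=> w; rewrite /setI /preimage /mkset !X;
  by have [E1 E2] := fourier_modeE HO n w t01; rewrite -E1 -E2.
apply: (@measurableI _ (g_sigma_algebraType _)); apply: sub_sigma_algebra.
  by exists (enum_rank (j1, j2, true)), B1.
by exists (enum_rank (j1, j2, false)), B2.
Qed.

Lemma generators_measurable : <<s generators>> `<=` measurable.
Proof.
apply: (subset_trans generators_sub); apply: smallest_sub.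
  split=> [|B mB|F mF]; [exact: measurable0|by rewrite setTD; exact: measurableC|exact: bigcupT_measurable].
by move=> _ [i [B [mB ->]]]; rewrite -[X in measurable X]setTI; exact: measurable_mode.
Qed.

Lemma mode_kernel_L2 i : L2_spacetime R (mode_kernel i).
Proof. exact: fourier_kernel_L2. Qed.

Lemma mode_gaussian i : ae_eq P setT (mode i) (I (mode_kernel i)).
Proof. exact: (fourier_mode_gaussian HI HO _ _ _). Qed.

Definition final_coef (i : 'I_#|{: mode_index}|) (x : R) : R := proj_coef smu mode_kernel (Phi x) i.

Lemma measurable_Phi_pair : measurable_fun setT (fun p : measurableTypeR R * S => Phi p.1 p.2).
Proof.
have m : measurable_fun setT (fun p : R * (R * R) => Phi p.1 p.2).
  apply: measurable_funM.
    apply: measurableT_comp; first exact: measurable_expR.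
    apply: measurable_funB => //; apply: (measurableT_comp (@measurable_clamp R)).
    exact: (measurableT_comp measurable_fst measurable_snd).
  apply: (@measurable_convolution_kernel R _ _ (fun=> 1) (fun p : R * (R * R) => p.1)
    (fun p => p.2.1) (fun p => p.2.2)) => //.
  + exact: measurable_fst.
  + exact: (measurableT_comp measurable_fst measurable_snd).
  + exact: (measurableT_comp measurable_snd measurable_snd).
exact: m.
Qed.

Lemma measurable_ip_Phi phi : L2_spacetime R phi ->
  measurable_fun setT (fun x : R => ip smu (Phi x) phi).
Proof.
move=> Lphi.
have L1 : L2_torus R (fun=> 1 : R).
  by apply: (@torus_bounded_L2 R _ 1) => // y; rewrite normr1.
have := rint_measurable (@ip_mixture_integrable _ _ (measurableTypeR R) S R tmu smu _ _ _
  measurable_Phi_pair (fun x => (Phi_L2_nrm x).1) (fun x => (Phi_L2_nrm x).2) L1 _ Lphi).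
by under [X in measurable_fun _ X -> _]eq_fun do rewrite mul1r.
Qed.

Lemma measurable_final_coef i : measurable_fun setT (final_coef i).
Proof.
apply: measurable_sum => k; apply: measurable_funM; last exact: measurable_cst.
exact: (measurable_ip_Phi (mode_kernel_L2 k)).
Qed.

Lemma final_coef_bounded : exists B, forall i x, `|final_coef i x| <= B.
Proof.
pose b i : R := \sum_k (expR 1 * Num.sqrt 2 * nrm smu (mode_kernel k)) * `|pinvmx (gram smu mode_kernel) k i|.
have b0 i : 0 <= b i.
  by apply: sumr_ge0 => k _; rewrite !mulr_ge0 ?expR_ge0 ?sqrtr_ge0 ?nrm_ge0.
exists (\sum_i b i) => i x.
apply: (@le_trans _ _ (b i)); last by rewrite (bigD1 i)//= lerDl sumr_ge0.
rewrite /final_coef /proj_coef; apply: (le_trans (ler_norm_sum _ _ _)); apply: ler_sum => k _.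
have [LP nP] := Phi_L2_nrm x.
rewrite normrM; apply: ler_wpM2r; first exact: normr_ge0.
apply: (le_trans (ip_abs_le_nrm LP (mode_kernel_L2 k))).
by apply: ler_wpM2r nP; exact: nrm_ge0.
Qed.

(** The residual at x is almost surely the Wiener integral of [Phi x] minus its projection, which is
    orthogonal to all observed kernels; the independence result then annihilates it on every
    observed event. *)
Lemma final_orthogonal x A : <<s generators>> A ->
  ip P (fun w => final_field x w - projection final_coef mode w x) \1_A = 0.
Proof.
move=> GA; have mA := generators_measurable GA.
have [LP _] := Phi_L2_nrm x.
have LS := Lfun2_lincomb mode_kernel_L2 (fun j => proj_coef smu mode_kernel (Phi x) j).
set phi := fun z => Phi x z - \sum_j proj_coef smu mode_kernel (Phi x) j * mode_kernel j z.
have Lphi : L2_spacetime R phi by exact: Lfun2B LP LS.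
rewrite -ip_indic//.
apply: (@orthogonal_integral_eq0 _ _ _ P xi I Hxi HI _ mode_kernel mode phi).
- exact: mode_kernel_L2.
- exact: Lphi.
- by move=> j; exact: (proj_coefP mode_kernel_L2 j LP).
- apply: measurable_funB; first exact: (Lfun2_measurable (final_field_L2 x)).
  by apply: measurable_sum => j; apply: measurable_funM => //; exact: measurable_mode.
- exact: measurable_mode.
- have A1 := I_comb HI 1 (-1) LP LS.
  have A2 := I_sum HI (index_enum 'I_#|{: mode_index}|) (fun j => proj_coef smu mode_kernel (Phi x) j) mode_kernel_L2.
  have A3 : {ae P, forall w, forall i, mode i w = I (mode_kernel i) w}.
    apply: filter_forall => i; have := mode_gaussian i; apply: filterS => w h; exact: h.
  have A4 := mild_solution_gaussian HI HO Hu x.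
  have A5 : I phi = I (fun z => 1 * Phi x z + -1 * \sum_j proj_coef smu mode_kernel (Phi x) j * mode_kernel j z).
    by congr I; apply/funext => z; rewrite mul1r mulN1r.
  rewrite A5; move: A3; apply: filter_app; move: A1 A2 A4; apply: filterS3 => w h1 h2 h4 h3 _.
  rewrite (h1 Logic.I) (h2 Logic.I) mul1r mulN1r -(h4 Logic.I); congr (_ - _).
  by apply: eq_bigr => j _; rewrite mulrC h3.
- exact: mode_gaussian.
- exact: generators_sub.
Qed.

End Assembly.

(** Comparison of b^-2 with 1/b - 1/(b+1) telescopes to N/((N+1)(2N+1)). This is at least 1/(3N)
    exactly when N^2 >= 3N + 1, hence the threshold 4. *)
Lemma tail_square_sum (R : realType) (N : nat) : (4 <= N)%N ->
  (3 * N%:R)^-1 <= \sum_(i < N) (((N + i.+1)%:R : R) ^+ 2)^-1.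
Proof.
move=> N4; have H m : ((N.+1)%:R : R)^-1 - ((N.+1 + m)%:R)^-1 <= \sum_(i < m) (((N + i.+1)%:R : R) ^+ 2)^-1.
  elim: m => [|m IH]; first by rewrite big_ord0 addn0 subrr.
  rewrite big_ord_recr/=; apply: le_trans (lerD IH (lexx _)); rewrite -addrA lerD2l.
  rewrite !addnS addSn -natr1.
  have : 0 < (N + m).+1%:R :> R by rewrite ltr0n.
  move: ((N + m).+1%:R : R) => b b0; rewrite -lerBlDl opprK.
  rewrite (_ : - (b + 1)^-1 + b^-1 = (b * (b + 1))^-1); last by field; rewrite !gt_eqF//; lra.
  by rewrite lef_pV2 ?posrE ?mulr_gt0 ?exprn_gt0//; [rewrite expr2; nra|lra].
apply: le_trans (H N).
rewrite natrD -[N.+1%:R]natr1; have : 4 <= N%:R :> R by rewrite ler_nat.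
move: (N%:R : R) => a a4.
rewrite (_ : (a + 1)^-1 - (a + 1 + a)^-1 = a / ((a + 1) * (a + 1 + a))); last by field; rewrite !gt_eqF//; lra.
rewrite ler_pdivlMr ?mulr_gt0//; [|lra|lra].
by rewrite ler_pdivrMl; nra.
Qed.

(** * Lower bound for the projection error *)

Section LowerBound.
Context {R : realType} {d : measure_display} {Omega : measurableType d}.
Variable P : probability Omega R.
Variables (xi : set (R * R) -> Omega -> R) (I : (R * R -> R) -> Omega -> R).
Variables (O u : R -> Omega -> R -> R).
Hypotheses (Hxi : white_noise P xi) (HI : stochastic_integral P xi I).
Hypothesis (HO : stochastic_convolution P I O).
Hypothesis Hu : mild_solution P xi O (fun v : R => v) (fun _ : R => 0) u.
Local Notation smu := (@spacetime_mu R).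
Local Notation tmu := (@torus_mu R).
Variables (M N : nat).
Hypothesis M0 : (0 < M)%N.

Definition best : Omega -> R -> R := projection (@final_coef R M N) (@mode R d Omega O M N).

Local Notation error h := (\int[P]_w ((inner_diff (u 1) best h w) ^+ 2)%:E)%E.

(** The integral of [zeta] is uncorrelated with the observed modes, hence with the projection; so
    the residual and u_1 have the same correlation with it, computed by the isometry. Cauchy-Schwarz
    concludes. *)
Lemma error_lower_bound h zeta b : L2_torus R h -> L2_spacetime R zeta ->
  (forall i, ip smu (@mode_kernel R M N i) zeta = 0) -> 0 < b -> ip smu zeta zeta <= b ->
  (((\int[tmu]_x (h x * ip smu (Phi x) zeta)) ^+ 2 / b)%:E <= error h)%E.
Proof.
move=> Lh Lz z0 b0 zb; have [B cB] := @final_coef_bounded R M N.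
have mU := measurable_final_field Hxi Hu; have LU := final_field_L2 Hxi HI HO Hu.
have nU := final_field_nrm Hxi HI HO Hu; have LX := final_state_L2T Hu.
have mc := @measurable_final_coef R M N.
have LYi (i : 'I_#|{: mode_index M N}|) : mode O i \in Lfun P 2%:E.
  exact: (fourier_mode_L2 HI HO _ _ _).
have LR : inner_diff (u 1) best h \in Lfun P 2%:E := residual_inner_L2 mU LU nU LX mc cB LYi Lh.
have Le := I_L2 HI Lz.
have -> : \int[tmu]_x (h x * ip smu (Phi x) zeta) = ip P (inner_diff (u 1) best h) (I zeta).
  have E := ipBl (inner_L2 mU LU nU Lh) (projection_inner_L2 mc cB LYi Lh) Le.
  rewrite -[RHS]/(ip P (fun w => L2T_inner (final_field u ^~ w) h - L2T_inner (best w) h) (I zeta)).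
  rewrite [RHS]E -(mixture_inner (final_field u) h) (ip_mixture mU LU nU Lh Le).
  rewrite (_ : (fun w => L2T_inner _ h) = (fun w => \sum_j L2T_inner (@final_coef R M N j) h * mode O j w)); last first.
    by apply/funext => w; exact: (projection_innerE _ mc cB).
  rewrite (ip_lincombl LYi _ Le) big1 ?subr0 => [|j _].
    apply: eq_Rintegral => x _; congr (_ * _); have [LP _] := Phi_L2_nrm x.
    rewrite -(I_ip HI LP Lz); apply: ip_ae.
    - exact: Lfun2_measurable (I_L2 HI LP).
    - exact: Lfun2_measurable (LU x).
    - exact: Lfun2_measurable Le.
    - have := mild_solution_gaussian HI HO Hu x; apply: filterS => w H H1.
      by rewrite -(H H1).
  have Lk := @mode_kernel_L2 R M N j.
  rewrite (ip_ae (Lfun2_measurable (LYi j)) (Lfun2_measurable (I_L2 HI Lk)) (Lfun2_measurable Le) (mode_gaussian HI HO j)).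
  by rewrite (I_ip HI Lk Lz) z0 mulr0.
rewrite (ip_integral LR) lee_fin ler_pdivrMr//; apply: (le_trans (ip_CS LR Le)).
by rewrite (I_ip HI Lz Lz) ler_wpM2l// ip_ge0.
Qed.

(** The test integrand has norm at most 1 and its pairing is at least 1/(16 M). *)
Lemma low_mode_error : (((256 * M%:R ^+ 2)^-1)%:E <= error (@cosn R 0))%E.
Proof.
pose chi (s : R) := sin (2 * pi * M%:R * s).
have mchi : measurable_fun setT chi.
  apply: continuous_measurable_fun => s; apply: continuous_comp; last exact: continuous_sin.
  by apply: cvgM; [exact: cvg_cst|exact: cvg_id].
have chi1 s : `|chi s| <= 1 by exact: sin_max.
have t1 : 0 <= (1 : R) <= 1 by rewrite ler01 lexx.
have [Lz _] := kernel_pairing 0 0 mchi chi1 t1.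
have := error_lower_bound (cosn_L2 R 0) Lz _ ltr01 _.
rewrite (Phi_pairing 0 mchi chi1) (separable_ip 0 mchi chi1) /mult /= invr1 !mulr1.
move=> H; apply: le_trans (H _ _).
- rewrite lee_fin; have := @sin_time_weight R M M0; set A := time_weight _ _.
  move=> AM; have m0 : 0 <= (16 * M%:R)^-1 :> R by rewrite invr_ge0 mulr_ge0.
  rewrite (_ : _^-1 = (16 * M%:R)^-1 ^+ 2) ?ler_pXn2r ?nnegrE//; first exact: le_trans AM.
  by rewrite exprVn exprMn; congr (_ * _)^-1; ring.
- move=> i; rewrite /mode_kernel.
  rewrite (ip_fourier_kernel _ _ _ (mode_time_itv M0 _) mchi chi1).
  by rewrite /mode_time (sin_mode_int _ M0) ?mul0r// -ltnS ltn_ord.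
- apply: (@le_trans _ _ (\int[unit_mu]_s (1 : R))); last first.
    rewrite (_ : \int[unit_mu]__ 1 = 1 * fine (@unit_mu R setT)); first by rewrite unit_mu_setT mul1r.
    exact: Rintegral_cst.
  apply: le_Rintegral => //.
  + apply: (@unit_bounded_integrable _ _ 1); first exact: measurable_funX.
    by move=> s; rewrite normrX exprn_ile1.
  + exact: finite_measure_integrable_cst.
  + by move=> s _; rewrite -[_ ^+ 2]ger0_norm ?sqr_ge0// normrX exprn_ile1.
Qed.

(** With A the integral of the squared decay, the pairing and the squared norm of the test integrand
    are both A/2, so the quotient is A/2. *)
Lemma high_mode_error l : (N < l)%N -> (((256 * l%:R ^+ 2)^-1)%:E <= error (@cosn R l))%E.
Proof.
move=> Nl; have l0 : (0 < l)%N by exact: leq_ltn_trans Nl.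
have mchi := @measurable_decay R l; have chi1 s := @decay_norm R l s l0.
have t1 : 0 <= (1 : R) <= 1 by rewrite ler01 lexx.
have [Lz _] := kernel_pairing l 0 mchi chi1 t1.
have q := @decay_square_int R l l0.
have q0 : 0 < \int[unit_mu]_s (decay l s ^+ 2) :> R.
  by apply: lt_le_trans q; rewrite invr_gt0 mulr_gt0// exprn_gt0// ltr0n.
have m2 : mult l = 2 :> R by rewrite /mult gtn_eqF.
have := @error_lower_bound _ _ (\int[unit_mu]_s (decay l s ^+ 2) / 2) (cosn_L2 R l) Lz _ _ _.
rewrite (Phi_pairing l mchi chi1) (separable_ip l mchi chi1) decay_time_weight// m2.
move=> H; apply: le_trans (H _ _ _).
- rewrite lee_fin; move: q q0; set A := (\int[_]_s _) => q q0.
  rewrite (_ : (A / 2) ^+ 2 / (A / 2) = A / 2); last by field; rewrite gt_eqF.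
  rewrite ler_pdivlMr//; apply: le_trans q; rewrite le_eqVlt; apply/orP; left; apply/eqP.
  by field; rewrite gt_eqF// ltr0n.
- move=> i; rewrite /mode_kernel.
  rewrite (ip_fourier_kernel _ _ _ (mode_time_itv M0 _) mchi chi1).
  by rewrite fourier_weight_cosn ?mulr0//; apply: leq_ltn_trans Nl; exact: mode_freq_le.
- by rewrite divr_gt0.
- by [].
Qed.

Local Notation G := (<<s @generators R d Omega O M N>>).

Let Gm : G `<=` measurable := generators_measurable HI HO M0.
Let mU := measurable_final_field Hxi Hu.
Let LU := final_field_L2 Hxi HI HO Hu.
Let nU := final_field_nrm Hxi HI HO Hu.
Let LX : forall w, L2_torus R (u 1 w) := final_state_L2T Hu.
Let mc := @measurable_final_coef R M N.
Let LY (i : 'I_#|{: mode_index M N}|) : mode O i \in Lfun P 2%:E.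
Proof. exact: (fourier_mode_L2 HI HO _ _ _). Qed.
Let GY := @mode_Gmeasurable R d Omega P I O HO M N M0.
Let orth := fun x A => @final_orthogonal _ _ _ _ _ _ _ _ Hxi HI HO Hu M N M0 x A.

Lemma best_cond_expectation : cond_expectation P G (u 1) best.
Proof.
have [B cB] := @final_coef_bounded R M N.
exact: (projection_cond_expectation Gm mU LU nU LX mc cB LY GY orth).
Qed.

Lemma measurable_inner_state h : L2_torus R h ->
  measurable_fun setT (fun w => L2T_inner (u 1 w) h).
Proof. by move=> Lh; exact: Lfun2_measurable (inner_L2 mU LU nU Lh). Qed.

Lemma measurable_inner Z h : L2T_random_variable G Z -> L2_torus R h ->
  measurable_fun setT (fun w => L2T_inner (Z w) h).
Proof. by move=> rZ Lh; exact: (Gmeasurable_measurable Gm (L2T_inner_Gmeasurable rZ Lh)). Qed.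

Lemma cond_expectation_error V h : cond_expectation P G (u 1) V -> L2_torus R h ->
  (\int[P]_w ((inner_diff (u 1) V h w) ^+ 2)%:E = \int[P]_w ((inner_diff (u 1) best h w) ^+ 2)%:E)%E.
Proof.
move=> cV Lh; have [B cB] := @final_coef_bounded R M N.
have [rV _ _] := cV; have [rb _ _] := best_cond_expectation.
have m Z : L2T_random_variable G Z -> measurable_fun setT (fun w => ((inner_diff (u 1) Z h w) ^+ 2)%:E).
  move=> rZ; apply/measurable_EFinP/measurable_funX/measurable_funB.
    exact: measurable_inner_state.
  exact: measurable_inner.
apply: ae_eq_integral => //; [exact: m|exact: m|].
have := cond_expectation_inner Gm mU LU nU LX mc cB LY GY orth cV Lh.
apply: filterS => w H H1; rewrite /inner_diff.
by congr ((_ - _) ^+ 2)%:E; exact: H.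
Qed.

Lemma cond_expectation_optimal V : cond_expectation P G (u 1) V ->
  ereal_inf [set L2_distance P (u 1) Z | Z in [set Z | L2T_random_variable G Z]] =
  L2_distance P (u 1) V.
Proof.
move=> cV; have [rV _ _] := cV; have [B cB] := @final_coef_bounded R M N.
apply/eqP; rewrite eq_le; apply/andP; split; first by apply: ereal_inf_lbound; exists V.
apply: le_ereal_inf_tmp => _ [Z rZ <-].
apply: (L2_distance_le LX measurable_inner_state rV.1 rZ.1) => [h|h|h Lh].
- exact: measurable_inner.
- exact: measurable_inner.
rewrite (cond_expectation_error cV Lh).
exact: (cond_expectation_inner_optimal Gm mU LU nU LX mc cB LY GY orth rZ Lh).
Qed.

(** The cosines of frequency 0 and N + 1, ..., 2N are orthogonal with squared norm 1 and 1/2;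
    dividing the errors by these gives 1/(256 M^2) plus the sum of the 1/(128 l^2). *)
Lemma cond_expectation_distance V : (4 <= N)%N -> cond_expectation P G (u 1) V ->
  (((M%:R^-1 + N%:R `^ (- 2^-1)) / 30)%:E <= L2_distance P (u 1) V)%E.
Proof.
move=> N4 cV; have [rV _ _] := cV.
(* Index 0 stands for the constant mode, and i >= 1 for the frequency N + i. *)
pose f (i : 'I_N.+1) : nat := if i == 0%N :> nat then 0%N else (N + i)%N.
pose l (i : 'I_N.+1) : R := if i == 0%N :> nat then (256 * M%:R ^+ 2)^-1 else (256 * (N + i)%:R ^+ 2)^-1.
apply: (@L2_distance_bessel _ _ _ _ (u 1) LX measurable_inner_state V _
  (fun i => cosn (f i)) (fun i => (mult (f i))^-1) l _ rV.1).
- by move=> h; exact: measurable_inner.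
- by move=> i; exact: cosn_L2.
- by move=> i; rewrite invr_gt0 mult_gt0.
- move=> i j; rewrite ip_cosn; case: (eqVneq i j) => [->|ij]; first by rewrite eqxx.
  case: ifP => // /eqP E; case/eqP: ij; apply: val_inj; move: E; rewrite /f.
  by do 2!case: eqP => /=; lia.
- move=> i; rewrite cond_expectation_error//; last exact: cosn_L2.
  rewrite /l /f; case: ifP => i0; first exact: low_mode_error.
  by apply: high_mode_error; lia.
- by rewrite divr_ge0// addr_ge0 ?invr_ge0// powR_ge0.
have -> : \sum_i l i / (mult (f i))^-1 = (256 * M%:R ^+ 2)^-1 + 128^-1 * \sum_(i < N) (((N + i.+1)%:R : R) ^+ 2)^-1.
  rewrite big_ord_recl /l /f /mult /= invr1 divr1; congr (_ + _).
  rewrite mulr_sumr; apply: eq_bigr => i _; rewrite /= /bump /= add1n.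
  rewrite (_ : (N + i.+1 == 0)%N = false) ?invrK; last by lia.
  have : ((N + i.+1)%:R : R) != 0 by rewrite pnatr_eq0; lia.
  by move: ((N + i.+1)%:R : R) => b b0; field.
have s := tail_square_sum R N4.
have n0 : 0 < N%:R :> R by rewrite ltr0n; lia.
have m0 : 0 < M%:R :> R by rewrite ltr0n.
have q : (N%:R `^ (- 2^-1)) ^+ 2 = N%:R^-1 :> R.
  by rewrite -powR_mulrn ?powR_ge0// -powRrM mulNr mulVf// powR_inv1// ltW.
move: s q; move: (N%:R `^ (- 2^-1)) (\sum_(i < N) _) => b S.
rewrite [(256 * _)^-1]invfM [(3 * _)^-1]invfM -exprVn; move: (M%:R^-1 : R) (N%:R^-1 : R) => a n s q.
(* Here a = 1/M and b^2 = 1/N. The square of a - b being nonnegative, (a + b)^2/900 <= (a^2 +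
   b^2)/450, below a^2/256 + b^2/384. *)
have := sqr_ge0 (a - b); rewrite sqrrB exprMn sqrrD q.
have := sqr_ge0 a; have := sqr_ge0 b; rewrite q.
move: s; move: (a ^+ 2) => a2; rewrite exprVn; nra.
Qed.

End LowerBound.

Theorem proposition2p9 (R : realType) (d : measure_display)
    (Omega : measurableType d) (P : probability Omega R)
    (xi : set (R * R) -> Omega -> R) (I : (R * R -> R) -> Omega -> R)
    (O u : R -> Omega -> R -> R)
    (Hxi : white_noise P xi)
    (HI : stochastic_integral P xi I)
    (HO : stochastic_convolution P I O)
    (Hu : mild_solution P xi O (fun v : R => v) (fun _ : R => 0) u) :
  exists K : nat, forall M N : nat, (K <= M)%N -> (K <= N)%N ->
    let G := sigma_fourier O M `[- N%:R, N%:R]%classic in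
    (exists V, cond_expectation P G (u 1) V) /\
    forall V, cond_expectation P G (u 1) V ->
      ereal_inf [set L2_distance P (u 1) Z | Z in
                  [set Z : Omega -> R -> R | L2T_random_variable G Z]]
        = L2_distance P (u 1) V
      /\ (((M%:R^-1 + N%:R `^ (- 2^-1)) / 30)%R%:E
            <= L2_distance P (u 1%R) V)%E.
Proof.
(* The threshold comes from [tail_square_sum]; for M it ensures positivity. *)
exists 4%N => M N M4 N4 G; have M0 : (0 < M)%N by exact: leq_trans M4.
split; first by exists (best O M N); exact: (best_cond_expectation Hxi HI HO Hu N M0).
move=> V cV; split; first exact: (cond_expectation_optimal Hxi HI HO Hu M0 cV).
exact: (cond_expectation_distance Hxi HI HO Hu M0 N4 cV).
Qed.
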